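(* Let $m\ge2$ and $f_1,\ldots,f_m\in\mathcal H^{\odot2}$. Then $$\kappa\bigl[\mathcal I^2(f_1),\ldots,\mathcal I^2(f_m)\bigr]=2^{m-1}\omega_m\sum_{\Gamma\in\mathcal M_{\mathrm C}(f_1,\ldots,f_m)}\operatorname{Tr}(\mathcal A_\Gamma),\qquad \omega_m=\begin{cases}1,&m=2,\\2,&m\ge3,\end{cases}$$ where $\operatorname{Tr}$ is the trace of operators on $\mathcal H$. Moreover, for $f\in\mathcal H^{\odot2}$, $$\kappa_m[\mathcal I^2(f)]=2^{m-1}(m-1)!\operatorname{Tr}(\mathcal A_f^m),$$ and the following change of chaos formula holds: $$\bigl(y^1\diamond\cdots\diamond y^m\bigr)\big|_{y^j=\mathcal I^2(f_j)}=\sum_{\Gamma\in\mathcal M_{\mathrm F}(f_1,\ldots,f_m)}2^{|V(\Gamma)|}\,\mathcal I^{2m-2|E(\Gamma)|}(f_\Gamma),$$ where $V(\Gamma)$ and $E(\Gamma)$ denote respectively the set of non-isolated vertices and the set of edges of $\Gamma$.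
   Context: $\mathcal H$ is a separable real Hilbert space and $W$ a centred isonormal Gaussian process over $\mathcal H$. $\mathcal H^{\odot n}\subset\mathcal H^{\otimes n}$ is the space of symmetric tensors, with norm $\|\cdot\|_{\mathcal H^{\odot n}}=\sqrt{n!}\,\|\cdot\|_{\mathcal H^{\otimes n}}$; $\operatorname{Sym}_n$ is symmetrisation and $u\odot v=\operatorname{Sym}(u\otimes v)$. $\mathcal I^n\colon\mathcal H^{\odot n}\to L^2(\Omega)$ is the isometry onto the $n$-th Wiener chaos (multiple Wiener integral), normalised so that $\mathcal I^n(h^{\odot n})$, for $\|h\|=1$, is the $n$-th monic Hermite polynomial in $W(h)$. For $f,g\in\mathcal H^{\otimes2}$ and an orthonormal basis $(e_k)$, $f\star g=\sum_{k,i,j}\langle f,e_i\otimes e_k\rangle\langle g,e_k\otimes e_j\rangle\,e_i\otimes e_j$; this product on $\mathcal H^{\otimes2}$ is associative. $\mathcal A_f\colon\mathcal H\to\mathcal H$ is the Hilbert–Schmidt operator associated with $f$: $\mathcal A_fh=\sum_{i,k}\langle f,e_i\otimes e_k\rangle\langle e_k,h\rangle e_i$. $\mathcal M_{\mathrm C}(f_1,\ldots,f_m)$ is the set of (undirected) cycles with vertex set $\{1,\ldots,m\}$ (vertex $i$ decorated by $f_i$): for $m=2$ it has a single element, two vertices joined by two parallel edges; for $m\ge3$ it consists of the $(m-1)!/2$ cycles through all $m$ labelled vertices. If $\Gamma=(m\to i_1\to\cdots\to i_{m-1}\to m)$ for a choice of orientation, $\mathcal A_\Gamma=\mathcal A_{f_{i_{m-1}}}\cdots\mathcal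 A_{f_{i_1}}\mathcal A_{f_m}$ (its trace does not depend on the orientation). $\mathcal M_{\mathrm F}(f_1,\ldots,f_m)$ is the set of linear forests on $\{1,\ldots,m\}$: graphs whose connected components are paths, including trivial one-vertex paths (the forest without edges is included). If $\Gamma$ has components $\Gamma_l=(j^l_1\to\cdots\to j^l_{n_l})$, $l=1,\ldots,k$, then $$f_\Gamma=\operatorname{Sym}_2(f_{j^1_1}\star\cdots\star f_{j^1_{n_1}})\odot\cdots\odot\operatorname{Sym}_2(f_{j^k_1}\star\cdots\star f_{j^k_{n_k}})\in\mathcal H^{\odot2k}$$ (a one-vertex component contributes $f_{j^l_1}$); this does not depend on the orientations. $\kappa[\cdots]$ is the joint cumulant and $\kappa_m$ the $m$-th cumulant. The Wick product $\diamond$ is the one intrinsic to the linear span of the second-chaos variables considered; explicitly, with $Y^j=\mathcal I^2(f_j)$, $$(y^1\diamond\cdots\diamond y^m)\big|_{y^j=Y^j}=\sum_{J\subset\{1,\ldots,m\}}\Bigl(\prod_{j\in J}Y^j\Bigr)\sum_{\pi}(-1)^{|\pi|}\prod_{B\in\pi}\kappa[Y^b:b\in B],$$ where $\pi$ runs over partitions of $\{1,\ldots,m\}\setminus J$ into non-empty blocks. *)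

(* Defs.v *)
From HB Require Import structures.
From mathcomp Require Export all_boot all_order all_fingroup all_algebra.
From mathcomp Require Export all_classical all_reals all_analysis.
Set Implicit Arguments.
Unset Strict Implicit.
Unset Printing Implicit Defensive.
Export Order.TTheory GRing.Theory Num.Theory.
Export numFieldNormedType.Exports.
#[export] Unset Printing Implicit Defensive.
Local Open Scope classical_set_scope.
Local Open Scope ring_scope.

Definition separable (T : topologicalType) : Prop :=
  exists D : set T, countable D /\ dense D.

(* An orthonormal basis of a separable Hilbert space is indexed by nat; in
   finite dimension it is padded by zero vectors, which do not contribute to
   any of the sums below. *)
Definition orthonormal_basis (R : realType) (H : completeNormedModType R)
    (ip : {dot H for idfun}) (e : nat -> H) : Prop :=
  [/\ forall i j, i != j -> ip (e i) (e j) = 0,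
      forall i, `|e i| = 1 \/ e i = 0
    & forall x, series (fun k => ip (e k) x *: e k) @ \oo --> x].

(* The Hilbert tensor power of order n is realised as the space of bounded
   n-linear Hilbert-Schmidt forms on H: f stands for
   (h_1, .., h_n) |-> <f, h_1 (x) .. (x) h_n>. *)
Definition form (R : realType) (H : completeNormedModType R) (n : nat) : Type :=
  ('I_n -> H) -> R.

Section Tensors.
Context {R : realType} {H : completeNormedModType R}.
Variables (ip : {dot H for idfun}) (e : nat -> H).

Definition multilinear_form n (f : form H n) : Prop :=
  forall (h : 'I_n -> H) (i : 'I_n), scalar (fun x => f [eta h with i |-> x]).

Definition bounded_form n (f : form H n) : Prop :=
  exists C : R, forall h, `|f h| <= C * \prod_(i < n) `|h i|.

(* Squared norm in the (unsymmetrised) tensor power. *)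
Definition tensor_sqnorm n (f : form H n) : \bar R :=
  (\esum_(k in [set: {ffun 'I_n -> nat}]) (f (fun i => e (k i)) ^+ 2)%:E)%E.

Definition tensor n (f : form H n) : Prop :=
  [/\ multilinear_form f, bounded_form f & (tensor_sqnorm f < +oo)%E].

Definition symmetric_tensor n (f : form H n) : Prop :=
  tensor f /\ forall (s : 'S_n) h, f (h \o s) = f h.

Definition tensor_power (h : H) n : form H n := fun x => \prod_(i < n) ip h (x i).

Definition Sym n (f : form H n) : form H n :=
  fun h => n`!%:R^-1 * \sum_(s : 'S_n) f (h \o s).

Definition tensor_prod p q (f : form H p) (g : form H q) : form H (p + q) :=
  fun h => f (h \o @lshift p q) * g (h \o @rshift p q).

Definition sym_prod p q (f : form H p) (g : form H q) : form H (p + q) :=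
  Sym (tensor_prod f g).

Definition pair2 (x y : H) : 'I_2 -> H := fun i => if i == ord0 then x else y.

Definition star (f g : form H 2) : form H 2 := fun h =>
  limn (series (fun i => limn (series (fun j =>
    limn (series (fun k => f (pair2 (e i) (e k)) * g (pair2 (e k) (e j))))
    * (ip (e i) (h ord0) * ip (e j) (h ord_max)))))).

Definition HS_op (f : form H 2) (h : H) : H :=
  limn (series (fun i =>
    limn (series (fun k => f (pair2 (e i) (e k)) * ip (e k) h)) *: e i)).

Definition trace (A : H -> H) : R := limn (series (fun k => ip (e k) (A (e k)))).

(* The iterated symmetric product of a list of 2-tensors; 1 is the unit of the
   symmetric product, in the tensor power of order 0. *)
Fixpoint sym_bigprod (l : seq (form H 2)) : form H (size l * 2) :=
  match l return form H (size l * 2) with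
  | [::] => fun=> 1
  | f :: l' => sym_prod f (@sym_bigprod l')
  end.

(* Transport along an equality of orders, as conform_mx does for matrices. *)
Definition conform_form n n' (f : form H n) : form H n' :=
  match n =P n' with
  | ReflectT eq_n => fun h => f (h \o cast_ord eq_n)
  | ReflectF _ => fun=> 0
  end.

End Tensors.

Arguments conform_form {R H n} n' f _.

Section Graphs.
Variable m : nat.

(* The multiplicity of every edge. *)
Definition multigraph : finType := {ffun {set 'I_m} -> 'I_m.+1}.

Definition cycle_edges (s : seq 'I_m) : seq {set 'I_m} :=
  [seq [set p.1; p.2]%SET | p <- zip s (rot 1 s)].

Definition cycle_graph (s : seq 'I_m) : multigraph :=
  [ffun E => inord (count_mem E (cycle_edges s))].

Definition cycles : {set multigraph} :=
  [set cycle_graph s | s : m.-tuple 'I_m & uniq s]%SET.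

(* s lists the vertices of G in cyclic order, starting from the last vertex
   (the vertex m of {1, .., m} is m.-1 in 'I_m). *)
Definition cycle_orientation (G : multigraph) (s : seq 'I_m) : bool :=
  [&& uniq s, size s == m, ohead [seq val i | i <- s] == Some m.-1
    & cycle_graph s == G].

Definition path_edges (s : seq 'I_m) : seq {set 'I_m} :=
  [seq [set p.1; p.2]%SET | p <- zip s (behead s)].

(* c lists the connected components of the graph with edge set G, all of them
   being paths (listed in one of their two orientations). *)
Definition path_decomposition (G : {set {set 'I_m}}) (c : seq (seq 'I_m)) : bool :=
  [&& [::] \notin c, perm_eq (flatten c) (enum 'I_m)
    & G == [set E in flatten (map path_edges c)]%SET].

Definition linear_forests : {set {set {set 'I_m}}} :=
  [set G : {set {set 'I_m}} | `[< exists c, path_decomposition G c >]]%SET.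

Definition non_isolated (G : {set {set 'I_m}}) : {set 'I_m} := finset.cover G.

Lemma mem_path_edges (E : {set 'I_m}) s (x : 'I_m) :
  E \in path_edges s -> x \in E -> x \in s.
Proof.
case: s => [|a s] //=; rewrite /path_edges /=.
elim: s a => [|b s IH] a //=; rewrite inE => /orP[/eqP->|/IH{}IH xE].
  by rewrite !inE => /orP[]/eqP->; rewrite eqxx ?orbT.
by rewrite inE IH ?orbT.
Qed.

Lemma path_edges_neq0 (E : {set 'I_m}) s : E \in path_edges s -> E != finset.set0.
Proof. by case/mapP=> p _ ->; apply/set0Pn; exists p.1; rewrite !inE eqxx. Qed.

Lemma uniq_path_edges s : uniq s -> uniq (path_edges s).
Proof.
case: s => [|a s] //; rewrite /path_edges /=.
elim: s a => [|b s IH] a //= /andP[aN us]; rewrite IH // andbT.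
apply: contra aN => /(@mem_path_edges _ (b :: s) a); apply.
by rewrite !inE eqxx.
Qed.

(* The number of components is the number of vertices minus that of edges, so
   that the tensor attached to a linear forest has order 2m - 2|E|. *)
Lemma path_decomposition_size G c :
  path_decomposition G c -> (size c * 2 = 2 * m - 2 * #|G|)%N.
Proof.
case/and3P=> cN pc /eqP->.
have szc : size (flatten c) = m by rewrite (perm_size pc) size_enum_ord.
have uc : uniq (flatten c) by rewrite (perm_uniq pc) enum_uniq.
suff [ue se] : uniq (flatten (map path_edges c)) /\
    (size (flatten (map path_edges c)) + size c = size (flatten c))%N.
  by rewrite cardsE (card_uniqP ue); move: se; rewrite szc;
    move: (size (flatten _)) (size c) => a b <-; rewrite mulnDr addKn mulnC.
elim: c cN uc {pc szc} => [|s c IH] //=; rewrite inE negb_or => /andP[sN cN].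
rewrite !cat_uniq !size_cat => /and3P[us dis uc].
have [ue <-] := IH cN uc; split; last first.
  case: s sN {us dis} => //= a s _; rewrite size_map size_zip /=.
  by rewrite (minn_idPr (leqnSn _)) addSn addnS addnA.
rewrite uniq_path_edges // ue andbT /=; apply/hasPn => E /flatten_mapP[t tc Et].
apply/negP => Es; have /set0Pn[x xE] := path_edges_neq0 Et.
move/hasPn: dis => /(_ x); rewrite (mem_path_edges Es xE) /= => dis.
suff /dis : x \in flatten c by [].
by apply/flattenP; exists t => //; exact: (mem_path_edges Et xE).
Qed.

End Graphs.

(* vertices m -> i_1 -> .. -> i_(m-1) give A_(i_(m-1)) o .. o A_(i_1) o A_m *)
Definition cycle_op (R : realType) (H : completeNormedModType R)
    (ip : {dot H for idfun}) (e : nat -> H) m (f : 'I_m -> form H 2)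
    (s : seq 'I_m) : H -> H :=
  fun h => foldl (fun x i => HS_op ip e (f i) x) h s.

Definition path_tensor (R : realType) (H : completeNormedModType R)
    (ip : {dot H for idfun}) (e : nat -> H) m (f : 'I_m -> form H 2)
    (s : seq 'I_m) : form H 2 :=
  match s with
  | [::] => fun=> 0
  | j :: s' => Sym (foldl (star ip e) (f j) [seq f i | i <- s'])
  end.

Definition forest_tensor (R : realType) (H : completeNormedModType R)
    (ip : {dot H for idfun}) (e : nat -> H) m (f : 'I_m -> form H 2)
    (c : seq (seq 'I_m)) :=
  @sym_bigprod R H [seq path_tensor ip e f s | s <- c].

Arguments forest_tensor [R H] ip e [m] f c _.

Section Chaos.
Context {R : realType} {H : completeNormedModType R}.
Context {d : measure_display} {Omega : measurableType d}.
Variables (P : probability Omega R) (ip : {dot H for idfun}) (e : nat -> H).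

(* normal_prob 0 s is Gaussian only for s != 0. *)
Definition centred_gaussian (X : Omega -> R) : Prop :=
  (exists2 s : R, s != 0 &
     forall A : set R, measurable A -> P (X @^-1` A) = normal_prob 0 s A) \/
  {ae P, forall w, X w = 0}.

Definition isonormal (W : H -> {RV P >-> R}) : Prop :=
  (forall n (h : 'I_n -> H) (c : 'I_n -> R),
     centred_gaussian (fun w => \sum_(i < n) c i * W (h i) w)) /\
  (forall g h, ('E_P[fun w => (W g w * W h w)%R] = (ip g h)%:E)%E).

(* Monic (probabilists') Hermite polynomials. *)
Fixpoint hermite (n : nat) : {poly R} :=
  if n is n'.+1 then 'X * hermite n' - (hermite n')^`() else 1.

(* Closed linear span, in L^2, of the H_n(W h) with |h| = 1. *)
Definition wiener_chaos (W : H -> {RV P >-> R}) n (X : {RV P >-> R}) : Prop :=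
  forall eps : R, 0 < eps ->
    exists k (c : 'I_k -> R) (h : 'I_k -> H), (forall i, `|h i| = 1) /\
      ('E_P[fun w => ((X w - \sum_(i < k) c i * (hermite n).[W (h i) w]) ^+ 2)%R]
         < eps%:E)%E.

(* I is the multiple integral of order n: the linear isometry from the
   symmetric tensors, with norm sqrt(n!) |.|, onto the n-th chaos (random
   variables being identified when almost surely equal) mapping h^(x)n to
   H_n(W h) for |h| = 1. *)
Definition multiple_integral (W : H -> {RV P >-> R}) n
    (I : form H n -> {RV P >-> R}) : Prop :=
  [/\ forall (a : R) f g, symmetric_tensor e f -> symmetric_tensor e g ->
        {ae P, forall w, I (fun h => a * f h + g h) w = a * I f w + I g w},
      forall f, symmetric_tensor e f ->
        ('E_P[fun w => (I f w ^+ 2)%R] = n`!%:R%:E * tensor_sqnorm e f)%E,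
      forall f, symmetric_tensor e f -> wiener_chaos W n (I f),
      forall X, wiener_chaos W n X ->
        exists2 f, symmetric_tensor e f & {ae P, forall w, X w = I f w}
    & forall h, `|h| = 1 ->
        {ae P, forall w, I (tensor_power ip h (n := n)) w = (hermite n).[W h w]}].

(* Joint cumulant of the Y j, j in B, for B non-empty. *)
Definition cumulant (J : finType) (Y : J -> Omega -> R) (B : {set J}) : R :=
  \sum_(pi : {set {set J}} | finset.partition pi B)
    (-1) ^+ #|pi|.-1 * (#|pi|.-1)`!%:R *
    \prod_(C in pi) fine ('E_P[fun w => (\prod_(j in C) Y j w)%R])%E.

Definition wick_product m (Y : 'I_m -> Omega -> R) (w : Omega) : R :=
  \sum_(J : {set 'I_m}) (\prod_(j in J) Y j w) *
    \sum_(pi : {set {set 'I_m}} | finset.partition pi (~: J)%SET)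
      (-1) ^+ #|pi| * \prod_(B in pi) cumulant Y B.

End Chaos.

(* Main.v *)
Require Import Defs.
From mathcomp Require Import ring lra zify.
From mathcomp Require Import measurable_realfun.
Set Implicit Arguments.
Unset Strict Implicit.
Unset Printing Implicit Defensive.

(** The random variables [I 2 (f j)] generate an algebra in which everything can
    be computed from one product formula. Multiplying [I 2 f] by the integral of
    a symmetric product of 2-tensors [F i] gives the integral of the product with
    [f] adjoined, plus terms where [f] is contracted with one factor, with one
    factor twice (a trace), or with two different factors ([product_formula]).
    Contracting once replaces [F i] by the symmetrised [f * F i], that is, it
    prolongs a path at an end; contracting with two factors joins two paths
    through [f]; contracting twice with the same factor closes a cycle.

    The product formula is proved by density. On squares of vectors both sides
    are Wick monomials of Gaussian variables, indexed by labels, and it is a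
    pointwise identity between polynomials ([gw_square_mul]). Both sides are
    linear and L1-continuous in each tensor ([L1bounded_density]), the continuity
    coming from the bounds of [star] and of the trace in Hilbert-Schmidt norm.
    The link with Hermite polynomials is [I_pure], obtained from the values of
    the integrals on powers by polarisation; that integrals of even order are
    centred ([E_I]) comes from the recursion and the norms of Hermite
    polynomials.

    Let [block_tensor B] be the sum of [2 ^ (|B| - 1)] times the path tensors of
    all orderings of [B]. The place of a vertex [a] in a path gives a recursion
    for [block_tensor (a |: B)] ([block_setU1]) whose three terms match
    the terms without trace of the product formula. Hence the sum
    [blockI A], over all set partitions of [A], of the integrals of the products
    of block tensors satisfies ([I2_blockI])
      [I 2 (f a) * blockI J = blockI (a |: J)
         + \sum_(B \subset J) 2 * tr2 (f a) (block_tensor B) * blockI (J :\: B)].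
    Wick products satisfy the same recursion with the joint cumulant of
    [a |: B] in place of the trace ([wickf_setU1]), and [blockI J] is centred
    unless [J] is empty. By a joint induction ([wick_blockI]) the Wick product
    is [blockI], and the joint cumulant of [a |: B] is
    [2 * tr2 (f a) (block_tensor B)]. The combinatorial relations between
    moments, cumulants and Wick products are the calculus of exponentials and
    logarithms of set functions.

    What remains is counting. The trace is a sum over the orderings of [B],
    closed up at [a]; each cycle arises from an ordering and from its reversal
    ([sum_cycles]), which coincide for two vertices only. For a single tensor
    all [(m - 1)!] orderings contribute the same trace. In the same way the
    orderings of the blocks of a set partition list every linear forest once for
    each choice of orientations of its components, and the powers of 2 add up to
    the number of non-isolated vertices ([forest_sum]). *)

Local Open Scope ring_scope.

(** * Set functions, set partitions and their exponential calculus *)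

Section SubsetSums.
Import boot.fintype boot.finset.
Variables (V : finType) (M : nmodType).
Implicit Types (A B C D : {set V}) (a : V) (pi : {set {set V}}).

Lemma sum_subsetU1 a A (g : {set V} -> M) : a \notin A ->
  \sum_(B : {set V} | B \subset a |: A) g B =
  \sum_(B : {set V} | B \subset A) g B + \sum_(B : {set V} | B \subset A) g (a |: B).
Proof.
move=> aA; rewrite (bigID (fun B : {set V} => a \in B)) /= addrC; congr (_ + _).
  apply: eq_bigl => B; apply/andP/idP => [[BA aB]|BA].
    by apply/subsetP => x xB; move: (subsetP BA x xB) aB;
       rewrite !inE => /orP[/eqP<-|//]; rewrite xB.
  split; first exact: subset_trans BA (subsetU1 _ _).
  by apply: contra aA; apply: (subsetP BA).
rewrite (reindex_onto (fun B => a |: B) (fun B => B :\ a)) /=; last first.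
  by move=> B /andP[_ aB]; rewrite setD1K.
apply: eq_bigl => B; rewrite setU11 andbT; apply/andP/idP => [[BA /eqP <-]|BA].
  by rewrite subDset.
have aB : a \notin B by apply: contra aA; apply: (subsetP BA).
by rewrite setUS // setU1K.
Qed.

Lemma sum_subset_subset A (g : {set V} -> {set V} -> M) :
  \sum_(B : {set V} | B \subset A) \sum_(C : {set V} | C \subset B) g C (B :\: C) =
  \sum_(C : {set V} | C \subset A) \sum_(D : {set V} | D \subset A :\: C) g C D.
Proof.
rewrite !pair_big_dep /=.
rewrite (reindex_onto (fun p => (p.1 :|: p.2, p.1)) (fun q => (q.2, q.1 :\: q.2))) /=;
  last first.
  move=> [B C] /= /andP[_ CB]; congr pair.
  by rewrite -[RHS](setID B C) (setIidPr CB).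
apply: eq_big => [[C D]|[C D] /andP[_ /eqP[->]]] //=.
rewrite subUset subsetUl andbT subsetD -andbA xpair_eqE eqxx /=.
congr (_ && (_ && _)); rewrite setDUl setDv set0U.
exact/eqP/setDidPl.
Qed.

(** Marking a block [B] of a set partition leaves a set partition of the
    complement of [B]. *)
Lemma sum_partition_block A (g : {set V} -> {set {set V}} -> M) :
  \sum_(pi : {set {set V}} | partition pi A) \sum_(B in pi) g B (pi :\ B) =
  \sum_(B : {set V} | (B != set0) && (B \subset A))
     \sum_(pi : {set {set V}} | partition pi (A :\: B)) g B pi.
Proof.
rewrite !pair_big_dep /=.
rewrite (reindex_onto (fun p => (p.1 |: p.2, p.1)) (fun q => (q.2, q.1 :\ q.2))) /=;
  last first.
  by move=> [pi B] /= /andP[_ Bpi]; rewrite setD1K.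
apply: eq_big => [[B pi]|[B pi] /andP[_ /eqP[->]]] //=.
rewrite setU11 andbT xpair_eqE eqxx /=.
apply/andP/andP => [[piA /eqP E]|[/andP[B0 BA] piA]].
  rewrite (partition_neq0 piA) ?setU11 // (partitionS piA) ?setU11 //.
  by split=> //; rewrite -E (partitionD1 piA) ?setU11.
split; last first.
  rewrite setU1K //; apply/negP => Bpi; move/set0Pn: B0 => [x xB].
  by move: (subsetP (partitionS piA Bpi) x xB); rewrite !inE xB.
rewrite -[A](setID A B) (setIidPr BA) partitionU1 //.
by rewrite disjoint_sym disjoints_subset subDset setUCr subsetT.
Qed.

(** The block containing a given point [a] is [a |: B] for an arbitrary [B]. *)
Lemma sum_partition_at a A (g : {set {set V}} -> M) : a \notin A ->
  \sum_(pi : {set {set V}} | partition pi (a |: A)) g pi =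
  \sum_(B : {set V} | B \subset A)
     \sum_(pi : {set {set V}} | partition pi (A :\: B)) g ((a |: B) |: pi).
Proof.
move=> aA; transitivity (\sum_(pi : {set {set V}} | partition pi (a |: A))
   \sum_(B in pi) if a \in B then g (B |: (pi :\ B)) else 0).
  apply: eq_bigr => pi piA.
  have [B Bpi aB] : exists2 B, B \in pi & a \in B.
    apply/bigcupP; rewrite -/(cover pi) (cover_partition piA); exact: setU11.
  rewrite (bigD1 B) //= aB setD1K // big1 ?addr0 // => C /andP[Cpi CB].
  case: ifP => // aC; have /trivIsetP/(_ C B Cpi Bpi CB) := partition_trivIset piA.
  by rewrite -setI_eq0 => /eqP/setP/(_ a); rewrite !inE aC aB.
rewrite (sum_partition_block _ (fun B pi => if a \in B then g (B |: pi) else 0)).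
rewrite big_mkcondl /= sum_subsetU1 // big1 ?add0r => [|B BA]; last first.
  case: ifP => // _; rewrite big1 // => pi _; rewrite ifN //.
  by apply: contra aA; apply: (subsetP BA).
apply: eq_bigr => B BA; rewrite ifT; last by apply/set0Pn; exists a; rewrite setU11.
rewrite setU11; apply: eq_bigl => pi; congr (partition _ _).
apply/setP => x; rewrite !inE; case: eqP => //= ->.
by rewrite (negPf aA) andbF.
Qed.

End SubsetSums.

Section SetFunctions.
Import boot.fintype boot.finset.
Variables (V : finType) (R : comPzRingType).
Implicit Types (A B C D : {set V}) (a : V) (pi : {set {set V}}).
Implicit Types (F G K : {set V} -> R).

(** Product of set functions: the ring they form is that of power series in
    square-zero variables indexed by [V], so that [expp] below is an
    exponential, [fun A => F (a |: A)] is the derivative in the variable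
    [a], and joint cumulants become the logarithm of joint moments. *)
Definition conv F G A : R := \sum_(B : {set V} | B \subset A) F B * G (A :\: B).

(** The exponential of [K] for the product [conv]. *)
Definition expp K A : R :=
  \sum_(pi : {set {set V}} | partition pi A) \prod_(B in pi) K B.

(** At a sample point where the variables take the values [x], the Wick
    product attached to the family [K] of cumulants. *)
Definition wickf (x : V -> R) K : {set V} -> R :=
  conv (fun A => \prod_(j in A) x j) (expp (fun B => - K B)).

Lemma eq_conv F F' G G' A : (forall B, B \subset A -> F B = F' B) ->
  (forall B, B \subset A -> G B = G' B) -> conv F G A = conv F' G' A.
Proof. by move=> eF eG; apply: eq_bigr => B BA; rewrite eF // eG // subsetDl. Qed.

Lemma convC F G A : conv F G A = conv G F A.
Proof.
rewrite /conv (reindex_onto (fun B => A :\: B) (fun B => A :\: B)) /=; last first.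
  by move=> B BA; rewrite setDDr setDv set0U (setIidPr BA).
apply: eq_big => [B|B /andP[_ /eqP ->]]; last by rewrite mulrC.
rewrite subsetDl /=; apply/eqP/idP => [<-|BA]; first exact: subsetDl.
by rewrite setDDr setDv set0U (setIidPr BA).
Qed.

Lemma convA F G K A : conv F (conv G K) A = conv (conv F G) K A.
Proof.
rewrite /conv; under [RHS]eq_bigr do rewrite mulr_suml.
under [LHS]eq_bigr do rewrite mulr_sumr.
rewrite -(sum_subset_subset A (fun B C => F B * (G C * K (A :\: B :\: C)))).
apply: eq_bigr => B BA; apply: eq_bigr => C CB; rewrite mulrA.
rewrite setDDl; congr (_ * K (_ :\: _)).
by rewrite -{2}(setID B C) (setIidPr CB).
Qed.

(** The Leibniz rule: [a] belongs to exactly one of the two factors. *)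
Lemma conv_setU1 F G a A : a \notin A ->
  conv F G (a |: A) =
  conv (fun B => F (a |: B)) G A + conv F (fun B => G (a |: B)) A.
Proof.
move=> aA; rewrite /conv sum_subsetU1 // addrC; congr (_ + _).
  apply: eq_bigr => B BA; congr (_ * G _); apply/setP => x; rewrite !inE.
  by case: eqP => //= ->; rewrite (negPf aA) andbF.
apply: eq_bigr => B BA; congr (_ * G _); apply/setP => x; rewrite !inE.
by case: eqP => //= ->; rewrite andbT; apply: contra aA; apply: (subsetP BA).
Qed.

Lemma conv0 F G : conv F G set0 = F set0 * G set0.
Proof.
rewrite /conv (big_pred1 set0) ?set0D // => B /=.
by rewrite subset0.
Qed.

Lemma conv_1 F A : conv F (fun B => (B == set0)%:R) A = F A.
Proof.
rewrite /conv (bigD1 A) //= setDv eqxx mulr1 big1 ?addr0 // => B /andP[BA nBA].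
case: eqP; rewrite ?mulr0 // => /eqP; rewrite setD_eq0 => AB.
by rewrite eqEsubset BA AB in nBA.
Qed.

Lemma expp0 K : expp K set0 = 1.
Proof.
rewrite /expp (big_pred1 set0) ?big_set0 // => pi /=.
by rewrite partition_set0.
Qed.

(** The derivative of an exponential, [a] being in some block. *)
Lemma expp_setU1 K a A : a \notin A ->
  expp K (a |: A) = conv (fun B => K (a |: B)) (expp K) A.
Proof.
move=> aA; rewrite /expp sum_partition_at //; apply: eq_bigr => B BA.
rewrite mulr_sumr; apply: eq_bigr => pi piA; rewrite big_setU1 //=.
apply/negP => /(partitionS piA)/subsetP/(_ a).
by rewrite !inE eqxx (negPf aA) andbF => /(_ isT).
Qed.

(** Both derivatives of the product cancel, as for the exponentials of [K]
    and [- K]. *)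
Lemma exppN K A : conv (expp K) (expp (fun B => - K B)) A = (A == set0)%:R.
Proof.
have [->|[a aA]] := set_0Vmem A; first by rewrite conv0 !expp0 mul1r eqxx.
rewrite -(setD1K aA) conv_setU1 ?setD11 //.
rewrite (_ : (a |: A :\ a == set0) = false); last first.
  by apply/negbTE/set0Pn; exists a; rewrite setU11.
have aB B : B \subset A :\ a -> a \notin B.
  by move=> BA; apply/negP => /(subsetP BA); rewrite setD11.
rewrite (@eq_conv _ (conv (fun B => K (a |: B)) (expp K)) (expp (fun B => - K B))
  (expp (fun B => - K B))) => [|B BA|//]; last by rewrite expp_setU1 // aB.
rewrite (@eq_conv (expp K) (expp K) _ (conv (fun B => - K (a |: B)) (expp (fun B => - K B))))
  => [|//|B BA]; last by rewrite expp_setU1 // aB.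
rewrite convA (@eq_conv (conv (expp K) (fun B => - K (a |: B)))
  (conv (fun B => - K (a |: B)) (expp K)) (expp (fun B => - K B)) (expp (fun B => - K B)))
  => [|B _|//]; last by rewrite convC.
rewrite -!convA /conv -big_split /= big1 // => B _.
by rewrite mulNr subrr.
Qed.

Lemma wickf0 x K : wickf x K set0 = 1.
Proof. by rewrite /wickf conv0 expp0 big_set0 mulr1. Qed.

(** Both factors of a Wick product are differentiated at [a]. *)
Lemma wickf_setU1 x K a A : a \notin A ->
  wickf x K (a |: A) = x a * wickf x K A - conv (fun B => K (a |: B)) (wickf x K) A.
Proof.
move=> aA; rewrite /wickf conv_setU1 //; congr (_ + _).
  rewrite /conv mulr_sumr; apply: eq_bigr => B BA.
  by rewrite big_setU1 ?mulrA //; apply: contra aA; apply: (subsetP BA).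
rewrite convA (@eq_conv (conv (fun B => K (a |: B)) (fun B => \prod_(j in B) x j))
   (conv (fun B => \prod_(j in B) x j) (fun B => K (a |: B)))
   (expp (fun B => - K B)) (expp (fun B => - K B))) => [|B _|//]; last by rewrite convC.
rewrite -convA /conv -sumrN; apply: eq_bigr => B BA; rewrite -mulrN; congr (_ * _).
rewrite expp_setU1 ?inE ?(negPf aA) ?andbF // /conv -sumrN.
by apply: eq_bigr => C _; rewrite mulNr.
Qed.

(** Inversion of the definition of the Wick product: the exponential of [-
    K] is inverted by that of [K]. *)
Lemma prod_wickf x K A : \prod_(j in A) x j = conv (expp K) (wickf x K) A.
Proof.
rewrite /wickf convA.
rewrite (@eq_conv (conv (expp K) (fun A => \prod_(j in A) x j))
  (conv (fun A => \prod_(j in A) x j) (expp K)) (expp (fun B => - K B))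
  (expp (fun B => - K B))) => [|B _|//]; last by rewrite convC.
rewrite -convA -[LHS](conv_1 (fun A => \prod_(j in A) x j)); apply: eq_conv => // B _; by rewrite exppN.
Qed.

End SetFunctions.

Section Cumulants.
Import boot.fintype boot.finset.
Variables (V : finType) (R : comPzRingType).
Implicit Types (A B C D : {set V}) (a : V) (pi : {set {set V}}).
Variable M : {set V} -> R.

(** With [M] the joint moments, these are the joint cumulants: the
    coefficients are those of the power series of the logarithm. *)
Definition logp A : R :=
  \sum_(pi : {set {set V}} | partition pi A)
    (-1) ^+ #|pi|.-1 * (#|pi|.-1)`!%:R * \prod_(B in pi) M B.

(** The inverse of [M] for [conv], expanded as a geometric series in the
    blocks. *)
Definition invp A : R :=
  \sum_(pi : {set {set V}} | partition pi A)
    (-1) ^+ #|pi| * (#|pi|)`!%:R * \prod_(B in pi) M B.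

Hypothesis M0 : M set0 = 1.

(** Marking a block of a partition into [k] blocks turns the sum over [M]
    times its inverse into [k] times the term of the same partition, with
    the opposite sign. *)
Lemma conv_invp A : conv M invp A = (A == set0)%:R.
Proof.
have [->|A0] := eqVneq A set0.
  rewrite conv0 M0 mul1r /invp (big_pred1 set0) => [|pi]; last by rewrite partition_set0.
  by rewrite cards0 big_set0 fact0 expr0 !mulr1.
rewrite /conv (bigD1 set0) ?sub0set //= M0 mul1r setD0.
have := sum_partition_block A (fun B pi => M B * ((-1) ^+ #|pi| * (#|pi|)`!%:R * \prod_(B in pi) M B)).
under [in RHS]eq_bigr do rewrite -mulr_sumr.
rewrite [in RHS](eq_bigl (fun B : {set V} => (B \subset A) && (B != set0))); last first.
  by move=> B; rewrite andbC.
move=> <-; rewrite /invp -big_split /= big1 // => pi piA.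
rewrite [X in _ + X](_ : _ = #|pi|%:R * ((-1) ^+ #|pi|.-1 * (#|pi|.-1)`!%:R * \prod_(B in pi) M B)).
  have : (0 < #|pi|)%N.
    rewrite card_gt0; apply: contra A0 => /eqP pi0; rewrite pi0 in piA.
    by rewrite -(cover_partition piA) /cover big_set0.
  case: #|pi| => //= n _; rewrite factS natrM exprS; move: (_ ^+ n) => u.
  by rewrite !mulrA !mulNr mul1r [n.+1%:R * u]mulrC addNr.
rewrite mulr_natl -sumr_const; apply: eq_bigr => B Bpi.
rewrite (cardsD1 B pi) Bpi add1n /= [in RHS](big_setD1 B Bpi) /=.
by rewrite mulrCA.
Qed.

(** The derivative of the logarithm times [M] is the derivative of [M]:
    removing the block of [a] from the terms of [logp] leaves the terms of
    the inverse of [M]. *)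
Lemma conv_logp a A : a \notin A -> conv (fun B => logp (a |: B)) M A = M (a |: A).
Proof.
move=> aA.
rewrite (@eq_conv _ _ _ (conv (fun C => M (a |: C)) invp) M M) => [|B BA|//];
  last first.
  have aB : a \notin B by apply: contra aA; apply: (subsetP BA).
  rewrite /logp sum_partition_at //; apply: eq_bigr => C CB; rewrite /invp mulr_sumr.
  apply: eq_bigr => pi piB; have nC : a |: C \notin pi.
    apply/negP => /(partitionS piB)/subsetP/(_ a).
    by rewrite !inE eqxx (negPf aB) andbF => /(_ isT).
  by rewrite cardsU1 nC /= add0n big_setU1 //= mulrCA.
rewrite -convA (@eq_conv _ _ (fun C => M (a |: C)) (fun C => M (a |: C)) _
  (fun B => (B == set0)%:R)) ?conv_1 // => B _.
by rewrite convC conv_invp.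
Qed.

(** Exponential and logarithm satisfy the same differential equation. *)
Lemma expp_logp A : expp logp A = M A.
Proof.
have [n] := ubnP #|A|; elim: n => // n IH in A *; rewrite ltnS => An.
have [->|[a aA]] := set_0Vmem A; first by rewrite expp0 M0.
rewrite -(setD1K aA) expp_setU1 ?setD11 // -conv_logp ?setD11 //.
apply: eq_conv => // B BA; apply: IH; apply: leq_ltn_trans (subset_leq_card BA) _.
by move: An; rewrite (cardsD1 a) aA.
Qed.

End Cumulants.

(** * Polarisation *)

Section Multilinear.
Variables (R : numFieldType) (M : lmodType R).

Definition mlin n (T : ('I_n -> M) -> R) :=
  forall (h : 'I_n -> M) i, scalar (fun x => T [eta h with i |-> x]).

Definition fcons n (x : M) (h : 'I_n -> M) : 'I_n.+1 -> M :=
  fun i => oapp h x (unlift ord0 i).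

Lemma fcons0 n x (h : 'I_n -> M) : fcons x h ord0 = x.
Proof. by rewrite /fcons unlift_none. Qed.

Lemma fconsS n x (h : 'I_n -> M) i : fcons x h (lift ord0 i) = h i.
Proof. by rewrite /fcons liftK. Qed.

Lemma fcons_upd0 n x y (h : 'I_n -> M) : [eta fcons x h with ord0 |-> y] = fcons y h :> ('I_n.+1 -> M).
Proof.
apply/funext => i /=; case: (unliftP ord0 i) => [j|] ->; rewrite ?eqxx ?fcons0 //.
by rewrite eq_sym (negPf (neq_lift _ _)) !fconsS.
Qed.

Lemma fcons_updS n x y (h : 'I_n -> M) i :
  [eta fcons x h with lift ord0 i |-> y] = fcons x [eta h with i |-> y] :> ('I_n.+1 -> M).
Proof.
apply/funext => j /=; case: (unliftP ord0 j) => [k|] ->.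
  by rewrite !fconsS /= (inj_eq (@lift_inj _ _)).
by rewrite (negPf (neq_lift _ _)) !fcons0.
Qed.

Lemma mlin_expand n (J : finType) (Q : pred J) (v : J -> M) (T : ('I_n -> M) -> R) :
  mlin T ->
  T (fun=> \sum_(j | Q j) v j) =
  \sum_(phi : {ffun 'I_n -> J} | [forall i, Q (phi i)]) T (fun i => v (phi i)).
Proof.
elim: n T => [|n IH] T Tl.
  rewrite (big_pred1 (ffun0 (card_ord 0))) /=.
    by congr T; apply/funext => -[].
  move=> phi; rewrite /=; apply/forallP/eqP => _; last by case.
  by apply/ffunP => -[].
set u := \sum_(j | Q j) v j.
have Tl0 h : scalar (fun x => T (fcons x h)).
  by move=> a x y; have := Tl (fcons 0 h) ord0 a x y; rewrite !fcons_upd0.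
have Tl' x : mlin (fun h => T (fcons x h)).
  by move=> h i a y z; have := Tl (fcons x h) (lift ord0 i) a y z; rewrite !fcons_updS.
have -> : (fun=> u) = fcons u (fun=> u) :> ('I_n.+1 -> M).
  by apply/funext => i; case: (unliftP ord0 i) => [j|] ->; rewrite ?fconsS ?fcons0.
have T0 h : T (fcons 0 h) = 0.
  by have := Tl0 h (-1) 0 0; rewrite scaler0 addr0 mulN1r addNr.
have Tsum h (r : seq J) : T (fcons (\sum_(j <- r | Q j) v j) h) = \sum_(j <- r | Q j) T (fcons (v j) h).
  elim: r => [|j r IHr]; first by rewrite !big_nil T0.
  rewrite !big_cons; case: ifP => // _.
  by have := Tl0 h 1 (v j) (\sum_(j <- r | Q j) v j); rewrite scale1r mul1r IHr.
rewrite {1}/u Tsum; under eq_bigr => j _ do rewrite (IH _ (Tl' (v j))).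
rewrite pair_big_dep /=.
rewrite [RHS](reindex (fun p : J * {ffun 'I_n -> J} =>
   [ffun i => oapp p.2 p.1 (unlift ord0 i)])) /=; last first.
  exists (fun phi => (phi ord0, [ffun i => phi (lift ord0 i)])).
    move=> [j phi] _; rewrite !ffunE unlift_none; congr pair.
    by apply/ffunP => i; rewrite !ffunE liftK.
  move=> phi _; apply/ffunP => i; rewrite !ffunE.
  by case: (unliftP ord0 i) => [j ij|ij] /=; rewrite ?ffunE -?ij.
apply: eq_big => [[j phi] /=|[j phi] _ /=].
  apply/andP/forallP => [[Qj /forallP Qphi] i|h].
    by rewrite ffunE; case: (unliftP ord0 i) => [k|] _ /=.
  split; first by have := h ord0; rewrite ffunE unlift_none.
  by apply/forallP => i; have := h (lift ord0 i); rewrite ffunE liftK.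
congr T; apply/funext => i; rewrite ffunE.
by case: (unliftP ord0 i) => [k|] ->; rewrite ?fconsS ?fcons0 /= ?liftK ?unlift_none.
Qed.

(** The sum over sets [S] containing the range of [phi] factors over the
    points: a point outside the range contributes [1 - 1], so only
    surjective, hence injective, maps remain. *)
Lemma signed_sum_supersets n (phi : {ffun 'I_n -> 'I_n}) :
  \sum_(S : {set 'I_n} | [forall i, phi i \in S]) (-1) ^+ #|~: S| = (injectiveb phi)%:R :> R.
Proof.
pose G (j : 'I_n) : R := if [exists i, phi i == j] then 0 else -1.
have Gin (S : {set 'I_n}) : \prod_j (if j \in S then 1 else G j) =
    if [forall i, phi i \in S] then (-1) ^+ #|~: S| else 0.
  case: ifPn => [/forallP h|]; last first.
    rewrite negb_forall => /existsP[i iS]; rewrite (bigD1 (phi i)) //= (negPf iS) /G.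
    by rewrite ifT ?mul0r //; apply/existsP; exists i.
  rewrite -prodr_const [RHS]big_mkcond; apply: eq_bigr => j _; rewrite inE /=.
  case: ifPn => //= jS; rewrite /G ifF //; apply/negbTE/existsPn => i.
  by apply: contra jS => /eqP <-.
transitivity (\sum_(S in {set 'I_n}) \prod_j (if j \in S then 1 else G j)).
  by rewrite big_mkcond /=; apply: eq_bigr => S _; rewrite Gin.
rewrite -(bigA_distr 1 _ (fun=> 1) G) /=.
have -> : injectiveb phi = [forall j, exists i, phi i == j].
  apply/injectiveP/forallP => [inj j|surj].
    by apply/existsP; have /codomP[i ->] := injF_onto inj j; exists i.
  have : #|codom phi| == #|'I_n|.
    apply/eqP/eq_card => j; rewrite inE; apply/codomP.
    by have /existsP[i /eqP <-] := surj j; exists i.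
  by move/image_injP => inj i j /inj; apply.
have [/forallP surj|] := boolP [forall j, exists i, phi i == j]; rewrite /G.
  by rewrite big1 // => j _; rewrite surj addr0.
rewrite negb_forall => /existsP[j /negPf jn].
by rewrite (bigD1 j) //= jn subrr mul0r.
Qed.

(** A symmetric multilinear map is recovered from its diagonal: the expansion
    of the right-hand side runs over maps of indices, and the signs retain the
    surjective ones, which are the permutations. *)
Lemma polarization n (v : 'I_n -> M) (T : ('I_n -> M) -> R) :
  mlin T -> (forall (s : 'S_n) h, T (h \o s) = T h) ->
  n`!%:R * T v = \sum_(S : {set 'I_n}) (-1) ^+ #|~: S| * T (fun=> \sum_(j in S) v j).
Proof.
move=> Tl Ts; under eq_bigr => S _ do rewrite mlin_expand // mulr_sumr.
rewrite (exchange_big_dep xpredT) //=.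
transitivity (\sum_(phi : {ffun 'I_n -> 'I_n} | injectiveb phi) T (fun i => v (phi i))).
  rewrite (reindex (fun s : 'S_n => pval s)) /=; last first.
    exists (insubd (1%g : 'S_n)) => [s _|phi inj]; first exact: valKd.
    by rewrite [pval _]insubdK.
  rewrite (eq_bigl xpredT) => [|s]; last by case: s.
  rewrite (eq_bigr (fun=> T v)) => [|s _]; first by rewrite sumr_const card_Sn mulr_natl.
  by rewrite -(Ts s v); congr T; apply/funext => i /=; rewrite pvalE.
rewrite big_mkcond /=; apply: eq_bigr => phi _; rewrite -mulr_suml signed_sum_supersets.
by case: injectiveb; rewrite ?mul1r ?mul0r.
Qed.

End Multilinear.

(** * Wick monomials of a Gaussian family *)

Section GaussWick.
Variable R : realType.

Section Family.
Import boot.fintype boot.finset.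
Variable V : finType.
Implicit Types (x : V -> R) (b : V -> V -> R) (S J : {set V}) (a : V).

(** Cumulants of a Gaussian family, supported on pairs; the factor 1/2
    compensates the two orders of a pair, [b] being symmetric. *)
Definition pairK b (C : {set V}) : R :=
  if #|C| == 2%N then 2^-1 * \sum_(i in C) \sum_(j in C :\ i) b i j else 0.

(** The Wick product, at a sample point, of variables with values [x] whose
    only non-zero cumulants are the covariances [b]. *)
Definition gw x b S : R := wickf x (pairK b) S.

Lemma gw0 x b : gw x b set0 = 1. Proof. exact: wickf0. Qed.

Lemma pairK_set2 b a i : (forall i j, b i j = b j i) -> a != i -> pairK b [set a; i] = b a i.
Proof.
move=> bs ai; rewrite /pairK cards2 ai /= big_setU1 ?inE //= big_set1.
have -> : [set a; i] :\ a = [set i] by rewrite setU1K // inE.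
have -> : [set a; i] :\ i = [set a].
  by rewrite setUC setU1K // inE eq_sym.
by rewrite !big_set1 (bs i a); field.
Qed.

(** The recursion of Gaussian integration by parts: the factor [a] is either
    multiplied or contracted with one of the others. *)
Lemma gw_setU1 x b a S : (forall i j, b i j = b j i) -> a \notin S ->
  gw x b (a |: S) = x a * gw x b S - \sum_(i in S) b a i * gw x b (S :\ i).
Proof.
move=> bs aS; rewrite /gw wickf_setU1 //; congr (_ - _); rewrite /conv.
rewrite (bigID (fun B : {set V} => #|B| == 1%N)) /= [X in _ + X]big1 ?addr0; last first.
  move=> B /andP[BS B1]; rewrite /pairK cardsU1.
  by rewrite (contra (subsetP BS a) aS) eqSS (negPf B1) mul0r.
rewrite (reindex_onto (fun i => [set i]) (fun B => odflt a [pick i in B])) /=; last first.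
  by move=> B /andP[_ /cards1P[i ->]]; case: pickP => [j /set1P ->|/(_ i)] //; rewrite inE eqxx.
apply: eq_big => [i|i iS].
  rewrite sub1set cards1 eqxx andbT; case: pickP => [j /set1P -> /=|/(_ i)]; last by rewrite inE eqxx.
  by rewrite eqxx andbT.
rewrite pairK_set2 //; case/andP: iS => /andP[]; rewrite sub1set => iS _ _.
by apply: contraNneq aS => ->.
Qed.

Lemma eq_gw x x' b b' S : (forall i, i \in S -> x i = x' i) ->
  (forall i j, i \in S -> j \in S -> b i j = b' i j) -> gw x b S = gw x' b' S.
Proof.
move=> xx bb; apply: eq_conv => B BS; first by apply: eq_bigr => i iB; exact/xx/(subsetP BS).
apply: eq_bigr => pi piB; apply: eq_bigr => C Cpi; congr (- _); rewrite /pairK.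
have CS i : i \in C -> i \in S by move=> iC; apply/(subsetP BS)/(subsetP (partitionS piB Cpi)).
case: ifP => // _; congr (_ * _); apply: eq_bigr => i iC; apply: eq_bigr => j.
by rewrite inE => /andP[_ jC]; rewrite bb ?CS.
Qed.

End Family.

Import boot.fintype boot.finset.

Lemma gw_imset (V V' : finType) (rho : V -> V') (x : V' -> R) b (S : {set V}) :
  injective rho -> (forall i j, b i j = b j i) ->
  gw (x \o rho) (fun i j => b (rho i) (rho j)) S = gw x b (rho @: S).
Proof.
move=> inj bs; have [n] := ubnP #|S|; elim: n => // n IH in S *; rewrite ltnS => Sn.
have [->|[a aS]] := set_0Vmem S; first by rewrite imset0 !gw0.
rewrite -(setD1K aS) imsetU1 !gw_setU1 ?mem_imset ?setD11 //.
have lt (D : {set V}) : D \subset S :\ a -> (#|D| < n)%N.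
  move=> DS; apply: leq_ltn_trans (subset_leq_card DS) _.
  by move: Sn; rewrite (cardsD1 a) aS.
rewrite IH ?lt //; congr (_ - _); rewrite big_imset /=; last by move=> i j _ _ /inj.
apply: eq_bigr => i _; rewrite IH ?lt ?subD1set //; congr (_ * gw _ _ _).
apply/setP => y; apply/imsetP/setD1P => [[j /setD1P[ji jS] ->]|[yi /imsetP[j jS yj]]].
  by rewrite (inj_eq inj) imset_f.
by exists j => //; rewrite in_setD1 jS andbT; apply: contraNneq yi => ji; rewrite yj ji.
Qed.

(** Hermite polynomials form an Appell sequence. *)
Lemma deriv_hermite n : (@hermite R n.+1)^`() = n.+1%:R *: hermite n.
Proof.
elim: n => [|n IH]; first by rewrite /= -polyC1 derivC subr0 polyC1 mulr1 derivX scale1r.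
rewrite [hermite n.+2]/= -/(hermite n.+1) derivB derivM derivX mul1r -/(hermite n.+1) IH.
rewrite derivZ -scalerAr -addrA -scalerBr -/(hermite n.+1).
by rewrite -[X in X + _]scale1r -scalerDl -(natrD _ 1).
Qed.

Lemma horner_hermite n y :
  (@hermite R n.+1).[y] = y * (hermite n).[y] - n%:R * (hermite n.-1).[y].
Proof.
case: n => [|n]; first by rewrite /= -polyC1 derivC subr0 hornerM hornerX mul0r subr0.
by rewrite [hermite n.+2]/= -/(hermite n.+1) hornerE hornerM hornerX hornerN deriv_hermite hornerZ.
Qed.

(** For a single variable the recursion of Wick monomials is the three-term
    recursion of Hermite polynomials. *)
Lemma gw_diag (V : finType) (c y : R) (S : {set V}) :
  gw (fun=> c * y) (fun _ _ => c ^+ 2) S = c ^+ #|S| * (hermite #|S|).[y].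
Proof.
have [n] := ubnP #|S|; elim: n => // n IH in S *; rewrite ltnS => Sn.
have [->|[a aS]] := set_0Vmem S; first by rewrite cards0 gw0 expr0 mul1r /= -polyC1 hornerC.
have SE : #|S| = #|S :\ a|.+1 by rewrite (cardsD1 a) aS.
have lt1 : (#|S :\ a| < n)%N by rewrite -SE.
rewrite SE -{1}(setD1K aS) gw_setU1 ?setD11 // (IH _ lt1).
rewrite (eq_bigr (fun=> c ^+ 2 * (c ^+ #|S :\ a|.-1 * (hermite #|S :\ a|.-1).[y]))).
  rewrite sumr_const horner_hermite -mulr_natl; case: #|S :\ a| => [|k] /=.
    by rewrite !mul0r !subr0 exprS; ring.
  by rewrite !exprS; ring.
move=> i iS; rewrite IH; last by rewrite (leq_ltn_trans (subset_leq_card (subD1set _ _))).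
by rewrite (cardsD1 i (S :\ a)) iS.
Qed.

Section Polar.
Variables (M : lmodType R) (x : M -> R) (b : M -> M -> R).
Hypotheses (xl : scalar x) (bl : forall u, scalar (b u)) (bs : forall u v, b u v = b v u).
Variable n : nat.

Let T (v : 'I_n -> M) := gw (fun i => x (v i)) (fun i j => b (v i) (v j)) [set: 'I_n].

Lemma gw_mlin : mlin T.
Proof.
move=> h i; pose D := [set: 'I_n] :\ i.
have E z : T [eta h with i |-> z] =
    x z * gw (fun i => x (h i)) (fun i j => b (h i) (h j)) D
    - \sum_(j in D) b z (h j) * gw (fun i => x (h i)) (fun i j => b (h i) (h j)) (D :\ j).
  rewrite /T -(setD1K (in_setT i)) gw_setU1 ?setD11 //= eqxx; congr (_ * _ - _).
    by apply: eq_gw => [j|j k]; rewrite !inE ?andbT => /negPf -> // /negPf ->.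
  apply: eq_bigr => j; rewrite inE => /andP[]; rewrite inE => /negPf ji _.
  rewrite ji; congr (_ * _).
  by apply: eq_gw => [k|k l]; rewrite !inE ?andbT => /andP[_ /negPf ->] // /andP[_ /negPf ->].
move=> a u v; rewrite /= !E xl mulrDl; rewrite [in LHS](eq_bigr (fun j =>
   a * (b u (h j) * gw (fun i => x (h i)) (fun i j => b (h i) (h j)) (D :\ j)) +
   b v (h j) * gw (fun i => x (h i)) (fun i j => b (h i) (h j)) (D :\ j))).
  by rewrite big_split /= -mulr_sumr; ring.
by move=> j _; rewrite !(bs _ (h j)) bl; ring.
Qed.

(** A Wick monomial is a symmetric multilinear function of the underlying
    vectors, hence is determined by Wick powers. *)
Lemma gw_polarization (v : 'I_n -> M) : n`!%:R * T v =
  \sum_(S : {set 'I_n}) (-1) ^+ #|~: S| *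
    gw (fun=> x (\sum_(j in S) v j)) (fun _ _ => b (\sum_(j in S) v j) (\sum_(j in S) v j))
       [set: 'I_n].
Proof.
rewrite (polarization v gw_mlin) // => s h.
have := @gw_imset _ _ s (fun i => x (h i)) (fun i j => b (h i) (h j)) [set: 'I_n].
rewrite /T => ->; [|exact: perm_inj|by move=> i j; exact: bs].
by congr gw; apply/setP => i; rewrite inE -[i](permKV s) imset_f.
Qed.

End Polar.

End GaussWick.

(** * Orderings of a finite set *)

Section Orderings.
Import boot.fintype boot.finset.
Variable V : finType.
Implicit Types (B : {set V}) (s : seq V) (a : V).

Definition ords B : seq (seq V) := permutations (enum B).

Lemma mem_ords B s : (s \in ords B) = uniq s && ([set x in s] == B).
Proof.
rewrite mem_permutations; apply/idP/andP => [p|[us /eqP <-]].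
  rewrite (perm_uniq p) enum_uniq; split=> //; apply/eqP/setP => x.
  by rewrite inE (perm_mem p) mem_enum.
by apply: uniq_perm; rewrite ?enum_uniq // => x; rewrite mem_enum inE.
Qed.

Lemma ords_uniq B : uniq (ords B). Proof. exact: permutations_uniq. Qed.

Lemma size_ords B s : s \in ords B -> size s = #|B|.
Proof. by rewrite mem_permutations => /perm_size ->; rewrite -cardE. Qed.

Lemma ords_neq0 B s : B != set0 -> s \in ords B -> s <> [::].
Proof.
move=> B0 /size_ords sB s0; move: sB; rewrite s0 /= => /esym/eqP.
by rewrite cards_eq0 (negPf B0).
Qed.

Lemma ords0 : ords set0 = [:: [::]].
Proof. by rewrite /ords enum_set0. Qed.

Lemma sum_ords_rev (M : nmodType) B (g : seq V -> M) :
  \sum_(s <- ords B) g (rev s) = \sum_(s <- ords B) g s.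
Proof.
rewrite -(big_map rev xpredT g); apply: perm_big; apply: uniq_perm; rewrite ?ords_uniq //.
  by rewrite map_inj_uniq ?ords_uniq //; exact: inv_inj revK.
have sr s : (rev s \in ords B) = (s \in ords B).
  rewrite !mem_ords rev_uniq; congr (_ && (_ == _)).
  by apply/setP => x; rewrite !inE mem_rev.
by move=> s; rewrite -{1}[s]revK mem_map ?sr //; exact: inv_inj revK.
Qed.

(** An ordering of [a |: B] is cut at [a]. *)
Lemma sum_ords_setU1 (M : nmodType) a B (g : seq V -> M) : a \notin B ->
  \sum_(s <- ords (a |: B)) g s =
  \sum_(B1 : {set V} | B1 \subset B)
     \sum_(s1 <- ords B1) \sum_(s2 <- ords (B :\: B1)) g (s1 ++ a :: s2).
Proof.
move=> aB; pose cut s : {set V} := [set x in take (index a s) s].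
rewrite big_seq (partition_big cut (fun B1 => B1 \subset B)) /=; last first.
  move=> s; rewrite mem_ords => /andP[us /eqP sB]; apply/subsetP => x; rewrite inE => xs.
  have as_ : a \in s by have := setU11 a B; rewrite -sB inE.
  have : x \in a |: B by rewrite -sB inE; exact: mem_take xs.
  rewrite !inE => /orP[/eqP xa|//]; move: us; rewrite -(cat_take_drop (index a s) s).
  rewrite (drop_nth a) ?index_mem // nth_index // cat_uniq => /and3P[_ /hasPn/(_ a)].
  by rewrite inE eqxx => /(_ isT); rewrite -{1}xa xs.
apply: eq_bigr => B1 B1B; rewrite -big_seq_cond -big_filter.
rewrite -(@big_allpairs_dep _ _ _ _ (fun=> seq V) _ (fun s1 s2 => s1 ++ a :: s2)
  (ords B1) (fun=> ords (B :\: B1)) g).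
have aB1 : a \notin B1 by apply: contra aB; apply: (subsetP B1B).
apply: perm_big; apply: uniq_perm.
- by rewrite filter_uniq // ords_uniq.
- apply: allpairs_uniq; rewrite ?ords_uniq //.
  move=> [s1 s2] [t1 t2] /allpairsP[[? ?] [/= h1 _ [-> ->]]] /allpairsP[[? ?] [/= h2 _ [-> ->]]] /eqP.
  by rewrite eqseq_cat ?(size_ords h1) ?(size_ords h2) // => /andP[/eqP -> /eqP[->]].
move=> s; rewrite mem_filter; apply/andP/allpairsP => [[/eqP cs sa]|].
  have := sa; rewrite mem_ords => /andP[us /eqP sB].
  have as_ : a \in s by have := setU11 a B; rewrite -sB inE.
  move: cs; rewrite /cut; set t1 := take _ _ => cs; set t2 := drop (index a s).+1 s.
  have sE : s = t1 ++ a :: t2.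
    by rewrite -[LHS](cat_take_drop (index a s)) (drop_nth a) ?index_mem // nth_index.
  have ut1 : uniq t1 by exact: take_uniq.
  exists (t1, t2); split=> //=; first by rewrite mem_ords ut1 -cs eqxx.
  have sx x : (x \in s) = (x == a) || (x \in B) by rewrite -in_setU1 -sB inE.
  move: us sx; rewrite sE cat_uniq /= => /and3P[_ /norP[at1 dis] /andP[ad ud]] sx.
  rewrite mem_ords ud /=; apply/eqP/setP => x; rewrite !inE -cs inE.
  have := sx x; rewrite mem_cat inE; have [->|xa] /= := eqVneq x a.
    by rewrite (negPf ad) (negPf aB) andbF.
  case xd: (x \in t2); last by rewrite orbF => <-; rewrite andNb.
  by rewrite orbT => <-; rewrite andbT (hasPn dis _ xd).
move=> [[s1 s2] [/= h1 h2 ->]].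
have [] := (h1, h2); rewrite !mem_ords => /andP[u1 /eqP e1] /andP[u2 /eqP e2].
have as1 : a \notin s1 by apply: contra aB1; rewrite -e1 inE.
have as2 : a \notin s2.
  by apply/negP => as2; have : a \in B :\: B1 by [rewrite -e2 inE]; rewrite inE (negPf aB) andbF.
have sin : s1 ++ a :: s2 \in ords (a |: B).
  rewrite mem_ords cat_uniq u1 /= u2 as2 (negPf as1) /= andbT; apply/andP; split.
    apply/hasPn => x; have : x \in [set x in s2] -> x \notin [set x in s1].
      by rewrite e2 e1 inE => /andP[].
    by rewrite !inE.
  apply/eqP/setP => x; rewrite !inE mem_cat inE orbCA; congr (_ || _).
  have : (x \in [set x in s1]) || (x \in [set x in s2]) = (x \in B).
    rewrite e1 e2 inE; case: (boolP (x \in B1)) => //= /(subsetP B1B) -> //.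
  by rewrite !inE.
split; last by rewrite -mem_ords.
apply/eqP/setP => x; rewrite inE index_cat (negPf as1) /= eqxx addn0 take_size_cat //.
by rewrite -e1 inE.
Qed.

Lemma sum_subset_compl (M : nmodType) B (g : {set V} -> {set V} -> M) :
  \sum_(C : {set V} | C \subset B) g (B :\: C) C = \sum_(C : {set V} | C \subset B) g C (B :\: C).
Proof.
rewrite [RHS](reindex_onto (fun C => B :\: C) (fun C => B :\: C)) /=; last first.
  by move=> C CB; rewrite setDDr setDv set0U (setIidPr CB).
apply: eq_big => [C|C CB].
  rewrite subsetDl /=; apply/idP/eqP => [CB|<-]; last exact: subsetDl.
  by rewrite setDDr setDv set0U (setIidPr CB).
by rewrite setDDr setDv set0U (setIidPr CB).
Qed.

End Orderings.

(** * Paths and their edges *)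

Section PathGraphs.
Import boot.fintype boot.finset.
Variable m : nat.
Implicit Types (s t p q : seq 'I_m) (x y : 'I_m) (E : {set 'I_m}).

Lemma path_edges_rcons s x y :
  path_edges (rcons (rcons s x) y) = rcons (path_edges (rcons s x)) [set x; y].
Proof.
elim: s => [|z s IH] //; case: s IH => [|z' s] // IH.
rewrite !rcons_cons in IH *.
by rewrite -[LHS]/([set z; z'] :: path_edges (z' :: rcons (rcons s x) y)) IH.
Qed.

Lemma path_edges_rev s : path_edges (rev s) = rev (path_edges s).
Proof.
elim: s => [|x s IH] //; case: s IH => [|y s] // IH.
rewrite rev_cons [in rev (y :: s)]rev_cons path_edges_rcons -rev_cons IH.
by rewrite -[path_edges [:: x, y & s]]/([set x; y] :: path_edges (y :: s)) rev_cons setUC.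
Qed.

Lemma path_edges_head x y s E : x \notin y :: s ->
  E \in path_edges [:: x, y & s] -> x \in E -> E = [set x; y].
Proof.
move=> xN; rewrite -[path_edges _]/([set x; y] :: path_edges (y :: s)) inE.
by case/orP => [/eqP //|/mem_path_edges h /h]; rewrite (negPf xN).
Qed.

Lemma set2_eq x y z : x != y -> x != z -> [set x; y] = [set x; z] -> y = z.
Proof.
move=> xy xz /setP/(_ y); rewrite !inE eqxx orbT eq_sym (negPf xy) /=.
by move/esym/eqP.
Qed.

(** From a known first vertex, a path is reconstructed step by step: its
    first edge is the only one containing that vertex. *)
Lemma path_det x p q : uniq (x :: p) -> uniq (x :: q) ->
  path_edges (x :: p) =i path_edges (x :: q) -> p = q.
Proof.
elim: p x q => [|y p IH] x [|z q] //.
- by move=> _ _ /(_ [set x; z]); rewrite inE eqxx.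
- by move=> _ _ /(_ [set x; y]); rewrite inE eqxx.
move=> u1 u2 E; have /andP[xp up] := u1; have /andP[xq uq] := u2.
have yz : y = z.
  have := E [set x; y]; rewrite [LHS]inE eqxx => /esym /(path_edges_head xq) h.
  apply: (@set2_eq x); last by apply: h; rewrite !inE eqxx.
    by apply: contra xp => /eqP ->; rewrite mem_head.
  by apply: contra xq => /eqP ->; rewrite mem_head.
rewrite -yz in xq uq u2 E *; congr (_ :: _); apply: (IH y) => // F.
have NF r : x \notin y :: r -> (F \in path_edges (y :: r)) =
    (F \in path_edges [:: x, y & r]) && (x \notin F).
  move=> xr; rewrite -[path_edges [:: x, y & r]]/([set x; y] :: path_edges (y :: r)) inE.
  have [Fp|Fp] := boolP (F \in path_edges (y :: r)).
    by rewrite orbT /=; apply/esym; apply: contra xr; exact: mem_path_edges Fp.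
  by rewrite orbF; case: eqP => // ->; rewrite !inE eqxx.
by rewrite !NF // E.
Qed.

Lemma path_edges_cat s x y t : [set x; y] \in path_edges (rcons s x ++ y :: t).
Proof.
rewrite cat_rcons; elim: s => [|z [|z' s] IH]; first by rewrite inE eqxx.
  by rewrite !inE eqxx orbT.
by rewrite inE IH orbT.
Qed.

(** An end point of a path has a single neighbour, hence is an end point of
    every path with the same edges; from there the edges force the order. *)
Lemma path_unique s t : uniq s -> uniq t -> perm_eq s t ->
  path_edges s =i path_edges t -> s = t \/ s = rev t.
Proof.
case: s => [|x [|y s]] us ut st E.
- by left; move/perm_size: st => /=; case: (t).
- by left; apply: perm_small_eq => //; rewrite -(perm_size st).
have xt : x \in t by rewrite -(perm_mem st) mem_head.
have /andP[xN _] := us.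
case/splitPr: {t}xt E ut {st} => p1 p2 E ut.
(* neighbours [u] and [v] of [x] on both sides would give two edges at [x] *)
case/lastP: p1 E ut => [|p1 u] E ut; first by left; congr cons; exact: path_det E.
case: p2 E ut => [|v p2] E ut.
  right; rewrite cats1 in E ut *; rewrite rev_rcons; congr cons; apply: (@path_det x) => //.
    by rewrite -rev_rcons rev_uniq.
  by rewrite -rev_rcons path_edges_rev => F; rewrite mem_rev E.
have e1 : [set u; x] = [set x; y].
  by apply: (path_edges_head xN); [rewrite E path_edges_cat|rewrite !inE eqxx orbT].
have e2 : [set x; v] = [set x; y].
  apply: (path_edges_head xN); last by rewrite !inE eqxx.
  by rewrite E -cat_rcons path_edges_cat.
have xy : x != y by apply: contra xN => /eqP ->; rewrite mem_head.
move: ut; rewrite cat_uniq => /and3P[_ /hasPn uN /andP[xv _]].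
have ux : u != x.
  by apply: contraNneq (uN x (mem_head _ _)) => ->; rewrite /= mem_rcons mem_head.
have uv : u != v.
  apply: contraNneq (uN v _) => [->|]; first by rewrite /= mem_rcons mem_head.
  by rewrite !inE eqxx orbT.
have xv' : x != v by apply: contra xv => /eqP ->; rewrite mem_head.
case/eqP: uv; rewrite -(set2_eq xy xv' (esym e2)).
by apply/esym; apply: (set2_eq xy _ _); [rewrite eq_sym; exact: ux|rewrite -e1 setUC].
Qed.

(** A sequence without repetition equals its reversal only when it has at
    most one entry. *)
Lemma sum_orientations (M : nmodType) (B : {set 'I_m}) t (g : seq 'I_m -> M) : t \in ords B ->
  g (rev t) = g t ->
  \sum_(s <- ords B | (s == t) || (s == rev t)) g s = g t *+ (if #|B| <= 1 then 1 else 2)%N.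
Proof.
move=> tB gt; have st := size_ords tB.
have rB : rev t \in ords B.
  by rewrite mem_permutations (perm_trans _ (_ : perm_eq t _)) ?perm_rev // -mem_permutations.
rewrite -big_filter; have uo := ords_uniq B.
have tail : (#|B| <= 1)%N = (rev t == t).
  rewrite -st; have ut : uniq t by move: tB; rewrite mem_ords => /andP[].
  case: t ut {st gt tB rB} => [|x [|y t]] //; first by rewrite /rev /= eqxx.
  rewrite cons_uniq => /andP[xN _].
  apply/esym/negbTE; rewrite rev_cons; apply/eqP => E.
  have xE : x = last y t by have := congr1 (last x) E; rewrite last_rcons.
  by case/negP: xN; rewrite {1}xE mem_last.
rewrite tail; have [rt|rt] := eqVneq (rev t) t.
  rewrite (perm_big [:: t]) ?big_seq1 //; apply: uniq_perm; rewrite ?filter_uniq // => s.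
  by rewrite mem_filter rt orbb inE; case: eqP => // ->; rewrite tB.
rewrite (perm_big [:: t; rev t]) /=; first by rewrite !big_cons big_nil addr0 gt mulr2n.
apply: uniq_perm; [by rewrite filter_uniq|by rewrite /= inE eq_sym rt|].
move=> s; rewrite mem_filter !inE; case: (eqVneq s t) => [->|_]; first by rewrite tB.
by case: eqP => // ->; rewrite rB.
Qed.

End PathGraphs.

Local Open Scope classical_set_scope.
Local Open Scope ring_scope.

(** * Orthonormal expansions in the Hilbert space *)

Lemma cvg_of_normle (R : realType) (W : normedModType R) (u : nat -> W) (v : nat -> R) l :
  (forall n, `|l - u n| <= v n) -> v @ \oo --> 0 -> u @ \oo --> l.
Proof.
move=> uv v0; apply/cvgrPdist_le => eps eps0.
move/cvgrPdist_le: v0 => /(_ _ eps0); apply: filterS => n.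
rewrite sub0r normrN => /(le_trans (ler_norm _)); exact: le_trans.
Qed.

Lemma cvg_seq_le (R : realType) (u : nat -> R) l c :
  u @ \oo --> l -> (forall n, u n <= c) -> l <= c.
Proof.
move=> ul uc; rewrite -(cvg_lim _ ul) //; apply: limr_le; first exact: cvgP ul.
exact: nearW.
Qed.

Lemma cvg_sumr (R : realType) (I : Type) (r : seq I) (u : I -> nat -> R) (l : I -> R) :
  (forall i, u i @ \oo --> l i) ->
  (fun n => \sum_(i <- r) u i n) @ \oo --> \sum_(i <- r) l i.
Proof.
move=> ul; elim: r => [|i r IH].
  by rewrite big_nil; under eq_fun do rewrite big_nil; exact: cvg_cst.
by rewrite big_cons; under eq_fun do rewrite big_cons; exact: cvgD.
Qed.

Lemma ler_sqr_sqrt (R : realType) (s c : R) : 0 <= s -> 0 <= c -> s ^+ 2 <= c * s -> s <= c.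
Proof.
move=> s0 c0; rewrite le_eqVlt in s0; case/orP: s0 => [/eqP <-//|s0].
by rewrite expr2 ler_pM2r.
Qed.

Section Hilbert.
Context (R : realType) (H : completeNormedModType R) (ip : {dot H for idfun}).
Hypothesis hip : forall x, ip x x = `|x| ^+ 2.

Lemma ipC x y : ip x y = ip y x.
Proof. by rewrite hermC /= expr0 mul1r. Qed.
Lemma ipDr x y z : ip x (y + z) = ip x y + ip x z.
Proof. exact: linearDr. Qed.
Lemma ipZr a x y : ip x (a *: y) = a * ip x y.
Proof. by rewrite linearZr_LR. Qed.
Lemma ipDl x y z : ip (x + y) z = ip x z + ip y z.
Proof. by rewrite ipC ipDr !(ipC z). Qed.
Lemma ipZl a x y : ip (a *: x) y = a * ip x y.
Proof. by rewrite ipC ipZr (ipC y). Qed.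
Lemma ip_sumr (I : Type) (r : seq I) (P : pred I) x (F : I -> H) :
  ip x (\sum_(i <- r | P i) F i) = \sum_(i <- r | P i) ip x (F i).
Proof. exact: linear_sumr. Qed.
Lemma ip_suml (I : Type) (r : seq I) (P : pred I) x (F : I -> H) :
  ip (\sum_(i <- r | P i) F i) x = \sum_(i <- r | P i) ip (F i) x.
Proof. by rewrite ipC ip_sumr; apply: eq_bigr => i _; rewrite ipC. Qed.
Lemma ip0r x : ip x 0 = 0. Proof. exact: linear0r. Qed.
Lemma ip0l x : ip 0 x = 0. Proof. by rewrite ipC ip0r. Qed.
Lemma ipNr x y : ip x (- y) = - ip x y. Proof. exact: linearNr. Qed.
Lemma ipBr x y z : ip x (y - z) = ip x y - ip x z. Proof. exact: linearBr. Qed.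
Lemma ipBl x y z : ip (x - y) z = ip x z - ip y z.
Proof. by rewrite ipC ipBr !(ipC z). Qed.

Lemma ip_cauchy_schwarz x y : `|ip x y| <= `|x| * `|y|.
Proof.
have key u v : ip u v <= `|u| * `|v|.
  have [->|u0] := eqVneq u 0; first by rewrite ip0l normr0 mul0r.
  have [->|v0] := eqVneq v 0; first by rewrite ip0r normr0 mulr0.
  have uv0 : 0 < `|u| * `|v| by rewrite mulr_gt0 // normr_gt0.
  have : 0 <= ip (`|v| *: u - `|u| *: v) (`|v| *: u - `|u| *: v) by rewrite hip sqr_ge0.
  rewrite ipBl !ipBr !ipZl !ipZr !hip (ipC v u) => h.
  have : `|u| * `|v| * ip u v <= `|u| * `|v| * (`|u| * `|v|) by nra.
  by rewrite ler_pM2l.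
by rewrite ler_norml key andbT lerNl -ipNr (le_trans (key _ _)) // normrN.
Qed.

Variable e : nat -> H.
Hypothesis he : orthonormal_basis ip e.

Lemma basis_cvg x : series (fun k => ip (e k) x *: e k) @ \oo --> x.
Proof. by case: he. Qed.

Lemma basis_ip i j : ip (e i) (e j) = (i == j)%:R * `|e i| ^+ 2.
Proof.
case: eqP => [->|/eqP ij]; first by rewrite mul1r hip.
by rewrite mul0r; case: he => ->.
Qed.

Lemma basis_norm01 i : `|e i| ^+ 2 = 1 \/ e i = 0.
Proof. by case: he => _ /(_ i) [->|->] _; [left; rewrite expr1n|right]. Qed.

Lemma basis_coefM i x : ip (e i) x * `|e i| ^+ 2 = ip (e i) x.
Proof. by case: (basis_norm01 i) => ->; rewrite ?mulr1 // ip0l mul0r. Qed.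

(** The padding vectors of the basis are zero, hence the factors [`|e k| ^+
    2]. *)
Lemma norm_comb (r : seq nat) (c : nat -> R) : uniq r ->
  `|\sum_(k <- r) c k *: e k| ^+ 2 = \sum_(k <- r) c k ^+ 2 * `|e k| ^+ 2.
Proof.
move=> ur; rewrite -hip ip_suml [LHS]big_seq [RHS]big_seq; apply: eq_bigr => i ir.
rewrite ip_sumr (bigD1_seq i) //= big1 => [|j ji].
  by rewrite ipZl ipZr hip addr0 mulrA expr2.
by rewrite ipZl ipZr basis_ip eq_sym (negPf ji) mul0r !mulr0.
Qed.

Lemma bessel n x : \sum_(0 <= k < n) ip (e k) x ^+ 2 <= `|x| ^+ 2.
Proof.
set S := \sum_(0 <= k < n) ip (e k) x *: e k.
have -> : \sum_(0 <= k < n) ip (e k) x ^+ 2 = ip x S.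
  by rewrite ip_sumr; apply: eq_bigr => k _; rewrite ipZr (ipC x).
have SS : ip S S = ip x S.
  rewrite hip norm_comb ?iota_uniq // ip_sumr; apply: eq_bigr => k _.
  by rewrite ipZr (ipC x) expr2 -mulrA basis_coefM.
have : 0 <= ip (x - S) (x - S) by rewrite hip sqr_ge0.
by rewrite ipBl !ipBr SS (ipC S x) subrr subr0 hip subr_ge0.
Qed.

(** By orthogonality the increments of the series have the norms of those of
    the convergent series of squared coefficients. *)
Lemma l2_series_cvg (c : nat -> R) (C : R) :
  (forall n, \sum_(0 <= k < n) c k ^+ 2 <= C) -> cvgn (series (fun k => c k *: e k)).
Proof.
move=> cC; apply: cauchy_cvg; apply/cauchy_seriesP => eps eps0.
have : cvgn (series (fun k => c k ^+ 2)).
  apply: nondecreasing_is_cvgn.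
    by apply/nondecreasing_seqP => n; rewrite !seriesEnat /= big_nat_recr //= lerDl sqr_ge0.
  by exists C => _ [n _ <-]; exact: cC.
move=> /cvg_cauchy/cauchy_seriesP/(_ (eps ^+ 2) (exprn_gt0 _ eps0)).
apply: filterS => -[a b] /= h.
rewrite -(@ltr_pXn2r _ 2) ?nnegrE ?normr_ge0 ?ltW // norm_comb ?iota_uniq //.
apply: le_lt_trans h; apply: le_trans (ler_norm _); apply: ler_sum => k _.
by case: (basis_norm01 k) => ->; rewrite ?mulr1 // normr0 expr0n mulr0 sqr_ge0.
Qed.

Section BoundedFunctional.
Variables (phi : H -> R) (C : R).
Hypothesis (phi_lin : scalar phi) (phiC : forall x, `|phi x| <= C * `|x|).

Let phi0 : phi 0 = 0.
Proof. by apply/eqP; rewrite -normr_le0 (le_trans (phiC _)) // normr0 mulr0. Qed.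

Lemma functional_sum (r : seq nat) (c : nat -> R) :
  phi (\sum_(k <- r) c k *: e k) = \sum_(k <- r) c k * phi (e k).
Proof.
elim: r => [|k r IH]; first by rewrite !big_nil phi0.
by rewrite !big_cons phi_lin IH.
Qed.

Lemma functional_cvg x u : u @ \oo --> x -> phi \o u @ \oo --> phi x.
Proof.
move=> ux; apply: (@cvg_of_normle _ _ _ (fun n => `|C| * `|x - u n|)) => [n /=|].
  have -> : phi x - phi (u n) = phi (x - u n).
    have -> : x - u n = -1 *: u n + x by rewrite scaleN1r addrC.
    by rewrite phi_lin mulN1r addrC.
  by apply: le_trans (phiC _) _; rewrite ler_wpM2r ?normr_ge0 // ler_norm.
rewrite -(mulr0 `|C|); apply: cvgMr; rewrite -(normr0 H) -(subrr x).
by apply: cvg_norm; apply: cvgB => //; exact: cvg_cst.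
Qed.

(** A continuous linear functional commutes with the expansion in the basis. *)
Lemma functional_expansion x :
  series (fun k => phi (e k) * ip (e k) x) @ \oo --> phi x.
Proof.
have := functional_cvg (@basis_cvg x); apply: cvg_trans; apply: near_eq_cvg.
apply: nearW => n /=; rewrite functional_sum; apply: eq_bigr => k _; exact: mulrC.
Qed.

(** The functional is tested on the combination of basis vectors whose
    coefficients are its own values. *)
Lemma functional_l2 n : \sum_(0 <= k < n) phi (e k) ^+ 2 <= C ^+ 2.
Proof.
have [H0|] := boolP [forall k : 'I_n, phi (e k) == 0].
  rewrite big_mkord big1 ?sqr_ge0 // => k _.
  by move/forallP/(_ k)/eqP: H0 => ->; rewrite expr0n.
rewrite negb_forall => /existsP[k0 hk0].
have C0 : 0 <= C.
  have := phiC (e k0); have : 0 < `|e k0|.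
    by rewrite normr_gt0; apply: contra hk0 => /eqP ->; rewrite phi0.
  move=> e0 h; rewrite -(@pmulr_lge0 _ `|e k0|) //.
  by apply: le_trans h; rewrite normr_ge0.
set s := \sum_(0 <= k < n) _; have s0 : 0 <= s by apply: sumr_ge0 => *; exact: sqr_ge0.
suff : Num.sqrt s <= C by rewrite -(@ler_pXn2r _ 2) ?nnegrE ?sqrtr_ge0 // sqr_sqrtr.
apply: ler_sqr_sqrt => //; rewrite sqr_sqrtr //.
have := phiC (\sum_(0 <= k < n) phi (e k) *: e k); rewrite functional_sum.
rewrite (eq_bigr (fun k => phi (e k) ^+ 2)) // -/s ger0_norm // => /le_trans; apply.
rewrite ler_wpM2l // -(@ler_pXn2r _ 2) ?nnegrE ?normr_ge0 ?sqrtr_ge0 // sqr_sqrtr //.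
rewrite norm_comb ?iota_uniq //; apply: ler_sum => k _.
by case: (basis_norm01 k) => ->; rewrite ?mulr1 // normr0 expr0n mulr0 sqr_ge0.
Qed.

End BoundedFunctional.

Lemma parseval x y : series (fun k => ip x (e k) * ip (e k) y) @ \oo --> ip x y.
Proof.
apply: (@functional_expansion (ip x) `|x|) => [a u v|u].
  by rewrite ipDr ipZr.
exact: ip_cauchy_schwarz.
Qed.

Lemma ip_ext x y : (forall z, ip z x = ip z y) -> x = y.
Proof.
move=> h; apply/eqP; rewrite -subr_eq0 -normr_eq0 -sqrf_eq0 -hip ipBr h subrr.
by rewrite eqxx.
Qed.

End Hilbert.

(** * The Hilbert-Schmidt norm through finite boxes of coefficients *)

Section Box.
Context (R : realType) (H : completeNormedModType R) (e : nat -> H).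
Implicit Types (n N : nat).

(** The squared norm of the coefficients with indices below [N]; increasing
    in [N], with limit the squared Hilbert-Schmidt norm. Estimates on finite
    boxes pass to the limit without manipulating infinite sums over
    multi-indices. *)
Definition boxsq n (f : form H n) N : R :=
  \sum_(k : {ffun 'I_n -> 'I_N}) f (fun i => e (k i)) ^+ 2.

Lemma boxsq_ge0 n (f : form H n) N : 0 <= boxsq f N.
Proof. by apply: sumr_ge0 => k _; exact: sqr_ge0. Qed.

Let emb n N (k : {ffun 'I_n -> 'I_N}) : {ffun 'I_n -> nat} := [ffun i => val (k i)].

Let emb_inj n N : injective (@emb n N).
Proof. by move=> k l /ffunP kl; apply/ffunP => i; apply/val_inj; move: (kl i); rewrite !ffunE. Qed.

Let emb_val n (f : form H n) N (k : {ffun 'I_n -> 'I_N}) :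
  f (fun i => e (emb k i)) = f (fun i => e (k i)).
Proof. by congr f; apply/funext => i; rewrite ffunE. Qed.

Lemma boxsq_le_sqnorm n (f : form H n) N : ((boxsq f N)%:E <= tensor_sqnorm e f)%E.
Proof.
pose r := [seq emb k | k : {ffun 'I_n -> 'I_N}].
have ur : uniq r by rewrite map_inj_uniq ?enum_uniq //; exact: emb_inj.
apply: esum_ge; exists [set` r]; first by split; [exact: finite_seq|].
rewrite (fsbigE r) => [|//|//|i /= ->//].
rewrite big_mkcond /= big_map /boxsq -sumEFin big_enum /=.
apply: lee_sum => k _; rewrite ifT ?emb_val //.
by rewrite inE /=; apply: map_f; rewrite mem_enum.
Qed.

(** A finite set of multi-indices lies in a box. *)
Lemma sqnorm_le_box n (f : form H n) (C : R) :
  (forall N, boxsq f N <= C) -> (tensor_sqnorm e f <= C%:E)%E.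
Proof.
move=> fC; apply: ge_ereal_sup => _ [X [finX _] <-].
rewrite fsbig_finite //=; set r := finmap.enum_fset _.
pose N := (\max_(k <- r) \max_i k i).+1%N.
have rN k i : k \in r -> (k i < N)%N.
  move=> kr; rewrite /N ltnS; apply: (leq_trans (leq_bigmax (F := fun i => k i) i)).
  exact: (leq_bigmax_seq (F := fun k : {ffun 'I_n -> nat} => \max_i k i)%N k kr).
rewrite sumEFin lee_fin; apply: le_trans (fC N).
pose proj (k : {ffun 'I_n -> nat}) : {ffun 'I_n -> 'I_N} := [ffun i => inord (k i)].
have projK k : k \in r -> emb (proj k) = k.
  by move=> kr; apply/ffunP => i; rewrite !ffunE /= inordK // rN.
have -> : \sum_(i <- r) f (fun j => e (i j)) ^+ 2
  = \sum_(k <- map proj r) f (fun i => e (k i)) ^+ 2.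
  rewrite big_map big_seq [RHS]big_seq; apply: eq_bigr => k kr.
  by rewrite -emb_val projK.
rewrite big_uniq /=; last first.
  rewrite map_inj_in_uniq ?finmap.fset_uniq // => k l kr lr kl.
  by rewrite -(projK k) // kl projK.
by rewrite big_mkcond /=; apply: ler_sum => k _; case: ifP; rewrite ?sqr_ge0.
Qed.

Definition hsq n (f : form H n) : R := fine (tensor_sqnorm e f).

Lemma tensor_sqnorm_ge0 n (f : form H n) : (0 <= tensor_sqnorm e f)%E.
Proof. by apply: esum_ge0 => k _; rewrite lee_fin sqr_ge0. Qed.

Lemma hsq_ge0 n (f : form H n) : 0 <= hsq f.
Proof. by rewrite fine_ge0 // tensor_sqnorm_ge0. Qed.

Lemma hsqE n (f : form H n) : (tensor_sqnorm e f < +oo)%E -> tensor_sqnorm e f = (hsq f)%:E.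
Proof. by move=> fin; rewrite fineK // ge0_fin_numE // tensor_sqnorm_ge0. Qed.

Lemma boxsq_le n (f : form H n) N : (tensor_sqnorm e f < +oo)%E -> boxsq f N <= hsq f.
Proof. by move=> fin; rewrite -lee_fin -hsqE // boxsq_le_sqnorm. Qed.

Lemma hsq_le_box n (f : form H n) (C : R) : (forall N, boxsq f N <= C) ->
  (tensor_sqnorm e f < +oo)%E /\ hsq f <= C.
Proof.
move=> fC; have fin : (tensor_sqnorm e f < +oo)%E.
  by apply: le_lt_trans (sqnorm_le_box fC) _; exact: ltry.
by split=> //; rewrite -lee_fin -hsqE //; exact: sqnorm_le_box.
Qed.

Lemma boxsq_mono n (f : form H n) : {homo boxsq f : N N' / (N <= N')%N >-> N <= N'}.
Proof.
move=> N N' NN'; rewrite /boxsq.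
pose w (k : {ffun 'I_n -> 'I_N}) : {ffun 'I_n -> 'I_N'} := [ffun i => widen_ord NN' (k i)].
have wi : injective w.
  move=> k l /ffunP kl; apply/ffunP => i; move: (kl i); rewrite !ffunE => /(congr1 val) /= ?.
  exact: val_inj.
have -> : \sum_(k : {ffun 'I_n -> 'I_N}) f (fun i => e (k i)) ^+ 2
   = \sum_(k <- [seq w k | k : {ffun 'I_n -> 'I_N}]) f (fun i => e (k i)) ^+ 2.
  rewrite big_map big_enum /=; apply: eq_bigr => k _; congr (f _ ^+ 2).
  by apply/funext => i; rewrite ffunE.
rewrite big_uniq /=; last by rewrite map_inj_uniq ?enum_uniq.
by rewrite big_mkcond /=; apply: ler_sum => k _; case: ifP; rewrite ?sqr_ge0.
Qed.

Lemma boxsq_cvg n (f : form H n) : (tensor_sqnorm e f < +oo)%E ->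
  boxsq f @ \oo --> hsq f.
Proof.
move=> fin; have ub N := @boxsq_le n f N fin.
have hu : has_ubound (range (boxsq f)) by exists (hsq f) => _ [N _ <-].
have c := nondecreasing_cvgn (@boxsq_mono n f) hu.
suff -> : hsq f = sup (range (boxsq f)) by [].
apply/eqP; rewrite eq_le; apply/andP; split; last first.
  by apply: ge_sup; [exists (boxsq f 0), 0%N|move=> _ [N _ <-]].
have [_] : (tensor_sqnorm e f < +oo)%E /\ hsq f <= sup (range (boxsq f)).
  by apply: hsq_le_box => N; apply: ub_le_sup => //; exists N.
exact.
Qed.

Lemma boxsqD n (f g : form H n) (a : R) N :
  boxsq (fun h => a * f h + g h)%R N <= 2 * a ^+ 2 * boxsq f N + 2 * boxsq g N.
Proof.
rewrite /boxsq !mulr_sumr -big_split /=; apply: ler_sum => k _.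
set x := f _; set y := g _; have := sqr_ge0 (a * x - y); nra.
Qed.

Lemma sqnorm_lin n (f g : form H n) (a : R) :
  (tensor_sqnorm e f < +oo)%E -> (tensor_sqnorm e g < +oo)%E ->
  (tensor_sqnorm e (fun h => a * f h + g h)%R < +oo)%E.
Proof.
move=> ff gf; suff /hsq_le_box[] : forall N, boxsq (fun h => a * f h + g h)%R N <=
   2 * a ^+ 2 * hsq f + 2 * hsq g by [].
move=> N; apply: le_trans (boxsqD _ _ _ _) _.
have a2 := sqr_ge0 a.
by apply: lerD; apply: ler_wpM2l; [lra|exact: boxsq_le|lra|exact: boxsq_le].
Qed.

Lemma boxsq_tensor_prod p q (f : form H p) (g : form H q) N :
  boxsq (tensor_prod f g) N = boxsq f N * boxsq g N.
Proof.
rewrite /boxsq big_distrlr /= pair_big /=.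
rewrite (reindex (fun k : {ffun 'I_(p + q) -> 'I_N} =>
   ([ffun i => k (lshift q i)], [ffun i => k (rshift p i)]))) /=; last first.
  exists (fun kl : {ffun 'I_p -> 'I_N} * {ffun 'I_q -> 'I_N} =>
    [ffun i => match fintype.split i with inl j => kl.1 j | inr j => kl.2 j end]).
    move=> k _; apply/ffunP => i; rewrite ffunE.
    by case: split_ordP => j ->; rewrite ffunE.
  move=> [k l] _ /=; congr pair; apply/ffunP => i; rewrite !ffunE.
    by rewrite (unsplitK (inl i)).
  by rewrite (unsplitK (inr i)).
apply: eq_bigr => k _; rewrite /tensor_prod exprMn; congr (f _ ^+ 2 * g _ ^+ 2);
  by apply/funext => i; rewrite ffunE.
Qed.

Lemma boxsq_perm n (f : form H n) (s : 'S_n) N :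
  boxsq (fun h => f (h \o s)) N = boxsq f N.
Proof.
rewrite /boxsq [RHS](reindex (fun k : {ffun 'I_n -> 'I_N} => [ffun i => k (s i)])) /=;
  last first.
  exists (fun k : {ffun 'I_n -> 'I_N} => [ffun i => k ((s^-1)%g i)]) => k _;
    by apply/ffunP => i; rewrite !ffunE ?permK ?permKV.
apply: eq_bigr => k _; congr (f _ ^+ 2).
by apply/funext => i; rewrite /= ffunE.
Qed.

Lemma sum_cauchy_schwarz (I : Type) (r : seq I) (F G : I -> R) :
  (\sum_(i <- r) F i * G i) ^+ 2 <= (\sum_(i <- r) F i ^+ 2) * (\sum_(i <- r) G i ^+ 2).
Proof.
have pos (K : I -> R) s : 0 <= \sum_(i <- s) K i ^+ 2 by apply: sumr_ge0 => i _; exact: sqr_ge0.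
elim: r => [|i r]; first by rewrite !big_nil expr0n mulr0.
rewrite !big_cons; move: (F i) (G i) (pos F r) (pos G r) => a b.
move: (\sum_(i <- r) _ * _) (\sum_(i <- r) _ ^+ 2) (\sum_(i <- r) _ ^+ 2) => C B A A0 B0 CAB.
suff X : 2 * (a * b * C) <= a ^+ 2 * B + b ^+ 2 * A.
  have -> : (a * b + C) ^+ 2 = a ^+ 2 * b ^+ 2 + 2 * (a * b * C) + C ^+ 2 by ring.
  have -> : (a ^+ 2 + A) * (b ^+ 2 + B) = a ^+ 2 * b ^+ 2 + (a ^+ 2 * B + b ^+ 2 * A) + A * B by ring.
  lra.
have X0 : 0 <= a ^+ 2 * B + b ^+ 2 * A by apply: addr_ge0; apply: mulr_ge0 => //; exact: sqr_ge0.
rewrite (le_trans (ler_norm _)) // -(@ler_pXn2r _ 2) ?nnegrE ?normr_ge0 //.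
rewrite real_normK ?num_real //.
have := sqr_ge0 (a ^+ 2 * B - b ^+ 2 * A); have := ler_wpM2l (sqr_ge0 (a * b)) CAB.
by rewrite !exprMn; nra.
Qed.

Lemma sqr_sum_le (I : finType) (F : I -> R) :
  (\sum_i F i) ^+ 2 <= #|I|%:R * \sum_i F i ^+ 2.
Proof.
have := sum_cauchy_schwarz (index_enum I) (fun=> 1) F.
rewrite (eq_bigr F) => [|i _]; last by rewrite mul1r.
suff -> : \sum_(i : I) (fun=> 1) i ^+ 2 = #|I|%:R :> R by [].
by rewrite expr1n sumr_const.
Qed.

(** The average over permutations of forms with the same box norm, by
    convexity of the square. *)
Lemma boxsq_Sym n (f : form H n) N : boxsq (Sym f) N <= boxsq f N.
Proof.
have c0 : (0 : R) < n`!%:R by rewrite ltr0n fact_gt0.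
apply: (@le_trans _ _ (\sum_(k : {ffun 'I_n -> 'I_N}) n`!%:R^-1 *
    \sum_(s : 'S_n) f ((fun i => e (k i)) \o s) ^+ 2)).
  apply: ler_sum => k _; rewrite /Sym exprMn expr2 -mulrA ler_pM2l ?invr_gt0 //.
  by rewrite ler_pdivrMl // (le_trans (sqr_sum_le _)) // card_Sn.
rewrite -mulr_sumr ler_pdivrMl // exchange_big /=.
rewrite (eq_bigr (fun=> boxsq f N)); first by rewrite sumr_const card_Sn mulr_natl.
by move=> s _; rewrite -(boxsq_perm f s).
Qed.

End Box.

(** * Algebra of tensors seen as multilinear forms *)

Section FormAlgebra.
Context (R : realType) (H : completeNormedModType R).
Implicit Types (n p q : nat).

Lemma upd_perm n (h : 'I_n -> H) (s : 'S_n) i x :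
  [eta h with i |-> x] \o s = [eta h \o s with (s^-1)%g i |-> x].
Proof.
by apply/funext => j /=; rewrite (canF_eq (permK s)).
Qed.

Lemma upd_lshift p q (h : 'I_(p + q) -> H) i x :
  [eta h with lshift q i |-> x] \o @lshift p q = [eta h \o @lshift p q with i |-> x].
Proof. by apply/funext => j /=; rewrite eq_lshift. Qed.

Lemma upd_lrshift p q (h : 'I_(p + q) -> H) i x :
  [eta h with lshift q i |-> x] \o @rshift p q = h \o @rshift p q.
Proof. by apply/funext => j /=; rewrite eq_rlshift. Qed.

Lemma upd_rshift p q (h : 'I_(p + q) -> H) i x :
  [eta h with rshift p i |-> x] \o @rshift p q = [eta h \o @rshift p q with i |-> x].
Proof. by apply/funext => j /=; rewrite eq_rshift. Qed.

Lemma upd_rlshift p q (h : 'I_(p + q) -> H) i x :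
  [eta h with rshift p i |-> x] \o @lshift p q = h \o @lshift p q.
Proof. by apply/funext => j /=; rewrite eq_lrshift. Qed.

Definition lin n (a : R) (f g : form H n) : form H n := fun h => a * f h + g h.

Lemma multilinear_lin n a (f g : form H n) :
  multilinear_form f -> multilinear_form g -> multilinear_form (lin a f g).
Proof. by move=> fl gl h i b u v; rewrite /lin fl gl; ring. Qed.

Lemma multilinear_Sym n (f : form H n) : multilinear_form f -> multilinear_form (Sym f).
Proof.
move=> fl h i b u v; rewrite /Sym mulrCA -mulrDr; congr (_ * _); rewrite mulr_sumr -big_split /=.
by apply: eq_bigr => s _; rewrite !upd_perm fl.
Qed.

Lemma multilinear_tensor_prod p q (f : form H p) (g : form H q) :
  multilinear_form f -> multilinear_form g -> multilinear_form (tensor_prod f g).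
Proof.
move=> fl gl h i b u v; rewrite /tensor_prod; case: (split_ordP i) => j ->.
  by rewrite !upd_lshift !upd_lrshift fl; ring.
by rewrite !upd_rshift !upd_rlshift gl; ring.
Qed.

Lemma bounded_lin n a (f g : form H n) :
  bounded_form f -> bounded_form g -> bounded_form (lin a f g).
Proof.
move=> [C fC] [D gD]; exists (`|a| * C + D) => h.
rewrite (le_trans (ler_normD _ _)) // mulrDl lerD // normrM -mulrA.
by rewrite ler_wpM2l.
Qed.

Lemma bounded_Sym n (f : form H n) : bounded_form f -> bounded_form (Sym f).
Proof.
move=> [C fC]; exists C => h; rewrite /Sym normrM gtr0_norm ?invr_gt0 ?ltr0n ?fact_gt0 //.
rewrite ler_pdivrMl ?ltr0n ?fact_gt0 // (le_trans (ler_norm_sum _ _ _)) //.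
rewrite -(card_Sn n) mulr_natl -sumr_const; apply: ler_sum => s _.
by rewrite (le_trans (fC _)) // [in leRHS](reindex_inj (@perm_inj _ s)).
Qed.

Lemma bounded_tensor_prod p q (f : form H p) (g : form H q) :
  bounded_form f -> bounded_form g -> bounded_form (tensor_prod f g).
Proof.
move=> [C fC] [D gD]; exists (C * D) => h.
by rewrite big_split_ord /= mulrACA normrM ler_pM.
Qed.

Lemma Sym_sym n (f : form H n) (s : 'S_n) h : Sym f (h \o s) = Sym f h.
Proof.
rewrite /Sym; congr (_ * _); rewrite [RHS](reindex_inj (mulIg s)) /=.
by apply: eq_bigr => t _; congr f; apply/funext => i /=; rewrite permM.
Qed.

Lemma Sym_id n (f : form H n) h : (forall (s : 'S_n) h, f (h \o s) = f h) -> Sym f h = f h.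
Proof.
move=> fs; rewrite /Sym (eq_bigr (fun=> f h)) => [|s _]; last by rewrite fs.
by rewrite sumr_const card_Sn -[f h *+ _]mulr_natl mulKf // pnatr_eq0 -lt0n fact_gt0.
Qed.

Lemma Sym_lin n a (f g : form H n) : Sym (lin a f g) = lin a (Sym f) (Sym g).
Proof.
by apply/funext => h; rewrite /Sym /lin big_split /= -mulr_sumr; ring.
Qed.

Lemma tensor_prod_linl p q a (f g : form H p) (k : form H q) :
  tensor_prod (lin a f g) k = lin a (tensor_prod f k) (tensor_prod g k).
Proof. by apply/funext => h; rewrite /tensor_prod /lin; ring. Qed.

Lemma tensor_prod_linr p q a (f g : form H q) (k : form H p) :
  tensor_prod k (lin a f g) = lin a (tensor_prod k f) (tensor_prod k g).
Proof. by apply/funext => h; rewrite /tensor_prod /lin; ring. Qed.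

Lemma sym_prod_linl p q a (f g : form H p) (k : form H q) :
  sym_prod (lin a f g) k = lin a (sym_prod f k) (sym_prod g k).
Proof. by rewrite /sym_prod tensor_prod_linl Sym_lin. Qed.

Lemma sym_prod_linr p q a (f g : form H q) (k : form H p) :
  sym_prod k (lin a f g) = lin a (sym_prod k f) (sym_prod k g).
Proof. by rewrite /sym_prod tensor_prod_linr Sym_lin. Qed.

(** A permutation of each of two blocks of variables, as a permutation of
    all of them; it lets an outer symmetrisation absorb the inner ones. *)
Definition block_perm_fun p q (s : 'S_p) (t : 'S_q) (i : 'I_(p + q)) : 'I_(p + q) :=
  match fintype.split i with inl j => lshift q (s j) | inr j => rshift p (t j) end.

Lemma block_perm_inj p q (s : 'S_p) (t : 'S_q) : injective (block_perm_fun s t).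
Proof.
move=> i j; rewrite /block_perm_fun.
case: (split_ordP i) => i' ->; case: (split_ordP j) => j' -> /eqP;
  rewrite ?eq_lshift ?eq_rshift ?eq_lrshift ?eq_rlshift // => /eqP/perm_inj -> //.
Qed.

Definition block_perm p q (s : 'S_p) (t : 'S_q) : 'S_(p + q) := perm (@block_perm_inj p q s t).

Lemma block_permL p q (s : 'S_p) (t : 'S_q) j : block_perm s t (lshift q j) = lshift q (s j).
Proof. by rewrite permE /block_perm_fun (unsplitK (inl j)). Qed.

Lemma block_permR p q (s : 'S_p) (t : 'S_q) j : block_perm s t (rshift p j) = rshift p (t j).
Proof. by rewrite permE /block_perm_fun (unsplitK (inr j)). Qed.

(** Each term of the inner symmetrisations is a permutation of the variables
    of the outer one. *)
Lemma Sym_tensor_prod p q (f : form H p) (g : form H q) :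
  Sym (tensor_prod (Sym f) (Sym g)) = Sym (tensor_prod f g).
Proof.
apply/funext => h; rewrite {1}/Sym.
under eq_bigr => s _ do rewrite /tensor_prod /Sym mulrACA big_distrlr /=.
rewrite -mulr_sumr exchange_big /=.
rewrite (eq_bigr (fun=> \sum_(t : 'S_q) \sum_(s : 'S_(p + q)) tensor_prod f g (h \o s))).
  rewrite !sumr_const !card_Sn -mulrnA -[X in _ * (_ * X)]mulr_natl natrM /Sym.
  have fn0 k : (k`!%:R : R) != 0 by rewrite pnatr_eq0 -lt0n fact_gt0.
  by field; rewrite ?fn0.
move=> s _; rewrite exchange_big /=; apply: eq_bigr => t _.
rewrite [RHS](reindex_inj (mulgI (block_perm s t))) /=; apply: eq_bigr => u _.
by rewrite /tensor_prod; congr (f _ * g _); apply/funext => i /=;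
  rewrite permM ?block_permL ?block_permR.
Qed.

(** The iterated symmetric product with the number of factors as a separate
    argument, so that the order of the form does not change syntactically
    when the list of factors is rewritten. *)
Fixpoint sbp k (l : seq (form H 2)) : form H (k * 2) :=
  match k return form H (k * 2) with
  | 0%N => fun=> 1
  | k'.+1 => sym_prod (head (fun=> 0) l) (@sbp k' (behead l))
  end.

Arguments sbp k l : clear implicits.

Lemma sym_bigprodE l : @sym_bigprod R H l = sbp (size l) l.
Proof. by elim: l => //= f l ->. Qed.

Lemma sbp_lin k l1 l2 a (f g : form H 2) : (size l1 < k)%N ->
  sbp k (l1 ++ lin a f g :: l2) = lin a (sbp k (l1 ++ f :: l2)) (sbp k (l1 ++ g :: l2)).
Proof.
elim: l1 k => [|f0 l1 IH] [|k] //=; first by rewrite sym_prod_linl.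
by rewrite ltnS => lk; rewrite IH // sym_prod_linr.
Qed.

Variable e : nat -> H.

Lemma tensor_lin n a (f g : form H n) : tensor e f -> tensor e g -> tensor e (lin a f g).
Proof.
move=> [f1 f2 f3] [g1 g2 g3]; split; [exact: multilinear_lin|exact: bounded_lin|].
exact: sqnorm_lin.
Qed.

Lemma symmetric_lin n a (f g : form H n) :
  symmetric_tensor e f -> symmetric_tensor e g -> symmetric_tensor e (lin a f g).
Proof.
move=> [tf sf] [tg sg]; split; first exact: tensor_lin.
by move=> s h; rewrite /lin sf sg.
Qed.

Lemma symmetric_fin n (f : form H n) : symmetric_tensor e f -> (tensor_sqnorm e f < +oo)%E.
Proof. by case=> -[]. Qed.

Lemma symmetric_Sym n (f : form H n) : tensor e f -> symmetric_tensor e (Sym f).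
Proof.
move=> [f1 f2 f3]; split; last by move=> s h; exact: Sym_sym.
split; [exact: multilinear_Sym|exact: bounded_Sym|].
suff /hsq_le_box[] : forall N, boxsq e (Sym f) N <= hsq e f by [].
by move=> N; apply: le_trans (boxsq_Sym _ _ _) _; exact: boxsq_le.
Qed.

Lemma hsq_Sym n (f : form H n) : tensor e f -> hsq e (Sym f) <= hsq e f.
Proof.
case=> _ _ f3; suff /hsq_le_box[] : forall N, boxsq e (Sym f) N <= hsq e f by [].
by move=> N; apply: le_trans (boxsq_Sym _ _ _) _; exact: boxsq_le.
Qed.

Lemma tensor_prod_hsq p q (f : form H p) (g : form H q) : tensor e f -> tensor e g ->
  tensor e (tensor_prod f g) /\ hsq e (tensor_prod f g) <= hsq e f * hsq e g.
Proof.
move=> [f1 f2 f3] [g1 g2 g3].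
have /hsq_le_box[fin le] : forall N, boxsq e (tensor_prod f g) N <= hsq e f * hsq e g.
  by move=> N; rewrite boxsq_tensor_prod ler_pM ?boxsq_ge0 ?boxsq_le.
by split=> //; split; [exact: multilinear_tensor_prod|exact: bounded_tensor_prod|].
Qed.

Definition sym_tensors : seq (form H 2) -> Prop :=
  foldr (fun f P => symmetric_tensor e f /\ P) True.

Lemma sym_tensors_cat l1 l2 : sym_tensors (l1 ++ l2) <-> sym_tensors l1 /\ sym_tensors l2.
Proof. by elim: l1 => [|f l1 IH] /=; rewrite ?IH; tauto. Qed.

Lemma sym_tensors_map (T : Type) (F : T -> form H 2) (r : seq T) :
  (forall i, symmetric_tensor e (F i)) -> sym_tensors (map F r).
Proof. by move=> hF; elim: r. Qed.

Lemma sbp_hsq l : sym_tensors l ->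
  symmetric_tensor e (sbp (size l) l) /\
  hsq e (sbp (size l) l) <= \prod_(f <- l) hsq e f.
Proof.
elim: l => [_|f l IH] /=.
  rewrite big_nil; have /hsq_le_box[fin le] : forall N, boxsq e (fun _ : 'I_0 -> H => 1 : R) N <= 1.
    by move=> N; rewrite /boxsq sumr_const expr1n card_ffun !card_ord expn0.
  split=> //; split=> //; split=> //; first by move=> h [].
  by exists 1 => h; rewrite big_ord0 normr1 mulr1.
move=> [[tf _] /IH[[tl _] le]]; rewrite big_cons.
have [t1 t2] := tensor_prod_hsq tf tl; split; first exact: symmetric_Sym.
rewrite (le_trans (hsq_Sym t1)) // (le_trans t2) // ler_wpM2l // hsq_ge0 //.
Qed.

End FormAlgebra.

Arguments sbp {R H} k l _.

(** * Tensors of order two, their operators and traces *)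

Section TwoForms.
Context (R : realType) (H : completeNormedModType R) (ip : {dot H for idfun}).
Hypothesis hip : forall x, ip x x = `|x| ^+ 2.
Variable e : nat -> H.
Hypothesis he : orthonormal_basis ip e.
Implicit Types (f g p : form H 2) (x y u v : H).

Lemma pair2_eta (h : 'I_2 -> H) : h = pair2 (h ord0) (h ord_max).
Proof.
apply/funext => i; rewrite /pair2; case: eqP => [->//|/eqP i0].
by congr h; apply/val_inj; case: i i0 => [[|[|//]] ?].
Qed.

Lemma form2_ext f g : (forall x y, f (pair2 x y) = g (pair2 x y)) -> f = g.
Proof. by move=> fg; apply/funext => h; rewrite (pair2_eta h) fg. Qed.

Lemma pair2_upd0 x y u : [eta pair2 x y with ord0 |-> u] = pair2 u y :> ('I_2 -> H).
Proof. by apply/funext => i /=; rewrite /pair2; case: eqP. Qed.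

Lemma pair2_upd1 x y u : [eta pair2 x y with ord_max |-> u] = pair2 x u :> ('I_2 -> H).
Proof.
apply/funext => i /=; rewrite /pair2.
by have [->|->] : i = ord0 \/ i = ord_max
  by case: i => [[|[|//]] ?]; [left|right]; apply/val_inj.
Qed.

Lemma big_ord2 (F : 'I_2 -> R) : \prod_(i < 2) F i = F ord0 * F ord_max.
Proof. by rewrite big_ord_recl big_ord1; congr (_ * F _); exact/val_inj. Qed.

(** The part of being a 2-tensor that makes operators and compositions
    meaningful, without square-summability. *)
Definition bform f := multilinear_form f /\ bounded_form f.

Lemma tensor_bform f : tensor e f -> bform f. Proof. by case. Qed.

Lemma symmetric_bform f : symmetric_tensor e f -> bform f. Proof. by case=> /tensor_bform. Qed.

Lemma bform_linl f y : bform f -> scalar (fun x => f (pair2 x y)).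
Proof.
by case=> fl _ a u v; have := fl (pair2 0 y) ord0 a u v; rewrite !pair2_upd0.
Qed.

Lemma bform_linr f x : bform f -> scalar (fun y => f (pair2 x y)).
Proof.
by case=> fl _ a u v; have := fl (pair2 x 0) ord_max a u v; rewrite !pair2_upd1.
Qed.

Lemma bform_le f : bform f -> exists2 C, 0 <= C &
  forall x y, `|f (pair2 x y)| <= C * `|x| * `|y|.
Proof.
case=> _ [C fC]; exists `|C| => // x y.
rewrite (le_trans (fC _)) // big_ord2 mulrA /pair2 /=.
by rewrite ler_wpM2r // ler_wpM2r // ler_norm.
Qed.

Lemma mk_bform (F : H -> H -> R) C :
  (forall y, scalar (F^~ y)) -> (forall x, scalar (F x)) ->
  (forall x y, `|F x y| <= C * `|x| * `|y|) -> bform (fun h => F (h ord0) (h ord_max)).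
Proof.
move=> Fl Fr FC; split; last first.
  by exists C => h; rewrite big_ord2 mulrA FC.
move=> h i a u v /=.
have [->|->] : i = ord0 \/ i = ord_max.
  by case: i => [[|[|//]] ?]; [left|right]; apply/val_inj.
- by rewrite !eqxx /= Fl.
- by rewrite !eqxx /= Fr.
Qed.

Lemma bform_lim_coef f x : bform f ->
  forall y, series (fun k => f (pair2 x (e k)) * ip (e k) y) @ \oo --> f (pair2 x y).
Proof.
move=> hf y; have [C C0 fC] := bform_le hf.
exact: (functional_expansion he (bform_linr x hf) (fC x)).
Qed.

Lemma bform_lim_coefl f y : bform f ->
  forall x, series (fun k => f (pair2 (e k) y) * ip (e k) x) @ \oo --> f (pair2 x y).
Proof.
move=> hf x; have [C C0 fC] := bform_le hf.
apply: (@functional_expansion _ _ _ _ he (fun x => f (pair2 x y)) (C * `|y|)).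
  exact: bform_linl.
by move=> z; rewrite (le_trans (fC _ _)) // mulrAC.
Qed.

Local Notation A := (HS_op ip e).

(** The coefficients are square-summable as those of the bounded functional
    [x |-> f (x, y)]. *)
Lemma HS_op_cvg f y : bform f ->
  series (fun i => f (pair2 (e i) y) *: e i) @ \oo --> A f y.
Proof.
move=> hf; rewrite /HS_op.
have -> : (fun i => limn (series (fun k => f (pair2 (e i) (e k)) * ip (e k) y)) *: e i)
    = (fun i => f (pair2 (e i) y) *: e i).
  by apply/funext => i; congr (_ *: _); apply: cvg_lim => //; exact: bform_lim_coef.
have [C C0 fC] := bform_le hf.
apply: (@l2_series_cvg _ _ ip hip e he _ ((C * `|y|) ^+ 2)) => n.
apply: (@functional_l2 _ _ ip hip e he (fun x => f (pair2 x y))); first exact: bform_linl.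
by move=> z; rewrite (le_trans (fC _ _)) // mulrAC.
Qed.

(** A continuous linear functional passes through the series defining the
    operator. *)
Lemma ip_HS_op f x y : bform f -> ip x (A f y) = f (pair2 x y).
Proof.
move=> hf; have xl : scalar (ip x) by move=> a u v; rewrite ipDr ipZr.
have := functional_cvg xl (@ip_cauchy_schwarz _ _ ip hip x) (@HS_op_cvg f y hf).
move=> /(cvg_lim (@Rhausdorff R)) <-; apply: cvg_lim => //.
apply: cvg_trans (@bform_lim_coefl f y hf x); apply: near_eq_cvg.
apply: nearW => n /=; rewrite ip_sumr; apply: eq_bigr => k _.
by rewrite ipZr (ipC ip x).
Qed.

Lemma HS_op_lin f : bform f -> forall a u v, A f (a *: u + v) = a *: A f u + A f v.
Proof.
move=> hf a u v; apply: (ip_ext hip) => z.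
by rewrite ipDr ipZr !ip_HS_op // (bform_linr z hf).
Qed.

Lemma HS_op_bound f : bform f -> exists2 C, 0 <= C & forall x, `|A f x| <= C * `|x|.
Proof.
move=> hf; have [C C0 fC] := bform_le hf; exists C => // x.
apply: ler_sqr_sqrt; rewrite ?mulr_ge0 // -hip ip_HS_op //.
by rewrite (le_trans (ler_norm _)) // (le_trans (fC _ _)) // mulrAC.
Qed.

Lemma bform_comp f g : bform f -> bform g ->
  bform (fun h => f (pair2 (h ord0) (A g (h ord_max)))).
Proof.
move=> hf hg; have [C C0 fC] := bform_le hf; have [D D0 gD] := HS_op_bound hg.
apply: (@mk_bform (fun x y => f (pair2 x (A g y))) (C * D)).
- by move=> y; exact: bform_linl.
- by move=> x a u v; rewrite HS_op_lin // bform_linr.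
- move=> x y; rewrite (le_trans (fC _ _)) // -!mulrA ler_wpM2l // [leRHS]mulrCA.
  by rewrite ler_wpM2l.
Qed.

(** Summing over the middle index is the expansion of [A g] in the basis,
    and summing over the outer ones that of both arguments: the triple
    series is the form of the composed operators. *)
Lemma starE f g : bform f -> bform g ->
  star ip e f g = fun h => f (pair2 (h ord0) (A g (h ord_max))).
Proof.
move=> hf hg; apply/funext => h; have [C C0 fC] := bform_le hf; have [D D0 gD] := HS_op_bound hg.
rewrite /star; apply: cvg_lim => //.
have -> : (fun i => limn (series (fun j =>
    limn (series (fun k => f (pair2 (e i) (e k)) * g (pair2 (e k) (e j)))) *
    (ip (e i) (h ord0) * ip (e j) (h ord_max))))) =
    (fun i => f (pair2 (e i) (A g (h ord_max))) * ip (e i) (h ord0)).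
  apply/funext => i; apply: cvg_lim => //.
  have -> : (fun j => limn (series (fun k => f (pair2 (e i) (e k)) * g (pair2 (e k) (e j)))) *
    (ip (e i) (h ord0) * ip (e j) (h ord_max))) =
    (fun j => (f (pair2 (e i) (A g (e j))) * ip (e i) (h ord0)) * ip (e j) (h ord_max)).
    apply/funext => j; rewrite mulrA; congr (_ * _ * _); apply: cvg_lim => //.
    have := @bform_lim_coef f (e i) hf (A g (e j)).
    by under eq_fun do rewrite ip_HS_op //.
  apply: (@functional_expansion _ _ _ _ he
     (fun y => f (pair2 (e i) (A g y)) * ip (e i) (h ord0)) (C * `|e i| * D * `|ip (e i) (h ord0)|)).
    by move=> a u v /=; rewrite HS_op_lin // bform_linr //; ring.
  move=> y; rewrite normrM [leRHS]mulrAC ler_wpM2r // (le_trans (fC _ _)) //.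
  by rewrite -[leRHS]mulrA ler_wpM2l ?mulr_ge0.
exact: bform_lim_coefl.
Qed.

Lemma star_pair f g x y : bform f -> bform g ->
  star ip e f g (pair2 x y) = f (pair2 x (A g y)).
Proof. by move=> hf hg; rewrite starE. Qed.

Lemma bform_star f g : bform f -> bform g -> bform (star ip e f g).
Proof. by move=> hf hg; rewrite starE //; exact: bform_comp. Qed.

Lemma HS_op_star f g x : bform f -> bform g -> A (star ip e f g) x = A f (A g x).
Proof.
move=> hf hg; apply: (ip_ext hip) => z.
by rewrite ip_HS_op; [rewrite star_pair // ip_HS_op|exact: bform_star].
Qed.

Lemma star_linl a f g p : bform f -> bform g -> bform p ->
  star ip e (lin a f g) p = lin a (star ip e f p) (star ip e g p).
Proof.
move=> hf hg hp; have hl : bform (lin a f g).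
  by split; [apply: multilinear_lin; [case: hf|case: hg]|apply: bounded_lin; [case: hf|case: hg]].
by apply: form2_ext => x y; rewrite star_pair // /lin !star_pair.
Qed.

Lemma star_linr a f g p : bform f -> bform g -> bform p ->
  star ip e p (lin a f g) = lin a (star ip e p f) (star ip e p g).
Proof.
move=> hf hg hp; have hl : bform (lin a f g).
  by split; [apply: multilinear_lin; [case: hf|case: hg]|apply: bounded_lin; [case: hf|case: hg]].
apply: form2_ext => x y; rewrite star_pair // /lin !star_pair //.
rewrite -(bform_linr x hp); congr (p (pair2 _ _)); apply: (ip_ext hip) => z.
by rewrite ipDr ipZr !ip_HS_op.
Qed.

Definition transp f : form H 2 := fun h => f (pair2 (h ord_max) (h ord0)).

Lemma sym_pair f x y : (forall (s : 'S_2) h, f (h \o s) = f h) ->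
  f (pair2 y x) = f (pair2 x y).
Proof.
move=> fs; rewrite -(fs (tperm ord0 ord_max)); congr f; apply/funext => i.
rewrite /pair2 /=; have [->|->] : i = ord0 \/ i = ord_max.
- by case: i => [[|[|//]] ?]; [left|right]; apply/val_inj.
- by rewrite tpermL.
- by rewrite tpermR.
Qed.

Lemma Sym2 f h : Sym f h = 2^-1 * (f (pair2 (h ord0) (h ord_max)) + f (pair2 (h ord_max) (h ord0))).
Proof.
rewrite /Sym; congr (_ * _); rewrite (bigD1 (1%g)) //= (bigD1 (tperm ord0 ord_max)) /=; last first.
  by apply/eqP => /permP/(_ ord0); rewrite tpermL perm1 => /(congr1 val).
rewrite big1 ?addr0; last first.
  move=> s /andP[s1 st]; have [s0|s0] : s ord0 = ord0 \/ s ord0 = ord_max.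
  - by case: (s ord0) => [[|[|//]] ?]; [left|right]; apply/val_inj.
  - case/eqP: s1; apply/permP => i; rewrite perm1.
    have [->|->] : i = ord0 \/ i = ord_max; rewrite ?s0 //.
    + by case: i => [[|[|//]] ?]; [left|right]; apply/val_inj.
    + have [//|sm] : s ord_max = ord_max \/ s ord_max = ord0.
        by case: (s ord_max) => [[|[|//]] ?]; [right|left]; apply/val_inj.
      by have := @perm_inj _ s ord_max ord0; rewrite s0 sm => /(_ erefl)/(congr1 val).
  - case/eqP: st; apply/permP => i.
    have [->|->] : i = ord0 \/ i = ord_max; rewrite ?tpermL ?tpermR ?s0 //.
    + by case: i => [[|[|//]] ?]; [left|right]; apply/val_inj.
    + have [sm|//] : s ord_max = ord_max \/ s ord_max = ord0.
        by case: (s ord_max) => [[|[|//]] ?]; [right|left]; apply/val_inj.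
      by have := @perm_inj _ s ord_max ord0; rewrite s0 sm => /(_ erefl)/(congr1 val).
congr (f _ + f _); first by rewrite -pair2_eta; apply/funext => i /=; rewrite perm1.
rewrite [LHS]pair2_eta /=; congr pair2; first by rewrite tpermL.
by rewrite tpermR.
Qed.

Lemma Sym2_pair f x y : Sym f (pair2 x y) = 2^-1 * (f (pair2 x y) + f (pair2 y x)).
Proof. by rewrite Sym2. Qed.

Lemma boxsq2 f N : boxsq e f N = \sum_(i < N) \sum_(j < N) f (pair2 (e i) (e j)) ^+ 2.
Proof.
rewrite /boxsq pair_big /=.
rewrite [RHS](reindex (fun k : {ffun 'I_2 -> 'I_N} => (k ord0, k ord_max))) /=; last first.
  exists (fun p : 'I_N * 'I_N => [ffun i => if i == ord0 then p.1 else p.2]).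
    move=> k _; apply/ffunP => i; rewrite ffunE /=.
    have [->//|->//] : i = ord0 \/ i = ord_max.
    by case: i => [[|[|//]] ?]; [left|right]; apply/val_inj.
  by move=> [i j] _; rewrite !ffunE.
by apply: eq_bigr => k _; rewrite [X in f X]pair2_eta.
Qed.

Lemma coef_prod_le f g n N : tensor e f -> tensor e g ->
  (\sum_(i < n) \sum_(k < N) f (pair2 (e i) (e k)) ^+ 2) *
  (\sum_(k < N) \sum_(j < n) g (pair2 (e k) (e j)) ^+ 2) <= hsq e f * hsq e g.
Proof.
move=> [_ _ ff] [_ _ gf]; pose M := maxn n N.
have w (F : nat -> nat -> R) a b : (forall i j, 0 <= F i j) -> (a <= M)%N -> (b <= M)%N ->
    \sum_(i < a) \sum_(j < b) F i j <= \sum_(i < M) \sum_(j < M) F i j.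
  move=> F0 aM bM; rewrite -(big_mkord xpredT (fun i => \sum_(j < b) F i j)).
  rewrite -(big_mkord xpredT (fun i => \sum_(j < M) F i j)) /=.
  apply: (@le_trans _ _ (\sum_(0 <= i < a) \sum_(j < M) F i j)).
    apply: ler_sum => i _; rewrite -(big_mkord xpredT (F i)) -[leRHS](big_mkord xpredT (F i)).
    by rewrite [leRHS](big_cat_nat (n := b)) //= lerDl sumr_ge0.
  rewrite [leRHS](big_cat_nat (n := a)) //= lerDl sumr_ge0 // => i _.
  by rewrite sumr_ge0.
have s0 a b (F : nat -> nat -> R) : 0 <= \sum_(i < a) \sum_(j < b) F i j ^+ 2.
  by apply: sumr_ge0 => i _; apply: sumr_ge0 => j _; exact: sqr_ge0.
apply: ler_pM; rewrite ?(s0 _ _ (fun i j => f (pair2 (e i) (e j))))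
    ?(s0 _ _ (fun i j => g (pair2 (e i) (e j)))) //.
  apply: le_trans (boxsq_le M ff); rewrite boxsq2.
  by apply: (w (fun i j => f (pair2 (e i) (e j)) ^+ 2)); rewrite ?leq_maxl ?leq_maxr // => *; exact: sqr_ge0.
apply: le_trans (boxsq_le M gf); rewrite boxsq2.
by apply: (w (fun i j => g (pair2 (e i) (e j)) ^+ 2)); rewrite ?leq_maxl ?leq_maxr // => *; exact: sqr_ge0.
Qed.

Lemma star_coef_cvg f g x y : bform f -> bform g ->
  (fun M => \sum_(k < M) f (pair2 x (e k)) * g (pair2 (e k) y)) @ \oo --> f (pair2 x (A g y)).
Proof.
move=> hf hg; apply: cvg_trans (@bform_lim_coef f x hf (A g y)); apply: near_eq_cvg.
by apply: nearW => n; rewrite /series /= big_mkord; apply: eq_bigr => k _; rewrite ip_HS_op.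
Qed.

(** Cauchy-Schwarz in the middle index, on finite boxes. *)
Lemma star_hsq f g : tensor e f -> tensor e g ->
  tensor e (star ip e f g) /\ hsq e (star ip e f g) <= hsq e f * hsq e g.
Proof.
move=> tf tg; have [hf hg] := (tensor_bform tf, tensor_bform tg).
have /hsq_le_box[fin le] : forall N, boxsq e (star ip e f g) N <= hsq e f * hsq e g.
  move=> N; rewrite boxsq2.
  apply: (@cvg_seq_le _ (fun M => \sum_(i < N) \sum_(j < N)
     (\sum_(k < M) f (pair2 (e i) (e k)) * g (pair2 (e k) (e j))) ^+ 2)).
    apply: cvg_sumr => i; apply: cvg_sumr => j; rewrite star_pair //.
    by under eq_fun do rewrite expr2; rewrite expr2; apply: cvgM; exact: star_coef_cvg.
  move=> M; apply: le_trans (coef_prod_le N M tf tg).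
  rewrite [X in _ <= _ * X]exchange_big /= big_distrlr /=.
  by apply: ler_sum => i _; apply: ler_sum => j _; exact: sum_cauchy_schwarz.
by have [b1 b2] := bform_star hf hg; split.
Qed.

Lemma tensor_star f g : tensor e f -> tensor e g -> tensor e (star ip e f g).
Proof. by move=> tf tg; case: (star_hsq tf tg). Qed.

Definition hs n (f : form H n) : R := Num.sqrt (hsq e f).

Lemma hs_ge0 n (f : form H n) : 0 <= hs f. Proof. exact: sqrtr_ge0. Qed.

(** The trace of the composition of the two operators, in the form in which
    contractions of second-chaos variables produce it. *)
Definition tr2 f g : R := trace ip e (fun x => A f (A g x)).

(** Cauchy-Schwarz over both indices, on finite boxes. *)
Lemma tr2_abs f g n : tensor e f -> tensor e g ->
  \sum_(0 <= k < n) `|f (pair2 (e k) (A g (e k)))| <= hs f * hs g.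
Proof.
move=> tf tg; have [hf hg] := (tensor_bform tf, tensor_bform tg).
rewrite big_mkord; apply: (@cvg_seq_le _ (fun M => \sum_(i < n)
   `|\sum_(k < M) f (pair2 (e i) (e k)) * g (pair2 (e k) (e i))|)).
  by apply: cvg_sumr => i; apply: cvg_norm; exact: star_coef_cvg.
move=> M; apply: (@le_trans _ _ (\sum_(i < n) \sum_(k < M)
   `|f (pair2 (e i) (e k))| * `|g (pair2 (e k) (e i))|)).
  apply: ler_sum => i _; rewrite (le_trans (ler_norm_sum _ _ _)) //.
  by apply: ler_sum => k _; rewrite normrM.
rewrite /hs -sqrtrM ?hsq_ge0 // -(@ler_pXn2r _ 2) ?nnegrE ?sqrtr_ge0 //; last first.
  by apply: sumr_ge0 => i _; apply: sumr_ge0 => k _; rewrite mulr_ge0.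
rewrite sqr_sqrtr ?mulr_ge0 ?hsq_ge0 //; apply: le_trans (coef_prod_le n M tf tg).
rewrite [X in _ <= _ * X]exchange_big /= !pair_big /=.
apply: le_trans (sum_cauchy_schwarz _ _ _) _; rewrite le_eqVlt; apply/orP; left; apply/eqP.
by congr (_ * _); apply: eq_bigr => k _; rewrite real_normK ?num_real.
Qed.

Lemma tr2_cvg f g : tensor e f -> tensor e g ->
  series (fun k => f (pair2 (e k) (A g (e k)))) @ \oo --> tr2 f g.
Proof.
move=> tf tg; have [hf hg] := (tensor_bform tf, tensor_bform tg).
rewrite /tr2 /trace; have -> : (fun k => ip (e k) (A f (A g (e k)))) =
   (fun k => f (pair2 (e k) (A g (e k)))).
  by apply/funext => k; rewrite ip_HS_op.
apply: normed_cvg; apply: nondecreasing_is_cvgn.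
  apply/nondecreasing_seqP => n; rewrite /normed_series_of /series /=.
  by rewrite big_nat_recr //= lerDl.
by exists (hs f * hs g) => _ [n _ <-]; exact: tr2_abs.
Qed.

Lemma tr2_le f g : tensor e f -> tensor e g -> `|tr2 f g| <= hs f * hs g.
Proof.
move=> tf tg; apply: (cvg_seq_le (cvg_norm (tr2_cvg tf tg))) => n.
by rewrite (le_trans (ler_norm_sum _ _ _)) // tr2_abs.
Qed.

Lemma tr2_linl a f g p : tensor e f -> tensor e g -> tensor e p ->
  tr2 (lin a f g) p = a * tr2 f p + tr2 g p.
Proof.
move=> tf tg tp; have tl := tensor_lin a tf tg.
have c := cvgD (cvgM (cvg_cst a) (tr2_cvg tf tp)) (tr2_cvg tg tp).
rewrite -(cvg_lim (@Rhausdorff R) (c _ _ _)); apply/esym/cvg_lim => //.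
apply: cvg_trans (tr2_cvg tl tp); apply: near_eq_cvg; apply: nearW => n.
rewrite /series /= fctE big_split /=; congr (_ + _).
by rewrite mulr_sumr.
Qed.

Lemma tr2_linr a f g p : tensor e f -> tensor e g -> tensor e p ->
  tr2 p (lin a f g) = a * tr2 p f + tr2 p g.
Proof.
move=> tf tg tp; have tl := tensor_lin a tf tg.
have hp := tensor_bform tp; have hf := tensor_bform tf; have hg := tensor_bform tg.
have c := cvgD (cvgM (cvg_cst a) (tr2_cvg tp tf)) (tr2_cvg tp tg).
rewrite -(cvg_lim (@Rhausdorff R) (c _ _ _)); apply/esym/cvg_lim => //.
apply: cvg_trans (tr2_cvg tp tl); apply: near_eq_cvg; apply: nearW => n.
rewrite /series /= fctE /= mulr_sumr -big_split; apply: eq_bigr => k _ /=.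
rewrite -(bform_linr (e k) hp); congr (p (pair2 _ _)); apply: (ip_ext hip) => z.
by rewrite ipDr ipZr !ip_HS_op //; exact: tensor_bform.
Qed.

End TwoForms.

(** * Rank-one tensors and the density of their span *)

Lemma norm_lin_sub (R : realType) (a x y z w : R) :
  `|a * x + y - (a * z + w)| <= `|a| * `|x - z| + `|y - w|.
Proof.
have -> : a * x + y - (a * z + w) = a * (x - z) + (y - w) by ring.
by rewrite -normrM; exact: ler_normD.
Qed.

Section RankOne.
Context (R : realType) (H : completeNormedModType R) (ip : {dot H for idfun}).
Hypothesis hip : forall x, ip x x = `|x| ^+ 2.
Variable e : nat -> H.
Hypothesis he : orthonormal_basis ip e.
Implicit Types (f g p : form H 2) (x y u v : H).

Definition pure n (v : 'I_n -> H) : form H n := fun h => \prod_(i < n) ip (v i) (h i).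

Lemma tensor_pure n (v : 'I_n -> H) : tensor e (pure v).
Proof.
split.
- move=> h i a x y; rewrite /pure.
  have E z : \prod_(j < n) ip (v j) ([eta h with i |-> z] j) =
      ip (v i) z * \prod_(j < n | j != i) ip (v j) (h j).
    by rewrite (bigD1 i) //= eqxx; congr (_ * _); apply: eq_bigr => j /negPf ->.
  by rewrite !E ipDr ipZr mulrDl mulrA.
- exists (\prod_(i < n) `|v i|) => h; rewrite /pure normr_prod -big_split /=.
  by apply: ler_prod => i _; rewrite normr_ge0 /=; exact: ip_cauchy_schwarz.
- have /hsq_le_box[] // : forall N, boxsq e (pure v) N <= \prod_(i < n) `|v i| ^+ 2.
  move=> N; rewrite /boxsq /pure; under eq_bigr do rewrite -prodrXl.
  rewrite -(bigA_distr_bigA (fun i (j : 'I_N) => ip (v i) (e j) ^+ 2)) /=.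
  apply: ler_prod => i _; rewrite sumr_ge0 => [/=|j _]; last exact: sqr_ge0.
  rewrite -(big_mkord xpredT (fun j => ip (v i) (e j) ^+ 2)) /=.
  by under eq_bigr do rewrite (ipC ip (v i)); exact: (bessel hip he).
Qed.

Local Notation sq u := (@tensor_power R H ip u 2).

Lemma sqE u x y : sq u (pair2 x y) = ip u x * ip u y.
Proof. by rewrite /tensor_power big_ord2. Qed.

Lemma symmetric_power u n : symmetric_tensor e (@tensor_power R H ip u n).
Proof.
split; first exact: (tensor_pure (fun=> u)).
by move=> s h; rewrite /tensor_power [RHS](reindex_inj (@perm_inj _ s)).
Qed.

Local Notation A := (HS_op ip e).

Lemma HS_op_sq u x : A (sq u) x = ip u x *: u.
Proof.
apply: (ip_ext hip) => z; rewrite (ip_HS_op hip he); last first.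
  exact: symmetric_bform (symmetric_power _ _).
by rewrite sqE ipZr (ipC ip z) mulrC.
Qed.

Lemma tr2_sq f u : tensor e f -> tr2 ip e f (sq u) = f (pair2 u u).
Proof.
move=> tf; have hf := tensor_bform tf; have ts := (symmetric_power u 2).1.
rewrite -(cvg_lim (@Rhausdorff R) (tr2_cvg hip he tf ts)); apply: cvg_lim => //.
apply: cvg_trans (bform_lim_coefl he (y := u) hf (x := u)); apply: near_eq_cvg; apply: nearW => n.
rewrite /series /=; apply: eq_bigr => k _; rewrite HS_op_sq (ipC ip u) mulrC.
have := bform_linr (e k) hf (ip (e k) u) u 0.
rewrite !addr0 => ->; rewrite [X in _ + X](_ : _ = 0) ?addr0 //.
have := bform_linr (e k) hf (-1) 0 0; rewrite scaler0 addr0 mulN1r addNr => ->//.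
Qed.

Definition zero_form : form H 2 := fun=> 0.

Lemma symmetric_zero : symmetric_tensor e zero_form.
Proof.
have -> : zero_form = lin (-1) (sq 0) (sq 0).
  by apply/funext => h; rewrite /lin mulN1r addNr.
by apply: symmetric_lin; exact: symmetric_power.
Qed.

Lemma hsq_zero : hsq e zero_form = 0.
Proof.
apply/eqP; rewrite eq_le hsq_ge0 andbT.
suff /hsq_le_box[] : forall N, boxsq e zero_form N <= 0 by [].
by move=> N; rewrite /boxsq big1 // => k _; rewrite expr0n.
Qed.

Lemma tr2_zeror f : tensor e f -> tr2 ip e f zero_form = 0.
Proof.
move=> tf; have [tz _] := symmetric_zero.
have := tr2_linr hip he (-1) tz tz tf; rewrite mulN1r addNr => <-.
by congr (tr2 _ _ _ _); apply/funext => h; rewrite /lin /zero_form mulr0 addr0.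
Qed.

Section Density.
Variables (phi : form H 2 -> R) (C : R).
Hypothesis phi_lin : forall a f g, symmetric_tensor e f -> symmetric_tensor e g ->
  phi (lin a f g) <= `|a| * phi f + phi g.
Hypothesis phi_le : forall f, symmetric_tensor e f -> phi f <= C * hs e f.
Hypothesis phi_sq : forall u, phi (sq u) <= 0.

Let phi_zero : phi zero_form <= 0.
Proof. by rewrite (le_trans (phi_le symmetric_zero)) // /hs hsq_zero sqrtr0 mulr0. Qed.

Definition sq_comb (r : seq (R * H)) : form H 2 :=
  foldr (fun c => lin c.1 (sq c.2)) zero_form r.

Lemma symmetric_sq_comb r : symmetric_tensor e (sq_comb r).
Proof.
elim: r => [|c r IH] /=; first exact: symmetric_zero.
by apply: symmetric_lin => //; exact: symmetric_power.
Qed.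

Lemma phi_sq_comb r : phi (sq_comb r) <= 0.
Proof.
elim: r => [|c r IH] /=; first exact: phi_zero.
rewrite (le_trans (phi_lin _ (symmetric_power _ _) (symmetric_sq_comb _))) //.
by rewrite -[leRHS]addr0 lerD // mulr_ge0_le0.
Qed.

Lemma sq_combE r x y : sq_comb r (pair2 x y) = \sum_(c <- r) c.1 * (ip c.2 x * ip c.2 y).
Proof. by elim: r => [|c r IH]; rewrite ?big_nil // big_cons /= /lin IH sqE. Qed.

(** Polarisation of the rank-one terms of the expansion of [f] in the basis,
    truncated at [N], as a combination of squares. *)
Definition trunc_comb f N : seq (R * H) :=
  flatten (map (fun i : 'I_N => flatten (map (fun j : 'I_N =>
    [:: (4^-1 * f (pair2 (e i) (e j)), e i + e j);
        (- (4^-1 * f (pair2 (e i) (e j))), e i - e j)]) (enum 'I_N))) (enum 'I_N)).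

Lemma trunc_combE f N x y : symmetric_tensor e f ->
  sq_comb (trunc_comb f N) (pair2 x y) =
  \sum_(i < N) \sum_(j < N) f (pair2 (e i) (e j)) * (ip (e i) x * ip (e j) y).
Proof.
move=> [_ fs]; rewrite sq_combE /trunc_comb big_flatten big_map big_enum /=.
transitivity (\sum_(i < N) \sum_(j < N) 2^-1 * f (pair2 (e i) (e j)) *
   (ip (e i) x * ip (e j) y + ip (e j) x * ip (e i) y)).
  apply: eq_bigr => i _; rewrite big_flatten big_map big_enum /=; apply: eq_bigr => j _.
  by rewrite !big_cons big_nil /= !ipBl !ipDl; field.
transitivity (\sum_(i < N) \sum_(j < N) 2^-1 * f (pair2 (e i) (e j)) * (ip (e i) x * ip (e j) y)
  + \sum_(i < N) \sum_(j < N) 2^-1 * f (pair2 (e i) (e j)) * (ip (e j) x * ip (e i) y)).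
  rewrite -big_split /=; apply: eq_bigr => i _; rewrite -big_split /=.
  by apply: eq_bigr => j _; rewrite mulrDr.
rewrite [X in _ + X]exchange_big -big_split /=; apply: eq_bigr => i _.
by rewrite -big_split /=; apply: eq_bigr => j _; rewrite (sym_pair _ _ fs); field.
Qed.

Lemma coef_norm f i j : bform f ->
  f (pair2 (e i) (e j)) * (`|e i| ^+ 2 * `|e j| ^+ 2) = f (pair2 (e i) (e j)).
Proof.
move=> hf; have f0l y : f (pair2 0 y) = 0.
  by have := bform_linl y hf (-1) 0 0; rewrite scaler0 addr0 mulN1r addNr => ->.
have f0r y : f (pair2 y 0) = 0.
  by have := bform_linr y hf (-1) 0 0; rewrite scaler0 addr0 mulN1r addNr => ->.
have [->|E] := basis_norm01 he i; last by rewrite E f0l mul0r.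
by have [->|E] := basis_norm01 he j; rewrite ?mulr1 // E f0r mul0r.
Qed.

Lemma trunc_coef f N a b : symmetric_tensor e f ->
  sq_comb (trunc_comb f N) (pair2 (e a) (e b)) =
  if (a < N)%N && (b < N)%N then f (pair2 (e a) (e b)) else 0.
Proof.
move=> sf; rewrite trunc_combE //; have hf := symmetric_bform sf.
under eq_bigr => i _ do under eq_bigr => j _ do rewrite !(basis_ip hip he).
case: ifP => [/andP[aN bN]|ab].
  rewrite (bigD1 (Ordinal aN)) //= [X in _ + X]big1 ?addr0 => [|i ia]; last first.
    rewrite big1 // => j _; rewrite (_ : (val i == a) = false) ?mul0r ?mulr0 //.
    by apply: contraNF ia => /eqP ia; apply/eqP/val_inj.
  rewrite (bigD1 (Ordinal bN)) //= [X in _ + X]big1 ?addr0 => [|i ia]; last first.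
    rewrite (_ : (val i == b) = false) ?mul0r ?mulr0 //.
    by apply: contraNF ia => /eqP ia; apply/eqP/val_inj.
  by rewrite !eqxx !mul1r coef_norm.
rewrite big1 // => i _; rewrite big1 // => j _.
have [ia|_] := eqVneq (val i) a; last by rewrite !mul0r mulr0.
have [jb|_] := eqVneq (val j) b; last by rewrite !mul0r !mulr0.
by move: ab; rewrite -ia -jb !ltn_ord.
Qed.

Lemma hsq_trunc f N : symmetric_tensor e f ->
  hsq e (lin (-1) (sq_comb (trunc_comb f N)) f) <= hsq e f - boxsq e f N.
Proof.
move=> sf; have fin := symmetric_fin sf.
suff /hsq_le_box[] : forall M, boxsq e (lin (-1) (sq_comb (trunc_comb f N)) f) M
   <= hsq e f - boxsq e f N by [].
move=> M; pose M' := maxn M N.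
apply: (le_trans (boxsq_mono e _ (leq_maxl M N))); rewrite -/M' lerBrDr.
apply: le_trans (boxsq_le M' fin); rewrite !boxsq2.
have NM : (N <= M')%N by rewrite leq_maxr.
pose c i j := f (pair2 (e i) (e j)) ^+ 2.
have -> : \sum_(i < N) \sum_(j < N) f (pair2 (e i) (e j)) ^+ 2 =
   \sum_(i < M') \sum_(j < M') if (i < N)%N && (j < N)%N then c i j else 0.
  rewrite (big_ord_widen M' (fun i => \sum_(j < N) c i j)) // big_mkcond /=.
  apply: eq_bigr => i _; case: ifP => iN; last by rewrite big1.
  by rewrite (big_ord_widen M' (fun j => c i j)) // big_mkcond.
rewrite -big_split /=; apply: ler_sum => i _; rewrite -big_split /=; apply: ler_sum => j _.
rewrite /lin trunc_coef // /c; case: ifP => _; last by rewrite mulr0 add0r addr0.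
by rewrite mulN1r addNr expr0n add0r.
Qed.

(** Truncated expansions are combinations of squares, and the norm of the
    remainder tends to 0. *)
Lemma density f : symmetric_tensor e f -> phi f <= 0.
Proof.
move=> sf; have fin := symmetric_fin sf.
have key N : phi f <= `|C| * Num.sqrt (hsq e f - boxsq e f N).
  set t := sq_comb (trunc_comb f N).
  have st : symmetric_tensor e t by exact: symmetric_sq_comb.
  have sl := symmetric_lin (-1) st sf.
  have {1}-> : f = lin 1 t (lin (-1) t f).
    by apply/funext => h; rewrite /lin; ring.
  rewrite (le_trans (phi_lin 1 st sl)) // normr1 mul1r.
  rewrite -[leRHS]add0r lerD ?phi_sq_comb // (le_trans (phi_le sl)) //.
  apply: (@le_trans _ _ (`|C| * hs e (lin (-1) t f))).
    by rewrite ler_wpM2r ?hs_ge0 // ler_norm.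
  by rewrite ler_wpM2l // ler_wsqrtr // hsq_trunc.
have c0 : (fun N => `|C| * Num.sqrt (hsq e f - boxsq e f N)) @ \oo --> 0.
  rewrite -(mulr0 `|C|) -sqrtr0 -(subrr (hsq e f)).
  apply: cvgM; first exact: cvg_cst.
  apply: continuous_cvg; first exact: sqrt_continuous.
  by apply: cvgB; [exact: cvg_cst|exact: boxsq_cvg].
rewrite -[leLHS]opprK oppr_le0.
apply: (@cvg_seq_le _ (fun N => - (`|C| * Num.sqrt (hsq e f - boxsq e f N)) ) 0 (- phi f)).
  by rewrite -oppr0; exact: cvgN.
by move=> N; rewrite lerN2 key.
Qed.

End Density.

(** By density it suffices to compare both traces on squares, where they are
    values of [f] on the diagonal. *)
Lemma tr2_transp f g : tensor e f -> tensor e (transp f) -> symmetric_tensor e g ->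
  tr2 ip e f g = tr2 ip e (transp f) g.
Proof.
move=> tf tt sg; apply/eqP; rewrite -subr_eq0 -normr_le0.
apply: (@density (fun g => `|tr2 ip e f g - tr2 ip e (transp f) g|)
  (hs e f + hs e (transp f))) => // [a k l [tk _] [tl _]|k [tk _]|u].
- by rewrite !(tr2_linr hip he) //; exact: norm_lin_sub.
- rewrite (le_trans (ler_normB _ _)) // mulrDl lerD // (tr2_le hip he) //.
- by rewrite !tr2_sq // /transp /= subrr normr0.
Qed.

End RankOne.

(** * Square-integrable random variables up to almost sure equality *)

Lemma quadratic_discriminant (R : realType) (A B C : R) : 0 <= A -> 0 <= B ->
  (forall t, 0 <= t ^+ 2 * A - 2 * t * C + B) -> C ^+ 2 <= A * B.
Proof.
move=> A0 B0 h; have [Az|An0] := eqVneq A 0.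
  rewrite Az mul0r; have [->|Cn0] := eqVneq C 0; first by rewrite expr0n.
  have := h ((B + 1) / (2 * C)); rewrite Az mulr0 add0r.
  have -> : - (2 * ((B + 1) / (2 * C)) * C) + B = - 1 by field.
  by rewrite oppr_ge0 ler10.
have Ap : 0 < A by rewrite lt_neqAle eq_sym An0.
have := h (C / A); have -> : (C / A) ^+ 2 * A - 2 * (C / A) * C + B = (A * B - C ^+ 2) / A by field.
by rewrite pmulr_lge0 ?invr_gt0 // subr_ge0.
Qed.

Section Probability.
Context {R : realType} {d : measure_display} {Omega : measurableType d}.
Variable P : probability Omega R.
Implicit Types (X Y Z : Omega -> R).

Definition aeq X Y : Prop := {ae P, forall w, X w = Y w}.

Lemma aeq_refl X : aeq X X. Proof. by apply: aeW. Qed.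

Lemma aeq_eq X Y : X = Y -> aeq X Y. Proof. by move=> ->; exact: aeq_refl. Qed.

Lemma aeq_sym X Y : aeq X Y -> aeq Y X.
Proof. by apply: filterS => w ->. Qed.

Lemma aeq_trans Y X Z : aeq X Y -> aeq Y Z -> aeq X Z.
Proof. by apply: filterS2 => w -> ->. Qed.

Lemma aeq_lin a X X' Y Y' : aeq X X' -> aeq Y Y' ->
  aeq (fun w => a * X w + Y w) (fun w => a * X' w + Y' w).
Proof. by apply: filterS2 => w -> ->. Qed.

Lemma aeq_add X X' Y Y' : aeq X X' -> aeq Y Y' ->
  aeq (fun w => X w + Y w) (fun w => X' w + Y' w).
Proof. by apply: filterS2 => w -> ->. Qed.

Lemma aeq_mul X X' Y Y' : aeq X X' -> aeq Y Y' ->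
  aeq (fun w => X w * Y w) (fun w => X' w * Y' w).
Proof. by apply: filterS2 => w -> ->. Qed.

Lemma aeq_scale a X X' : aeq X X' -> aeq (fun w => a * X w) (fun w => a * X' w).
Proof. by apply: filterS => w ->. Qed.

Lemma aeq_sum (I : Type) (r : seq I) (Q : pred I) (F G : I -> Omega -> R) :
  (forall i, Q i -> aeq (F i) (G i)) ->
  aeq (fun w => \sum_(i <- r | Q i) F i w) (fun w => \sum_(i <- r | Q i) G i w).
Proof.
move=> FG; elim: r => [|i r IH]; first by apply: aeq_eq; apply/funext => w; rewrite !big_nil.
case Qi: (Q i); last by move: IH; apply: filterS => w; rewrite !big_cons Qi.
by move: (FG i Qi) IH; apply: filterS2 => w; rewrite !big_cons Qi => -> ->.
Qed.

Lemma aeq_sum_seq (I : eqType) (r : seq I) (F G : I -> Omega -> R) :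
  (forall i, i \in r -> aeq (F i) (G i)) ->
  aeq (fun w => \sum_(i <- r) F i w) (fun w => \sum_(i <- r) G i w).
Proof.
move=> FG; have := @aeq_sum _ r (mem r) F G FG.
by apply: filterS => w; rewrite -!big_seq.
Qed.

Definition L1 X : Prop := P.-integrable setT (EFin \o X).

Definition L2 X : Prop :=
  measurable_fun setT X /\ (\int[P]_w (X w ^+ 2)%:E < +oo)%E.

Definition E1 X : R := fine ('E_P[X])%E.

Lemma E1E X : E1 X = \int[P]_w X w.
Proof. by rewrite /E1 unlock. Qed.

Lemma L1_measurable X : L1 X -> measurable_fun setT X.
Proof. by move=> /measurable_int /measurable_EFinP. Qed.

Lemma L1_lin a X Y : L1 X -> L1 Y -> L1 (fun w => a * X w + Y w).
Proof.
move=> hX hY; have := integrableD measurableT (integrableZl measurableT a hX) hY.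
by apply: eq_integrable => // w _ /=; rewrite EFinD EFinM.
Qed.

Lemma L1_cst c : L1 (fun=> c).
Proof. exact: finite_measure_integrable_cst. Qed.

Lemma L1_le X Y : measurable_fun setT X -> (forall w, `|X w| <= Y w) -> L1 Y -> L1 X.
Proof.
move=> mX XY; apply: le_integrable => //; first exact/measurable_EFinP.
by move=> w _ /=; rewrite lee_fin (le_trans (XY w)) // ler_norm.
Qed.

Lemma L1_aeq X Y : measurable_fun setT X -> aeq X Y -> L1 Y -> L1 X.
Proof.
move=> mX XY /integrableP[mY fY]; apply/integrableP; split; first exact/measurable_EFinP.
apply: le_lt_trans fY; rewrite le_eqVlt; apply/orP; left; apply/eqP.
apply: ae_eq_integral => //; [|exact: measurableT_comp|].
  by apply: measurableT_comp => //; exact/measurable_EFinP.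
by move: XY; apply: filterS => w /= ->.
Qed.

Lemma E1_lin a X Y : L1 X -> L1 Y -> E1 (fun w => a * X w + Y w) = a * E1 X + E1 Y.
Proof.
move=> hX hY; rewrite !E1E RintegralD // ?RintegralZl //.
have := integrableZl measurableT a hX.
by apply: eq_integrable => // w _ /=; rewrite EFinM.
Qed.

Lemma E1_cst c : E1 (fun=> c) = c.
Proof. by rewrite /E1 (expectation_cst P c). Qed.

Lemma L1_sum (I : Type) (r : seq I) (F : I -> Omega -> R) : (forall i, L1 (F i)) ->
  L1 (fun w => \sum_(i <- r) F i w).
Proof.
move=> hF; elim: r => [|i r IH].
  by under eq_fun do rewrite big_nil; exact: L1_cst.
have -> : (fun w => \sum_(j <- i :: r) F j w) = (fun w => 1 * F i w + \sum_(j <- r) F j w).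
  by apply/funext => w; rewrite big_cons mul1r.
exact: L1_lin.
Qed.

Lemma E1_sum (I : Type) (r : seq I) (F : I -> Omega -> R) : (forall i, L1 (F i)) ->
  E1 (fun w => \sum_(i <- r) F i w) = \sum_(i <- r) E1 (F i).
Proof.
move=> hF; elim: r => [|i r IH].
  by rewrite big_nil; under eq_fun do rewrite big_nil; exact: E1_cst.
have -> : (fun w => \sum_(j <- i :: r) F j w) = (fun w => 1 * F i w + \sum_(j <- r) F j w).
  by apply/funext => w; rewrite big_cons mul1r.
by rewrite E1_lin ?mul1r ?IH ?big_cons //; exact: L1_sum.
Qed.

Lemma L1_scale a X : L1 X -> L1 (fun w => a * X w).
Proof.
by move=> hX; have := L1_lin a hX (L1_cst 0); under eq_fun do rewrite addr0.
Qed.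

Lemma E1_scale a X : L1 X -> E1 (fun w => a * X w) = a * E1 X.
Proof.
move=> hX; have := E1_lin a hX (L1_cst 0); under eq_fun do rewrite addr0.
by rewrite E1_cst addr0.
Qed.

Lemma E1_le X Y : L1 X -> L1 Y -> (forall w, X w <= Y w) -> E1 X <= E1 Y.
Proof. by move=> hX hY XY; rewrite !E1E le_Rintegral. Qed.

Lemma E1_ge0 X : (forall w, 0 <= X w) -> 0 <= E1 X.
Proof. by move=> X0; rewrite E1E Rintegral_ge0. Qed.

Lemma L1_abs X : L1 X -> L1 (fun w => `|X w|).
Proof. by move=> /integrable_abse. Qed.

Lemma E1_norm X : L1 X -> `|E1 X| <= E1 (fun w => `|X w|).
Proof.
move=> hX; have hA := L1_abs hX; rewrite ler_norml; apply/andP; split; last first.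
  by apply: E1_le => // w; exact: ler_norm.
rewrite -mulN1r -E1_scale //; apply: E1_le => //; first exact: L1_scale.
by move=> w; rewrite mulN1r lerNl -normrN ler_norm.
Qed.

Lemma E1_aeq X Y : measurable_fun setT X -> measurable_fun setT Y -> aeq X Y -> E1 X = E1 Y.
Proof.
move=> mX mY XY; rewrite !E1E /Rintegral; congr fine.
apply: ae_eq_integral => //; [exact/measurable_EFinP|exact/measurable_EFinP|].
by move: XY; apply: filterS => w /= ->.
Qed.

Lemma E1_abs_eq0 X : L1 X -> E1 (fun w => `|X w|) <= 0 -> aeq X (fun=> 0).
Proof.
move=> hX h0; have mX := L1_measurable hX.
have : (\int[P]_w `|(X w)%:E|)%E = 0%E.
  have fin := integrable_fin_num measurableT (L1_abs hX).
  have E : E1 (fun w => `|X w|) = fine (\int[P]_w `|(X w)%:E|)%E by exact: E1E.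
  rewrite -(fineK fin); congr (_%:E); apply/eqP; rewrite eq_le.
  by rewrite -E h0 E1_ge0.
move=> e0; have mEX : measurable_fun setT (EFin \o X) by exact/measurable_EFinP.
have := (ae_eq_integral_abs P measurableT mEX).1 e0.
by apply: filterS => w /(_ I) /= [->].
Qed.

Lemma L2_L1sqr X : L2 X -> L1 (fun w => X w ^+ 2).
Proof.
move=> [mX fX]; apply/integrableP; split.
  by apply/measurable_EFinP; exact: measurable_funX.
apply: le_lt_trans fX; rewrite le_eqVlt; apply/orP; left; apply/eqP.
by apply: eq_integral => w _ /=; rewrite ger0_norm ?sqr_ge0.
Qed.

Lemma L1sqr_L2 X : measurable_fun setT X -> L1 (fun w => X w ^+ 2) -> L2 X.
Proof.
move=> mX /integrableP[_ h]; split=> //; apply: le_lt_trans h.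
rewrite le_eqVlt; apply/orP; left; apply/eqP.
by apply: eq_integral => w _ /=; rewrite ger0_norm ?sqr_ge0.
Qed.

Lemma L2_aeq X Y : measurable_fun setT X -> aeq X Y -> L2 Y -> L2 X.
Proof.
move=> mX XY hY; apply: L1sqr_L2 => //; apply: L1_aeq (L2_L1sqr hY).
  exact: measurable_funX.
by move: XY; apply: filterS => w ->.
Qed.

Lemma L2_mul X Y : L2 X -> L2 Y -> L1 (fun w => X w * Y w).
Proof.
move=> hX hY; apply: (@L1_le _ (fun w => 1 * X w ^+ 2 + Y w ^+ 2)).
- by apply: measurable_funM; [case: hX|case: hY].
- move=> w; rewrite normrM mul1r -(real_normK (num_real (X w))) -(real_normK (num_real (Y w))).
  by have := sqr_ge0 (`|X w| - `|Y w|); have := normr_ge0 (X w); have := normr_ge0 (Y w); nra.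
- by apply: L1_lin; exact: L2_L1sqr.
Qed.

Lemma L2_cst c : L2 (fun=> c).
Proof. by apply: L1sqr_L2; [exact: measurable_cst|exact: L1_cst]. Qed.

Lemma L2_L1 X : L2 X -> L1 X.
Proof. by move=> hX; have := L2_mul hX (L2_cst 1); under eq_fun do rewrite mulr1. Qed.

Lemma L2_lin a X Y : L2 X -> L2 Y -> L2 (fun w => a * X w + Y w).
Proof.
move=> hX hY; apply: L1sqr_L2.
  by apply: measurable_funD; [apply: measurable_funM; [exact: measurable_cst|case: hX]|case: hY].
have -> : (fun w => (a * X w + Y w) ^+ 2) =
    (fun w => a ^+ 2 * X w ^+ 2 + ((2 * a) * (X w * Y w) + Y w ^+ 2)).
  by apply/funext => w; ring.
by apply: L1_lin; [exact: L2_L1sqr|apply: L1_lin; [exact: L2_mul|exact: L2_L1sqr]].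
Qed.

Lemma L2_scale a X : L2 X -> L2 (fun w => a * X w).
Proof.
by move=> hX; have := L2_lin a hX (L2_cst 0); under eq_fun do rewrite addr0.
Qed.

Lemma L2_sum (I : Type) (r : seq I) (F : I -> Omega -> R) : (forall i, L2 (F i)) ->
  L2 (fun w => \sum_(i <- r) F i w).
Proof.
move=> hF; elim: r => [|i r IH].
  by under eq_fun do rewrite big_nil; exact: L2_cst.
have -> : (fun w => \sum_(j <- i :: r) F j w) = (fun w => 1 * F i w + \sum_(j <- r) F j w).
  by apply/funext => w; rewrite big_cons mul1r.
exact: L2_lin.
Qed.

Lemma E1_cauchy_schwarz X Y : L2 X -> L2 Y ->
  E1 (fun w => `|X w * Y w|) ^+ 2 <= E1 (fun w => X w ^+ 2) * E1 (fun w => Y w ^+ 2).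
Proof.
move=> hX hY; have s0 Z : 0 <= E1 (fun w => Z w ^+ 2) by apply: E1_ge0 => w; exact: sqr_ge0.
apply: quadratic_discriminant => // t.
have hXY := L1_abs (L2_mul hX hY); have hX2 := L2_L1sqr hX; have hY2 := L2_L1sqr hY.
have : 0 <= E1 (fun w => (t * `|X w| - `|Y w|) ^+ 2) by apply: E1_ge0 => w; exact: sqr_ge0.
have -> : (fun w => (t * `|X w| - `|Y w|) ^+ 2) =
    (fun w => t ^+ 2 * X w ^+ 2 + (- (2 * t) * `|X w * Y w| + Y w ^+ 2)).
  apply/funext => w; rewrite normrM -(real_normK (num_real (X w))).
  by rewrite -(real_normK (num_real (Y w))); ring.
rewrite E1_lin //; last by exact: L1_lin.
by rewrite E1_lin // mulNr addrA.
Qed.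

Lemma E1_le_L2 X : L2 X -> E1 (fun w => `|X w|) ^+ 2 <= E1 (fun w => X w ^+ 2).
Proof.
move=> hX; have := E1_cauchy_schwarz hX (L2_cst 1).
have -> : (fun w => `|X w * 1|) = (fun w => `|X w|) by apply/funext => w; rewrite mulr1.
by rewrite E1_cst expr1n mulr1.
Qed.

Lemma E1_sqr_eq0 X : L2 X -> E1 (fun w => X w ^+ 2) <= 0 -> aeq X (fun=> 0).
Proof.
move=> hX h0; apply: E1_abs_eq0; first exact: L2_L1.
have := le_trans (E1_le_L2 hX) h0; rewrite le_eqVlt ltNge sqr_ge0 orbF sqrf_eq0.
by move/eqP->.
Qed.

Lemma E1_sqr_fin X (c : R) : ('E_P[fun w => (X w ^+ 2)%R] = c%:E)%E -> measurable_fun setT X ->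
  L2 X /\ E1 (fun w => X w ^+ 2) = c.
Proof.
move=> h mX; split; last by rewrite /E1 h.
by split=> //; move: h; rewrite unlock => ->; exact: ltry.
Qed.

End Probability.

(** * Multiple integrals of pure tensors *)

(** The recursion moves degree from one argument to the other, up to
    correlations of smaller total degree, so that all correlations on an
    antidiagonal agree off the diagonal; the norms then force them to be 0. *)
Lemma hermite_correlation (R : realType) (c : nat -> nat -> R) :
  (forall m n, c m n = c n m) ->
  (forall m n, c m n.+1 = c m.+1 n + m%:R * c m.-1 n - n%:R * c m n.-1) ->
  (forall n, c n n = n`!%:R) ->
  forall N m n, (m + n = N.*2)%N -> c m n = (m == n)%:R * n`!%:R.
Proof.
move=> csym crec cnn; elim=> [|N IH] m n mn.
  have [-> ->] : m = 0%N /\ n = 0%N by lia.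
  by rewrite cnn eqxx mul1r.
have step k : (k <= N)%N -> c (N.+1.*2 - k)%N k = c N.+1.*2 0%N.
  elim: k => [|k IHk] kN; first by rewrite subn0.
  rewrite crec (_ : (N.+1.*2 - k.+1).+1 = N.+1.*2 - k)%N; last by lia.
  rewrite IHk; last by lia.
  rewrite (IH (N.+1.*2 - k.+1).-1 k); last by lia.
  rewrite (_ : ((N.+1.*2 - k.+1).-1 == k) = false) ?mul0r ?mulr0 ?addr0; last by lia.
  case: k kN {IHk} => [|k] kN; first by rewrite mul0r subr0.
  rewrite (IH (N.+1.*2 - k.+2)%N k); last by lia.
  by rewrite (_ : (N.+1.*2 - k.+2 == k)%N = false) ?mul0r ?mulr0 ?subr0 //; lia.
have c0 : c N.+1.*2 0%N = 0.
  have := crec N.+1 N; rewrite cnn /= (IH N N) ?addnn // eqxx mul1r factS natrM.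
  have -> : N%:R * c N.+1 N.-1 = 0.
    case: N IH {step mn} => [|k] IH; first by rewrite mul0r.
    rewrite (IH k.+2 k); last by lia.
    by rewrite (_ : (k.+2 == k) = false) ?mul0r ?mulr0 //; lia.
  have -> : c N.+2 N = c N.+1.*2 0%N by rewrite -(step N) //; congr (c _ _); lia.
  by rewrite subr0 -[LHS]add0r => /addIr ->.
have [->|nm] := eqVneq m n; first by rewrite cnn mul1r.
rewrite mul0r; have [nN|nN] := leqP n N.
  by rewrite (_ : m = N.+1.*2 - n)%N ?step //; lia.
have mN : (m <= N)%N by move/eqP: nm; lia.
by rewrite csym (_ : n = N.+1.*2 - m)%N ?step //; lia.
Qed.

Lemma cvg_expr (R : realType) (u : nat -> R) (l : R) n :
  u @ \oo --> l -> (fun k => u k ^+ n) @ \oo --> l ^+ n.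
Proof.
move=> ul; elim: n => [|n IH].
  by rewrite expr0; under eq_fun do rewrite expr0; exact: cvg_cst.
by rewrite exprS; under eq_fun do rewrite exprS; exact: cvgM.
Qed.

Section Integral.
Context (R : realType) (H : completeNormedModType R) (ip : {dot H for idfun}).
Hypothesis hip : forall x, ip x x = `|x| ^+ 2.
Variable e : nat -> H.
Hypothesis he : orthonormal_basis ip e.
Context (d : measure_display) (Omega : measurableType d) (P : probability Omega R).
Variable W : H -> {RV P >-> R}.
Hypothesis hW : isonormal ip W.
Variable I : forall n, form H n -> {RV P >-> R}.
Hypothesis hI : forall n, (0 < n)%N -> multiple_integral ip e W (@I n).

Local Notation "X =a Y" := (aeq P X Y) (at level 70).

Lemma hsq_power u n : hsq e (@tensor_power R H ip u n) = (`|u| ^+ 2) ^+ n.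
Proof.
have c1 := boxsq_cvg (symmetric_fin (symmetric_power hip he u n)).
have c2 : boxsq e (@tensor_power R H ip u n) @ \oo --> (`|u| ^+ 2) ^+ n.
  have -> : boxsq e (@tensor_power R H ip u n) =
      (fun N => (\sum_(0 <= k < N) ip u (e k) * ip (e k) u) ^+ n).
    apply/funext => N; rewrite /boxsq /tensor_power; under eq_bigr do rewrite -prodrXl.
    rewrite -(bigA_distr_bigA (fun (i : 'I_n) (j : 'I_N) => ip u (e j) ^+ 2)) /=.
    rewrite prodr_const card_ord big_mkord; congr (_ ^+ _); apply: eq_bigr => j _.
    by rewrite (ipC ip (e j)) expr2.
  by rewrite -hip; apply: cvg_expr; exact: (parseval hip he).
by rewrite -(cvg_lim (@Rhausdorff R) c1) (cvg_lim (@Rhausdorff R) c2).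
Qed.

Lemma mRV (X : {RV P >-> R}) : measurable_fun setT X.
Proof. exact: measurable_funPT. Qed.

Lemma measurable_horner (p : {poly R}) (X : Omega -> R) :
  measurable_fun setT X -> measurable_fun setT (fun w => p.[X w]).
Proof.
move=> mX; elim/poly_ind: p => [|p c IH].
  by under eq_fun do rewrite horner0; exact: measurable_cst.
under eq_fun do rewrite hornerMXaddC.
by apply: measurable_funD; [exact: measurable_funM|exact: measurable_cst].
Qed.

Lemma W_cov g h : L1 P (fun w => W g w * W h w) /\ E1 P (fun w => W g w * W h w) = ip g h.
Proof.
have L2W u : L2 P (W u).
  have E : ('E_P[fun w => (W u w ^+ 2)%R] = (ip u u)%:E)%E.
    by case: hW => _ <-; congr ('E_P[_])%E; apply/funext => w; rewrite expr2.
  by case: (E1_sqr_fin E (mRV (W u))).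
by split; [exact: L2_mul|rewrite /E1; case: hW => _ ->].
Qed.

Lemma L2_W u : L2 P (W u).
Proof. by apply: L1sqr_L2; [exact: mRV|have := (W_cov u u).1; under eq_fun do rewrite -expr2]. Qed.

(** The second moment of the difference vanishes, as the covariances are
    inner products. *)
Lemma W_lin a u v : W (a *: u + v) =a (fun w => a * W u w + W v w).
Proof.
set z := a *: u + v.
have hX : L2 P (fun w => - 1 * (a * W u w + W v w) + W z w).
  by apply: L2_lin; [apply: L2_lin|]; exact: L2_W.
have h0 : E1 P (fun w => (- 1 * (a * W u w + W v w) + W z w) ^+ 2) = 0.
  have -> : (fun w => (- 1 * (a * W u w + W v w) + W z w) ^+ 2) =
     (fun w => a ^+ 2 * (W u w * W u w) + ((2 * a) * (W u w * W v w) +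
       ((- (2 * a)) * (W u w * W z w) + (1 * (W v w * W v w) + ((-2) * (W v w * W z w) + W z w * W z w))))).
    by apply/funext => w; ring.
  have L g h := (W_cov g h).1.
  rewrite E1_lin //; last by do 4 (apply: L1_lin => //).
  rewrite E1_lin //; last by do 3 (apply: L1_lin => //).
  rewrite E1_lin //; last by do 2 (apply: L1_lin => //).
  rewrite E1_lin //; last by do 1 (apply: L1_lin => //).
  rewrite E1_lin // !(W_cov _ _).2 /z !(ipDl, ipDr, ipZl, ipZr) (ipC ip v u); ring.
have := E1_sqr_eq0 hX; rewrite h0 => /(_ (lexx _)).
by apply: filterS => w h; lra.
Qed.

Lemma W_zero : W 0 =a (fun=> 0).
Proof. by have := W_lin (-1) 0 0; rewrite scaler0 addr0; apply: filterS => w h; lra. Qed.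

Lemma W_scale a u : W (a *: u) =a (fun w => a * W u w).
Proof.
by have := W_lin a u 0; rewrite addr0; move: W_zero; apply: filterS2 => w -> ->; rewrite addr0.
Qed.

Lemma W_sum (J : Type) (r : seq J) (Q : pred J) (v : J -> H) :
  W (\sum_(j <- r | Q j) v j) =a (fun w => \sum_(j <- r | Q j) W (v j) w).
Proof.
elim: r => [|j r IH].
  by rewrite big_nil; move: W_zero; apply: filterS => w ->; rewrite big_nil.
rewrite big_cons; case Qj: (Q j); last first.
  by move: IH; apply: filterS => w ->; rewrite big_cons Qj.
have := W_lin 1 (v j) (\sum_(j <- r | Q j) v j); rewrite scale1r; move: IH.
by apply: filterS2 => w -> ->; rewrite big_cons Qj mul1r.
Qed.

Section Order.
Variable n : nat.
Hypothesis n0 : (0 < n)%N.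

Lemma I_L2 f : symmetric_tensor e f ->
  L2 P (I f) /\ E1 P (fun w => @I n f w ^+ 2) = n`!%:R * hsq e f.
Proof.
move=> sf; case: (hI n0) => _ /(_ f sf) h _ _ _; apply: E1_sqr_fin (mRV _).
by rewrite h (hsqE (symmetric_fin sf)) -EFinM.
Qed.

Lemma I_lin a f g : symmetric_tensor e f -> symmetric_tensor e g ->
  @I n (lin a f g) =a (fun w => a * I f w + I g w).
Proof. by move=> sf sg; case: (hI n0) => /(_ a f g sf sg). Qed.

Lemma I_null f : symmetric_tensor e f -> hsq e f <= 0 -> @I n f =a (fun=> 0).
Proof.
move=> sf f0; have [h1 h2] := I_L2 sf; apply: E1_sqr_eq0 => //.
by rewrite h2 mulr_ge0_le0.
Qed.

Lemma symmetric_zeron : symmetric_tensor e (fun _ : 'I_n -> H => 0 : R).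
Proof.
have -> : (fun _ : 'I_n -> H => 0 : R) = lin (-1) (@tensor_power _ _ ip 0 n) (@tensor_power _ _ ip 0 n).
  by apply/funext => h; rewrite /lin mulN1r addNr.
by apply: symmetric_lin; exact: (symmetric_power hip he).
Qed.

Lemma I_zero : @I n (fun=> 0) =a (fun=> 0).
Proof.
apply: I_null; first exact: symmetric_zeron.
suff /hsq_le_box[] : forall N, boxsq e (fun _ : 'I_n -> H => 0 : R) N <= 0 by [].
by move=> N; rewrite /boxsq big1 // => k _; rewrite expr0n.
Qed.

Lemma symmetric_comb (J : Type) (r : seq J) (c : J -> R) (f : J -> form H n) :
  (forall j, symmetric_tensor e (f j)) ->
  symmetric_tensor e (fun h => \sum_(j <- r) c j * f j h).
Proof.
move=> sf; elim: r => [|j r IH].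
  by under eq_fun do rewrite big_nil; exact: symmetric_zeron.
under eq_fun do rewrite big_cons; exact: (symmetric_lin (c j) (sf j) IH).
Qed.

Lemma I_comb (J : Type) (r : seq J) (c : J -> R) (f : J -> form H n) :
  (forall j, symmetric_tensor e (f j)) ->
  I (fun h => \sum_(j <- r) c j * f j h) =a (fun w => \sum_(j <- r) c j * I (f j) w).
Proof.
move=> sf; elim: r => [|j r IH].
  under eq_fun do rewrite big_nil.
  by move: I_zero; apply: filterS => w ->; rewrite big_nil.
have := I_lin (c j) (sf j) (symmetric_comb r c sf).
rewrite (_ : lin _ _ _ = (fun h => \sum_(j <- j :: r) c j * f j h)); last first.
  by apply/funext => h; rewrite big_cons.
by move: IH; apply: filterS2 => w -> ->; rewrite big_cons.
Qed.

Lemma I_scale a f : symmetric_tensor e f ->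
  @I n (fun h => a * f h) =a (fun w => a * I f w).
Proof.
move=> sf; have := @I_comb unit [:: tt] (fun=> a) (fun=> f) (fun=> sf).
rewrite (_ : (fun h => \sum_(j <- [:: tt]) a * f h) = (fun h => a * f h)); last first.
  by apply/funext => h; rewrite big_seq1.
by apply: filterS => w ->; rewrite big_seq1.
Qed.

(** After normalisation of [u] both sides are Hermite polynomials in [W u]. *)
Lemma I_power u : @I n (tensor_power ip u (n := n)) =a
  (fun w => gw (fun=> W u w) (fun _ _ => `|u| ^+ 2) (finset.setTfor 'I_n)).
Proof.
have [->|u0] := eqVneq u 0.
  have -> : tensor_power ip 0 (n := n) = fun=> 0.
    apply/funext => h; rewrite /tensor_power (bigD1 (Ordinal n0)) //=.
    by rewrite (ip0l ip) mul0r.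
  move: W_zero I_zero; apply: filterS2 => w -> ->.
  rewrite normr0 -[X in gw (fun=> X) _ _](mul0r 0) gw_diag cardsT card_ord.
  by rewrite expr0n -(prednK n0) mul0r.
pose u1 := `|u|^-1 *: u.
have nu0 : `|u| != 0 by rewrite normr_eq0.
have uE : u = `|u| *: u1 by rewrite scalerA divff // scale1r.
have n1 : `|u1| = 1 by rewrite normrZ normfV normr_id mulVf.
have -> : tensor_power ip u (n := n) = fun h => `|u| ^+ n * tensor_power ip u1 h.
  apply/funext => h; rewrite /tensor_power {1}uE.
  under eq_bigr do rewrite (ipZl ip).
  by rewrite big_split /= prodr_const card_ord.
have h1 : @I n (tensor_power ip u1 (n := n)) =a (fun w => (hermite n).[W u1 w]).
  by case: (hI n0) => _ _ _ _ /(_ u1 n1).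
have h2 := I_scale (`|u| ^+ n) (symmetric_power hip he u1 n).
have := W_scale `|u| u1; rewrite -uE; move: h1 h2; apply: filterS3 => w h1 h2 h3.
by rewrite h2 h1 h3 gw_diag cardsT card_ord.
Qed.

(** Polarisation of a symmetrised product in terms of powers. *)
Lemma Sym_pure_polarization (v : 'I_n -> H) h :
  Sym (pure ip v) h = \sum_(S : {set 'I_n}) ((-1) ^+ #|finset.setC S| / n`!%:R) *
    tensor_power ip (\sum_(j in S) v j) h.
Proof.
have f0 : (n`!%:R : R) != 0 by rewrite pnatr_eq0 -lt0n fact_gt0.
pose T (v : 'I_n -> H) := Sym (pure ip v) h.
have Tl : mlin T.
  move=> u i a x y; rewrite /T /Sym mulrCA -mulrDr; congr (_ * _).
  rewrite mulr_sumr -big_split /=; apply: eq_bigr => s _; rewrite /pure.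
  have E z : \prod_(j < n) ip ([eta u with i |-> z] j) (h (s j)) =
      ip z (h (s i)) * \prod_(j < n | j != i) ip (u j) (h (s j)).
    by rewrite (bigD1 i) //= eqxx; congr (_ * _); apply: eq_bigr => j /negPf ->.
  by rewrite !E (ipDl ip) (ipZl ip) mulrDl mulrA.
have Ts (s : 'S_n) u : T (u \o s) = T u.
  rewrite /T /Sym; congr (_ * _); rewrite [RHS](reindex_inj (mulgI s^-1%g)) /=.
  apply: eq_bigr => t _; rewrite /pure [LHS](reindex_inj (@perm_inj _ s^-1%g)) /=.
  by apply: eq_bigr => i _; rewrite permKV permM.
have := polarization v Tl Ts.
move=> E; apply: (mulfI f0); rewrite [LHS]E mulr_sumr; apply: eq_bigr => S _.
rewrite [RHS]mulrA [X in _ = X * _]mulrCA divff // mulr1; congr (_ * _).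
rewrite /T Sym_id //; exact: (symmetric_power hip he _ n).2.
Qed.

(** Powers are mapped to Hermite polynomials, that is to Wick powers; both
    sides are polarisations of this case. *)
Lemma I_pure (v : 'I_n -> H) : @I n (Sym (pure ip v)) =a
  (fun w => gw (fun i => W (v i) w) (fun i j => ip (v i) (v j)) (finset.setTfor 'I_n)).
Proof.
have f0 : (n`!%:R : R) != 0 by rewrite pnatr_eq0 -lt0n fact_gt0.
pose c (S : {set 'I_n}) : R := (-1) ^+ #|finset.setC S| / n`!%:R.
have -> : Sym (pure ip v) = fun h => \sum_(S : {set 'I_n}) c S *
    tensor_power ip (\sum_(j in S) v j) h.
  by apply/funext => h; rewrite Sym_pure_polarization.
apply: aeq_trans.
  by apply: I_comb => S; exact: (symmetric_power hip he).
apply: (@aeq_trans _ _ _ _ (fun w => \sum_(S : {set 'I_n}) c S *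
  gw (fun=> \sum_(j in S) W (v j) w)
     (fun _ _ => `|\sum_(j in S) v j| ^+ 2) (finset.setTfor 'I_n))).
  apply: aeq_sum => S _; apply: aeq_scale; apply: aeq_trans; first exact: I_power.
  by move: (W_sum (index_enum _) (mem S) v); apply: filterS => w /= ->.
apply: aeq_eq; apply/funext => w.
pose z (i : 'I_n) : (H * R^o)%type := (v i, W (v i) w).
have z1 (S : {set 'I_n}) : (\sum_(j in S) z j).1 = \sum_(j in S) v j.
  exact: (big_morph (fun p : (H * R^o)%type => p.1) (fun _ _ => erefl) erefl).
have z2 (S : {set 'I_n}) : (\sum_(j in S) z j).2 = \sum_(j in S) W (v j) w.
  exact: (big_morph (fun p : (H * R^o)%type => p.2) (fun _ _ => erefl) erefl).
pose b (p q : (H * R^o)%type) := ip p.1 q.1.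
have bl p : scalar (b p) by move=> a q r; rewrite /b /= (ipDr ip) (ipZr ip).
have bs p q : b p q = b q p by exact: ipC.
have xl : scalar (fun p : (H * R^o)%type => p.2 : R) by [].
have E := @gw_polarization R (H * R^o)%type _ b xl bl bs n z.
apply: (mulfI f0); rewrite [RHS]E mulr_sumr; apply: eq_bigr => S _.
by rewrite mulrA mulrCA divff // mulr1 /b /= z1 z2 hip.
Qed.

End Order.

(** Their correlations obey the recursion because the polynomials do, their
    norms are those of multiple integrals, and the mean is the correlation
    with the constant polynomial 1. *)
Lemma hermite_unit u : `|u| = 1 ->
  (forall n, L2 P (fun w => (hermite n).[W u w])) /\
  forall k, (0 < k)%N -> E1 P (fun w => (hermite k.*2).[W u w]) = 0.
Proof.
move=> u1; pose h n w := (@hermite R n).[W u w].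
have hh n : L2 P (h n) /\ E1 P (fun w => h n w * h n w) = n`!%:R.
  case: n => [|n].
    have -> : h 0%N = fun=> 1 by apply/funext => w; rewrite /h /= -polyC1 hornerC.
    by split; [exact: L2_cst|rewrite mulr1 E1_cst].
  have n0 : (0 < n.+1)%N by [].
  have hE : @I n.+1 (tensor_power ip u (n := n.+1)) =a h n.+1.
    by case: (hI n0) => _ _ _ _ /(_ u u1).
  have sp := symmetric_power hip he u n.+1.
  have [LI EI] := I_L2 n0 sp.
  have mh : measurable_fun setT (h n.+1).
    exact/measurable_horner/mRV.
  have Lh : L2 P (h n.+1) by apply: L2_aeq LI => //; exact: aeq_sym.
  split=> //.
  have -> : E1 P (fun w => h n.+1 w * h n.+1 w) = E1 P (fun w => @I n.+1 (tensor_power ip u (n := n.+1)) w ^+ 2).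
    apply: E1_aeq; [exact: measurable_funM|exact/measurable_funX/mRV|].
    by move: hE; apply: filterS => w ->; rewrite expr2.
  by rewrite EI hsq_power u1 !expr1n mulr1.
split=> [n|k k0]; first by case: (hh n).
pose c m n := E1 P (fun w => h m w * h n w).
have L m n : L1 P (fun w => h m w * h n w) by apply: L2_mul; [case: (hh m)|case: (hh n)].
have := @hermite_correlation R c _ _ _ k k.*2 0%N; rewrite addn0 => hc.
have {hc} : c k.*2 0%N = (k.*2 == 0%N)%:R * 0`!%:R.
  apply: hc => //.
  - by move=> m n; rewrite /c; congr E1; apply/funext => w; rewrite mulrC.
  - move=> m n; rewrite /c.
    have -> : (fun w => h m w * h n.+1 w) = (fun w => 1 * (h m.+1 w * h n w) +
        (m%:R * (h m.-1 w * h n w) + (- n%:R) * (h m w * h n.-1 w))).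
      apply/funext => w; rewrite /h horner_hermite.
      have := horner_hermite m (W u w); set x := (hermite m.+1).[_] => xE.
      have -> : x = W u w * (hermite m).[W u w] - m%:R * (hermite m.-1).[W u w] by [].
      by ring.
    rewrite E1_lin //; last by apply: L1_lin => //; exact: L1_scale.
    by rewrite E1_lin ?E1_scale //; [rewrite mul1r addrA mulNr|exact: L1_scale].
  - by move=> n; case: (hh n).
rewrite double_eq0 (gtn_eqF k0) mul0r => <-; rewrite /c; congr E1; apply/funext => w.
by rewrite /h /= -polyC1 hornerC mulr1.
Qed.

(** A multiple integral of even order is an L2-limit of combinations of
    Hermite polynomials of that order, which are centred. *)
Lemma E_I k (f : form H k.*2) : (0 < k)%N -> symmetric_tensor e f ->
  E1 P (I f) = 0.
Proof.
move=> k0 sf; have k20 : (0 < k.*2)%N by rewrite double_gt0.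
have [LI _] := I_L2 k20 sf; apply/eqP; rewrite -normr_le0.
apply/ler_addgt0Pr => eps eps0; rewrite add0r.
case: (hI k20) => _ _ /(_ f sf) hc _ _.
have [q [c [v [v1 lt]]]] := hc (eps ^+ 2) (exprn_gt0 2 eps0).
pose Z w := \sum_(i < q) c i * (hermite k.*2).[W (v i) w].
have LZ : L2 P Z.
  by apply: L2_sum => i; apply: L2_scale; case: (hermite_unit (v1 i)).
have LD : L2 P (fun w => (-1) * Z w + I f w) by exact: L2_lin.
have EZ : E1 P Z = 0.
  rewrite /Z E1_sum => [|i]; last by apply/L1_scale/L2_L1; case: (hermite_unit (v1 i)).
  rewrite big1 // => i _; have [h1 h2] := hermite_unit (v1 i).
  by rewrite E1_scale ?h2 ?mulr0 //; exact: L2_L1.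
have -> : E1 P (I f) = E1 P (fun w => (-1) * Z w + I f w).
  by rewrite E1_lin ?EZ ?mulr0 ?add0r //; exact: L2_L1.
rewrite (le_trans (E1_norm (L2_L1 LD))) // -(@ler_pXn2r _ 2) ?nnegrE ?(ltW eps0) //; last first.
  exact: E1_ge0.
rewrite (le_trans (E1_le_L2 LD)) //.
have fin := integrable_fin_num measurableT (L2_L1sqr LD).
rewrite -lee_fin /E1 [X in X%:E](_ : _ = fine (\int[P]_w ((((-1) * Z w + I f w) ^+ 2)%R)%:E)%E);
  last by rewrite unlock.
rewrite (fineK fin); apply: le_trans (ltW lt); rewrite unlock le_eqVlt.
apply/orP; left; apply/eqP; apply: eq_integral => w _ /=.
by rewrite mulN1r addrC.
Qed.

End Integral.

(** * Multiple integrals of symmetric products of 2-tensors *)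

Section Products.
Context (R : realType) (H : completeNormedModType R) (ip : {dot H for idfun}).
Hypothesis hip : forall x, ip x x = `|x| ^+ 2.
Variable e : nat -> H.
Hypothesis he : orthonormal_basis ip e.
Context (d : measure_display) (Omega : measurableType d) (P : probability Omega R).
Variable W : H -> {RV P >-> R}.
Hypothesis hW : isonormal ip W.
Variable I : forall n, form H n -> {RV P >-> R}.
Hypothesis hI : forall n, (0 < n)%N -> multiple_integral ip e W (@I n).
Implicit Types (f g p : form H 2) (l : seq (form H 2)) (X : Omega -> R).

Local Notation "X =a Y" := (aeq P X Y) (at level 70).
Local Notation sq u := (@tensor_power R H ip u 2).
Local Notation sym2 := (@symmetric_tensor R H e 2).
Local Notation syms := (sym_tensors e).

(** The integral of the symmetric product of a list of 2-tensors; the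
    properties of the integrals concern positive orders only, so the empty
    list is given the value 1 separately. *)
Definition calI l : Omega -> R :=
  if l is [::] then fun=> 1 else @I (size l * 2) (sbp (size l) l).

Lemma calI_cat l1 f l2 :
  calI (l1 ++ f :: l2) = @I ((size l1 + size l2).+1 * 2) (sbp (size l1 + size l2).+1 (l1 ++ f :: l2)).
Proof.
rewrite -addnS -[(size l2).+1]/(size (f :: l2)) -size_cat /calI.
by case: l1.
Qed.

Lemma sbp_sym k l : size l = k -> syms l ->
  symmetric_tensor e (sbp k l) /\ hsq e (sbp k l) <= \prod_(f <- l) hsq e f.
Proof. by move=> <-; exact: sbp_hsq. Qed.

Lemma calI_L2 l : syms l -> L2 P (calI l) /\
  E1 P (fun w => calI l w ^+ 2) <= (size l * 2)`!%:R * \prod_(f <- l) hsq e f.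
Proof.
case: l => [_|f l sl].
  split; first exact: L2_cst.
  have -> : (fun w => calI [::] w ^+ 2) = fun=> 1 by apply/funext => w; rewrite expr1n.
  by rewrite E1_cst big_nil mulr1.
have [s1 s2] := sbp_sym erefl sl; have n0 : (0 < size (f :: l) * 2)%N by [].
have [L E] := I_L2 hI n0 s1; split=> //.
by rewrite E ler_wpM2l.
Qed.

Lemma calI_lin l1 l2 a f g : syms l1 -> syms l2 -> sym2 f -> sym2 g ->
  calI (l1 ++ lin a f g :: l2) =a (fun w => a * calI (l1 ++ f :: l2) w + calI (l1 ++ g :: l2) w).
Proof.
move=> s1 s2 sf sg; rewrite !calI_cat sbp_lin; last by rewrite ltnS leq_addr.
have sz h : size (l1 ++ h :: l2) = (size l1 + size l2).+1 by rewrite size_cat addnS.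
by apply: (I_lin hI) => //; apply: (sbp_sym _ _).1 => //; apply/sym_tensors_cat.
Qed.

(** Symmetric products of 2-tensors have even order. *)
Lemma E_calI l : syms l -> l <> [::] -> E1 P (calI l) = 0.
Proof.
case: l => [|f l] // sl _; have [s1 _] := sbp_sym erefl sl; rewrite /calI.
move: s1; move: (sbp _ _); set k := size (f :: l); have k0 : (0 < k)%N by [].
by rewrite muln2 => F sF; exact: (E_I hip he hI k0 sF).
Qed.

Lemma calI1 f : sym2 f -> calI [:: f] = @I 2 f.
Proof.
move=> [_ sf]; rewrite /calI /=; congr (@I 2 _); apply/funext => h.
have E h' : tensor_prod f (fun _ : 'I_0 -> H => 1) h' = f h'.
  rewrite /tensor_prod mulr1; congr f; apply/funext => i /=; congr h'.
  exact: val_inj.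
rewrite /sym_prod Sym_id ?E // => s h'; rewrite !E; exact: sf.
Qed.

(** ** Random linear functionals of one slot *)

(** A random functional of a symmetric 2-tensor that is almost surely
    linear, and bounded from the Hilbert-Schmidt norm to L2; [L1bounded] is
    its L1 analogue, needed for products of two random variables. *)
Definition L2bounded (D : form H 2 -> Omega -> R) : Prop :=
  [/\ forall f, sym2 f -> L2 P (D f),
      forall a f g, sym2 f -> sym2 g -> D (lin a f g) =a (fun w => a * D f w + D g w)
    & exists2 C, 0 <= C & forall f, sym2 f -> E1 P (fun w => D f w ^+ 2) <= C * hsq e f].

Definition L1bounded (D : form H 2 -> Omega -> R) : Prop :=
  [/\ forall f, sym2 f -> L1 P (D f),
      forall a f g, sym2 f -> sym2 g -> D (lin a f g) =a (fun w => a * D f w + D g w)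
    & exists C, forall f, sym2 f -> E1 P (fun w => `|D f w|) <= C * hs e f].

Definition bounded_map (phi : form H 2 -> form H 2) : Prop :=
  [/\ forall f, sym2 f -> sym2 (phi f),
      forall a f g, sym2 f -> sym2 g -> phi (lin a f g) = lin a (phi f) (phi g)
    & exists2 C, 0 <= C & forall f, sym2 f -> hsq e (phi f) <= C * hsq e f].

Lemma bounded_map_id : bounded_map id.
Proof. by split=> //; exists 1 => // f _; rewrite mul1r. Qed.

Lemma L2bounded_calI phi l1 l2 : syms l1 -> syms l2 -> bounded_map phi ->
  L2bounded (fun p => calI (l1 ++ phi p :: l2)).
Proof.
move=> s1 s2 [ps pl [C C0 pC]].
have sl f : sym2 f -> syms (l1 ++ phi f :: l2).
  by move=> sf; apply/sym_tensors_cat; split=> //; split=> //; exact: ps.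
split=> [f sf|a f g sf sg|].
- by case: (calI_L2 (sl f sf)).
- by rewrite pl //; apply: calI_lin => //; exact: ps.
- pose K l := \prod_(f <- l) hsq e f.
  have K0 l : 0 <= K l by apply: prodr_ge0 => f _; exact: hsq_ge0.
  exists (((size l1 + size l2).+1 * 2)`!%:R * (K l1 * (C * K l2))).
    by do ! apply: mulr_ge0.
  move=> f sf; apply: le_trans (calI_L2 (sl f sf)).2 _.
  rewrite size_cat /= addnS -mulrA ler_wpM2l // big_cat big_cons -/(K _) -/(K _) -!mulrA.
  by rewrite ler_wpM2l // [K l2 * _]mulrC mulrA ler_wpM2r // pC.
Qed.

Lemma L2bounded_scalar (c : form H 2 -> R) X :
  (forall a f g, sym2 f -> sym2 g -> c (lin a f g) = a * c f + c g) ->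
  (exists2 C, 0 <= C & forall f, sym2 f -> `|c f| <= C * hs e f) -> L2 P X ->
  L2bounded (fun p w => c p * X w).
Proof.
move=> cl [C C0 cC] hX; split=> [f _|a f g sf sg|]; first exact: L2_scale.
  by apply: aeq_eq; apply/funext => w; rewrite cl //; ring.
exists (C ^+ 2 * E1 P (fun w => X w ^+ 2)).
  by rewrite mulr_ge0 ?sqr_ge0 // E1_ge0 // => w; exact: sqr_ge0.
move=> f sf; have -> : (fun w => (c f * X w) ^+ 2) = (fun w => c f ^+ 2 * X w ^+ 2).
  by apply/funext => w; rewrite exprMn.
rewrite E1_scale; last exact: L2_L1sqr.
rewrite [leRHS]mulrAC ler_wpM2r //; first by apply: E1_ge0 => w; exact: sqr_ge0.
rewrite -(real_normK (num_real (c f))) -(sqr_sqrtr (hsq_ge0 e f)) -exprMn.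
by rewrite ler_pXn2r ?nnegrE ?mulr_ge0 ?sqrtr_ge0 // cC.
Qed.

Lemma L2bounded_mul D X : L2bounded D -> L2 P X -> L1bounded (fun p w => X w * D p w).
Proof.
move=> [D2 Dl [C C0 DC]] hX; split=> [f sf|a f g sf sg|].
- by apply: L2_mul => //; exact: D2.
- by apply: filterS (Dl a f g sf sg) => w ->; ring.
- exists (Num.sqrt (E1 P (fun w => X w ^+ 2) * C)) => f sf.
  have X0 : 0 <= E1 P (fun w => X w ^+ 2) by apply: E1_ge0 => w; exact: sqr_ge0.
  rewrite /hs -sqrtrM ?mulr_ge0 // -(@ler_pXn2r _ 2) ?nnegrE ?sqrtr_ge0 //; last exact: E1_ge0.
  rewrite sqr_sqrtr ?mulr_ge0 ?hsq_ge0 //.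
  apply: le_trans (E1_cauchy_schwarz hX (D2 f sf)) _.
  by rewrite -mulrA ler_wpM2l // DC.
Qed.

Lemma L2bounded_L1bounded D : L2bounded D -> L1bounded D.
Proof.
move=> hD; have := L2bounded_mul hD (L2_cst P 1).
rewrite (_ : (fun p w => 1 * D p w) = D) //.
by apply/funext => p; apply/funext => w; rewrite mul1r.
Qed.

Lemma L1bounded_lin a D D' : L1bounded D -> L1bounded D' -> L1bounded (fun p w => a * D p w + D' p w).
Proof.
move=> [D1 Dl [C DC]] [D1' Dl' [C' DC']]; split=> [f sf|b f g sf sg|].
- by apply: L1_lin; [exact: D1|exact: D1'].
- by apply: filterS2 (Dl b f g sf sg) (Dl' b f g sf sg) => w -> ->; ring.
- exists (`|a| * C + C') => f sf.
  have LA := L1_abs (D1 f sf); have LA' := L1_abs (D1' f sf).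
  apply: (@le_trans _ _ (`|a| * E1 P (fun w => `|D f w|) + E1 P (fun w => `|D' f w|))).
    rewrite -E1_lin //; apply: E1_le.
    + by apply: L1_abs; apply: L1_lin; [exact: D1|exact: D1'].
    + exact: L1_lin.
    + by move=> w; rewrite (le_trans (ler_normD _ _)) // normrM.
  by rewrite mulrDl lerD ?DC' // -mulrA ler_wpM2l // DC.
Qed.

Lemma L1bounded_zero : L1bounded (fun _ _ => 0).
Proof.
split=> [f _|a f g _ _|]; first exact: L1_cst.
  by apply: aeq_eq; apply/funext => w; rewrite mulr0 addr0.
by exists 0 => f _; rewrite normr0 E1_cst mul0r.
Qed.

Lemma L1bounded_scale a D : L1bounded D -> L1bounded (fun p w => a * D p w).
Proof.
move=> hD; have := L1bounded_lin a hD L1bounded_zero.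
rewrite (_ : (fun p w => a * D p w + 0) = (fun p w => a * D p w)) //.
by apply/funext => p; apply/funext => w; rewrite addr0.
Qed.

Lemma L1bounded_add D D' : L1bounded D -> L1bounded D' -> L1bounded (fun p w => D p w + D' p w).
Proof.
move=> hD hD'; have := L1bounded_lin 1 hD hD'.
rewrite (_ : (fun p w => 1 * D p w + D' p w) = (fun p w => D p w + D' p w)) //.
by apply/funext => p; apply/funext => w; rewrite mul1r.
Qed.

Lemma L1bounded_sum (J : Type) (r : seq J) (Q : pred J) (D : J -> form H 2 -> Omega -> R) :
  (forall j, Q j -> L1bounded (D j)) -> L1bounded (fun p w => \sum_(j <- r | Q j) D j p w).
Proof.
move=> hD; elim: r => [|j r IH].
  rewrite (_ : (fun p w => _) = (fun _ _ => 0)); first exact: L1bounded_zero.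
  by apply/funext => p; apply/funext => w; rewrite big_nil.
case Qj: (Q j); last first.
  rewrite (_ : (fun p w => _) = (fun p w => \sum_(j <- r | Q j) D j p w)) //.
  by apply/funext => p; apply/funext => w; rewrite big_cons Qj.
have := L1bounded_lin 1 (hD j Qj) IH; congr L1bounded.
by apply/funext => p; apply/funext => w; rewrite big_cons Qj mul1r.
Qed.

(** The L1 norm of [D f] is a seminorm in [f] to which [density] applies. *)
Lemma L1bounded_density D : L1bounded D -> (forall u, D (sq u) =a (fun=> 0)) ->
  forall f, sym2 f -> D f =a (fun=> 0).
Proof.
move=> [D1 Dl [C DC]] Dsq f sf; apply: E1_abs_eq0; first exact: D1.
apply: (@density R H ip hip e he (fun f => E1 P (fun w => `|D f w|)) C) => //.
- move=> a g h sg sh; have sl := symmetric_lin a sg sh.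
  have LA := L1_abs (D1 _ sg); have LA' := L1_abs (D1 _ sh).
  rewrite (@E1_aeq _ _ _ P _ (fun w => `|a * D g w + D h w|)).
  + rewrite -E1_lin //; apply: E1_le; [|exact: L1_lin|].
    * by apply: L1_abs; apply: L1_lin; exact: D1.
    * by move=> w; rewrite (le_trans (ler_normD _ _)) // normrM.
  + exact/L1_measurable/L1_abs/D1.
  + by apply/L1_measurable/L1_abs/L1_lin; exact: D1.
  + by apply: filterS (Dl a g h sg sh) => w ->.
- move=> u; rewrite (@E1_aeq _ _ _ P _ (fun=> 0)) ?E1_cst //.
  + exact/L1_measurable/L1_abs/D1/(symmetric_power hip he).
  + by apply: filterS (Dsq u) => w ->; rewrite normr0.
Qed.

Lemma symmetric_symstar f g : sym2 f -> sym2 g -> sym2 (Sym (star ip e f g)).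
Proof. by move=> [tf _] [tg _]; apply: symmetric_Sym; exact: (tensor_star hip he). Qed.

Lemma bounded_map_star f g : sym2 f -> sym2 g ->
  [/\ bounded_map (fun p => Sym (star ip e f p)), bounded_map (fun p => Sym (star ip e p f)),
      bounded_map (fun p => Sym (star ip e f (star ip e g p))),
      bounded_map (fun p => Sym (star ip e f (star ip e p g)))
    & bounded_map (fun p => Sym (star ip e p (star ip e f g)))].
Proof.
move=> sf sg; have [tf _] := sf; have [tg _] := sg.
have hf := tensor_bform tf; have hg := tensor_bform tg.
have lb a p q : sym2 p -> sym2 q -> bform (lin a p q).
  by move=> hp hq; exact: (tensor_bform (tensor_lin a hp.1 hq.1)).
have st := tensor_star hip he.
have bst := bform_star hip he.
have hle p q : tensor e p -> tensor e q -> hsq e (Sym (star ip e p q)) <= hsq e p * hsq e q.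
  move=> tp tq; apply: le_trans (hsq_Sym (st _ _ tp tq)) _.
  by case: (star_hsq hip he tp tq).
have sle p q : tensor e p -> tensor e q -> hsq e (star ip e p q) <= hsq e p * hsq e q.
  by move=> tp tq; case: (star_hsq hip he tp tq).
have ge := hsq_ge0 e.
split.
- split=> [p [tp _]|a p q [tp _] [tq _]|].
  + exact/symmetric_Sym/st.
  + have hp := tensor_bform tp; have hq := tensor_bform tq.
    by rewrite (star_linr hip he) // Sym_lin.
  + by exists (hsq e f) => // p [tp _]; exact: hle.
- split=> [p [tp _]|a p q [tp _] [tq _]|].
  + exact/symmetric_Sym/st.
  + have hp := tensor_bform tp; have hq := tensor_bform tq.
    by rewrite (star_linl hip he) // Sym_lin.
  + by exists (hsq e f) => // p [tp _]; rewrite mulrC hle.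
- split=> [p [tp _]|a p q [tp _] [tq _]|].
  + exact/symmetric_Sym/st/st.
  + have hp := tensor_bform tp; have hq := tensor_bform tq.
    by rewrite (star_linr hip he) // (star_linr hip he) // ?Sym_lin //; exact: bst.
  + exists (hsq e f * hsq e g); first by rewrite mulr_ge0.
    move=> p [tp _]; apply: le_trans (hle _ _ tf (st _ _ tg tp)) _.
    by rewrite -mulrA ler_wpM2l // sle.
- split=> [p [tp _]|a p q [tp _] [tq _]|].
  + exact/symmetric_Sym/st/st.
  + have hp := tensor_bform tp; have hq := tensor_bform tq.
    by rewrite (star_linl hip he) // (star_linr hip he) // ?Sym_lin //; exact: bst.
  + exists (hsq e f * hsq e g); first by rewrite mulr_ge0.
    move=> p [tp _]; apply: le_trans (hle _ _ tf (st _ _ tp tg)) _.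
    by rewrite -mulrA ler_wpM2l // mulrC sle.
- split=> [p [tp _]|a p q [tp _] [tq _]|].
  + exact/symmetric_Sym/st/st.
  + have hp := tensor_bform tp; have hq := tensor_bform tq.
    by rewrite (star_linl hip he) // ?Sym_lin //; exact: bst.
  + exists (hsq e f * hsq e g); first by rewrite mulr_ge0.
    move=> p [tp _]; apply: le_trans (hle _ _ tp (st _ _ tf tg)) _.
    by rewrite mulrC ler_wpM2r // sle.
Qed.

End Products.

(** * The product formula *)

Section GaussWickPairs.
Import boot.fintype boot.finset.
Variables (R : realType) (V : finType).

(** Labels of vector factors: a square contributes two factors, told apart
    by the boolean; [None] labels the square that is multiplied in. *)
Definition lab : finType := (option V * bool)%type.
Definition twice (S : {set V}) : {set lab} := [set x | if x.1 is Some i then i \in S else false].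

Variables (x : option V -> R) (b : option V -> option V -> R).
Hypothesis bs : forall i j, b i j = b j i.

Local Notation G := (@gw R lab (fun z => x z.1) (fun z t => b z.1 t.1)).
Local Notation A1 := ((None, true) : lab).
Local Notation A2 := ((None, false) : lab).
Local Notation B i := ((Some i, true) : lab).
Local Notation C i := ((Some i, false) : lab).

Let G_setU1 (z : lab) (S : {set lab}) : z \notin S ->
  G (z |: S) = x z.1 * G S - \sum_(i in S) b z.1 i.1 * G (S :\ i).
Proof. by move=> zS; apply: gw_setU1. Qed.

Let G_swap (z t : lab) (S : {set lab}) : z.1 = t.1 -> z \notin S -> t \notin S ->
  G (z |: S) = G (t |: S).
Proof. by move=> zt zS tS; rewrite !G_setU1 // zt. Qed.

Let lab_twice (z : lab) (S : {set V}) :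
  (z \in twice S) = if z.1 is Some i then i \in S else false.
Proof. by rewrite inE. Qed.

Let twiceD1 (i : V) (S : {set V}) : i \in S -> twice S = B i |: (C i |: twice (S :\ i)).
Proof.
move=> iS; apply/setP => -[[j|] c]; rewrite !inE /= ?xpair_eqE; last by case: c.
have [->|ji] := eqVneq j i; first by rewrite iS eqxx; case: c.
rewrite (_ : (Some j == Some i) = false) /= ?in_setD1 ?ji //.
by apply/eqP => -[] /eqP; rewrite (negPf ji).
Qed.

Let BC i : B i != C i. Proof. by rewrite xpair_eqE andbF. Qed.

Let notB i (S : {set V}) : B i \notin C i |: twice (S :\ i).
Proof. by rewrite in_setU1 negb_or BC lab_twice /= setD11. Qed.

Let notC i (S : {set V}) : C i \notin twice (S :\ i).
Proof. by rewrite lab_twice /= setD11. Qed.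

Let notBt i (S : {set V}) : B i \notin twice (S :\ i).
Proof. by rewrite lab_twice /= setD11. Qed.

Let sum_twice (S : {set V}) (F : lab -> R) :
  \sum_(z in twice S) F z = \sum_(i in S) (F (B i) + F (C i)).
Proof.
have [n] := ubnP #|S|; elim: n => // n IH in S *; rewrite ltnS => Sn.
have [->|[i iS]] := set_0Vmem S.
  rewrite big_set0 big_pred0 // => -[[i|] c]; rewrite lab_twice //=.
  by rewrite in_set0.
rewrite (twiceD1 iS) !big_setU1 //= ?(big_setD1 i iS) /= addrA IH //.
by move: Sn; rewrite (cardsD1 i) iS.
Qed.

Let twiceDB i (S : {set V}) : i \in S -> twice S :\ B i = C i |: twice (S :\ i).
Proof. by move=> iS; rewrite (twiceD1 iS) setU1K. Qed.

Let twiceDC i (S : {set V}) : i \in S -> twice S :\ C i = B i |: twice (S :\ i).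
Proof.
move=> iS; rewrite (twiceD1 iS) setUCA setU1K //.
by rewrite in_setU1 negb_or eq_sym BC lab_twice /= setD11.
Qed.

Let GD (z : lab) (S : {set V}) i : i \in S -> G (twice S :\ B i) = G (twice S :\ C i).
Proof. by move=> iS; rewrite twiceDB // twiceDC //; apply: G_swap. Qed.

Let U1D (z t : lab) (S : {set lab}) : z != t -> (z |: S) :\ t = z |: (S :\ t).
Proof. by move=> zt; apply/setP => y; rewrite !inE; case: (eqVneq y t) => [->|]; rewrite // eq_sym (negPf zt). Qed.

(** Expansion of one more factor against paired factors. *)
Let G_pair (z : lab) (S : {set V}) : z \notin twice S ->
  G (z |: twice S) = x z.1 * G (twice S)
   - 2 * \sum_(i in S) b z.1 (Some i) * G (B i |: twice (S :\ i)).
Proof.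
move=> zS; rewrite G_setU1 // sum_twice mulr_sumr; congr (_ - _); apply: eq_bigr => i iS.
by rewrite /= GD // twiceDC //; ring.
Qed.

(** The two copies of the additional factor are contracted with nothing,
    with one factor, with both copies of the same factor, or with copies of
    two different factors. A contraction can use either copy of the other
    factor, and a single contraction either copy of the additional one,
    whence the coefficients. *)
Lemma gw_square_mul (S : {set V}) :
  (x None ^+ 2 - b None None) * G (twice S) =
  G (A1 |: (A2 |: twice S))
  + 4 * \sum_(i in S) b None (Some i) * G (A1 |: (B i |: twice (S :\ i)))
  + 2 * \sum_(i in S) b None (Some i) ^+ 2 * G (twice (S :\ i))
  + 4 * \sum_(i in S) \sum_(j in S :\ i) b None (Some i) * b None (Some j) *
        G (B i |: (B j |: twice (S :\ i :\ j))).
Proof.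
have A1t S' : A1 \notin twice S' by rewrite inE.
have A2t S' : A2 \notin twice S' by rewrite inE.
(* the third factor met by the extra index, after a first contraction *)
have E1 i : i \in S -> G (A1 |: (B i |: twice (S :\ i))) =
    x None * G (B i |: twice (S :\ i)) - b None (Some i) * G (twice (S :\ i))
    - 2 * \sum_(j in S :\ i) b None (Some j) * G (B i |: (B j |: twice (S :\ i :\ j))).
  move=> iS; rewrite G_setU1; last by rewrite !inE.
  rewrite big_setU1 //= setU1K // sum_twice opprD addrA; congr (_ - _); rewrite mulr_sumr.
  apply: eq_bigr => j jS /=; rewrite !U1D; last 2 first.
  - by rewrite xpair_eqE andbF.
  - rewrite xpair_eqE andbT; apply/eqP => -[] ij; move: jS; rewrite ij setD11 //.
  have swap : G (B i |: (twice (S :\ i) :\ B j)) = G (B i |: (twice (S :\ i) :\ C j)).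
    rewrite twiceDB // twiceDC // setUCA [in RHS]setUCA; apply: G_swap => //.
    + by rewrite in_setU1 negb_or notC xpair_eqE andbF.
    + rewrite in_setU1 negb_or notBt andbT xpair_eqE andbT.
      by apply/eqP => -[ji]; move: jS; rewrite ji setD11.
  by rewrite swap twiceDC //; ring.
have E0 : G (A1 |: (A2 |: twice S)) = x None * G (A2 |: twice S) - b None None * G (twice S)
    - 2 * \sum_(i in S) b None (Some i) * G (A1 |: (B i |: twice (S :\ i))).
  rewrite G_setU1; last by rewrite !inE.
  rewrite big_setU1 //= setU1K // sum_twice opprD addrA; congr (_ - _); rewrite mulr_sumr.
  apply: eq_bigr => i iS /=; rewrite !U1D ?xpair_eqE ?andbF //.
  have swap z : z.1 != None -> G (A2 |: (z |: twice (S :\ i))) = G (A1 |: (z |: twice (S :\ i))).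
    move=> zN; apply: G_swap => //; rewrite in_setU1 negb_or ?A1t ?A2t andbT.
      by apply: contra zN => /eqP <-.
    by apply: contra zN => /eqP <-.
  have BCs : G (A1 |: (C i |: twice (S :\ i))) = G (A1 |: (B i |: twice (S :\ i))).
    rewrite setUCA [in RHS]setUCA; apply: G_swap => //.
    + by rewrite in_setU1 negb_or notC andbT xpair_eqE.
    + by rewrite in_setU1 negb_or notBt andbT xpair_eqE.
  by rewrite twiceDB // twiceDC // !swap // BCs; ring.
rewrite E0 (G_pair (A2t S)) /=.
set S0 := G (twice S); set T0 := \sum_(i in S) b None (Some i) * G (A1 |: _).
have T0E : T0 = x None * (\sum_(i in S) b None (Some i) * G (B i |: twice (S :\ i)))
   - \sum_(i in S) b None (Some i) ^+ 2 * G (twice (S :\ i))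
   - 2 * \sum_(i in S) \sum_(j in S :\ i) b None (Some i) * b None (Some j) *
        G (B i |: (B j |: twice (S :\ i :\ j))).
  rewrite /T0 !mulr_sumr -!sumrB; apply: eq_bigr => i iS; rewrite E1 //.
  rewrite !mulrBr; congr (_ - _ - _); [by ring|by ring|].
  by rewrite !mulr_sumr; apply: eq_bigr => j _; ring.
by rewrite T0E; ring.
Qed.

End GaussWickPairs.

Section ProductFormula.
Context (R : realType) (H : completeNormedModType R) (ip : {dot H for idfun}).
Hypothesis hip : forall x, ip x x = `|x| ^+ 2.
Variable e : nat -> H.
Hypothesis he : orthonormal_basis ip e.
Context (d : measure_display) (Omega : measurableType d) (P : probability Omega R).
Variable W : H -> {RV P >-> R}.
Hypothesis hW : isonormal ip W.
Variable I : forall n, form H n -> {RV P >-> R}.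
Hypothesis hI : forall n, (0 < n)%N -> multiple_integral ip e W (@I n).
Implicit Types (f g p : form H 2) (l : seq (form H 2)) (X : Omega -> R).

Local Notation "X =a Y" := (aeq P X Y) (at level 70).
Local Notation sq u := (@tensor_power R H ip u 2).
Local Notation sym2 := (@symmetric_tensor R H e 2).
Local Notation syms := (sym_tensors e).
Local Notation calI := (calI I).
Local Notation pp a b := (pure ip (pair2 a b)).

Definition flat (T : Type) (qs : seq (T * T)) : seq T := flatten [seq [:: q.1; q.2] | q <- qs].

Lemma size_flat (T : Type) (qs : seq (T * T)) : size (flat qs) = (size qs * 2)%N.
Proof. by rewrite /flat; elim: qs => //= q qs ->. Qed.

(** A symmetric product of symmetrised products of two vectors is one
    symmetrised product of vectors. *)
Lemma sbp_pairs (T : Type) (v : T -> H) x0 (qs : seq (T * T)) :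
  sbp (size qs) [seq Sym (pp (v q.1) (v q.2)) | q <- qs] =
  Sym (pure ip (fun i : 'I_(size qs * 2) => v (nth x0 (flat qs) i))).
Proof.
elim: qs => [|q qs IH] /=.
  apply/funext => h; rewrite Sym_id /pure ?big_ord0 // => s h'.
  by rewrite !big_ord0.
rewrite IH /sym_prod Sym_tensor_prod; congr Sym; apply/funext => h.
rewrite /tensor_prod /pure [RHS](@big_split_ord _ _ _ 2 (size qs * 2)) /=.
by rewrite !big_ord2.
Qed.

(** The labels are distinct although vectors may coincide, so that the Wick
    monomial can be indexed by the set of labels. *)
Lemma calI_pairs (T : finType) (v : T -> H) (x0 : T) (qs : seq (T * T)) : uniq (flat qs) ->
  calI [seq Sym (pp (v q.1) (v q.2)) | q <- qs] =a
  (fun w => gw (fun z => W (v z) w) (fun z t => ip (v z) (v t)) [set z in flat qs]%SET).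
Proof.
case: qs => [_|q qs uq].
  apply: aeq_eq; apply/funext => w; by rewrite (_ : [set z in flat [::]]%SET = finset.set0) ?gw0 //.
rewrite /calI size_map (sbp_pairs v x0 (q :: qs)); set n := (size (q :: qs) * 2)%N.
have n0 : (0 < n)%N by [].
apply: aeq_trans; first exact: (I_pure hip he hW hI n0).
apply: aeq_eq; apply/funext => w; pose rho (i : 'I_n) := nth x0 (flat (q :: qs)) i.
have rho_inj : injective rho.
  move=> i j /eqP; rewrite nth_uniq ?size_flat ?ltn_ord // => /eqP ij; exact: val_inj.
have := @gw_imset R _ _ rho (fun z => W (v z) w) (fun z t => ip (v z) (v t)) (finset.setTfor 'I_n) rho_inj.
rewrite /comp => -> => [|z t]; last exact: ipC.
congr gw; apply/finset.setP => z; rewrite inE; apply/imsetP/idP => [[i _ ->]|].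
  by rewrite mem_nth // size_flat.
move=> zq; have iz : (index z (flat (q :: qs)) < n)%N by rewrite /n -(size_flat (q :: qs)) index_mem.
by exists (Ordinal iz); rewrite ?inE // /rho nth_index.
Qed.

Lemma sqE2 u : sq u = Sym (pp u u).
Proof.
have E : sq u = pp u u.
  by apply/funext => h; rewrite /tensor_power /pure; apply: eq_bigr => i _; rewrite /pair2; case: ifP.
apply/funext => h; rewrite -E Sym_id //; exact: (symmetric_power hip he u 2).2.
Qed.

Lemma calI_scale l c g : syms l -> sym2 g ->
  calI ((fun h => c * g h) :: l) =a (fun w => c * calI (g :: l) w).
Proof.
move=> sl sg; have -> : (fun h => c * g h) = lin (c - 1) g g by apply/funext => h; rewrite /lin; ring.
have := calI_lin hI (l1 := [::]) (c - 1) Logic.I sl sg sg.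
by apply: filterS => w /= ->; ring.
Qed.

Lemma pp_star2 a u h : star ip e (sq a) (sq u) h = ip a u * pp a u h.
Proof.
have ba := symmetric_bform (symmetric_power hip he a 2).
have bu := symmetric_bform (symmetric_power hip he u 2).
rewrite (starE hip he) // (sqE ip) (HS_op_sq hip he) (ipZr ip) /pure big_ord2 /pair2 /=; ring.
Qed.

Lemma pp_star3 u a v h : star ip e (sq u) (star ip e (sq a) (sq v)) h =
  ip u a * ip a v * pp u v h.
Proof.
have ba := symmetric_bform (symmetric_power hip he a 2).
have bu := symmetric_bform (symmetric_power hip he u 2).
have bv := symmetric_bform (symmetric_power hip he v 2).
have bav := bform_star hip he ba bv.
rewrite (starE hip he) // (sqE ip) (HS_op_star hip he) // !(HS_op_sq hip he) !(ipZr ip).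
by rewrite /pure big_ord2 /pair2 /=; ring.
Qed.

Lemma Sym_scale n c (g : form H n) : Sym (fun h => c * g h) = fun h => c * Sym g h.
Proof. by apply/funext => h; rewrite /Sym -mulr_sumr mulrCA. Qed.

Variable V : finType.
Implicit Types (F : V -> form H 2) (S : {set V}).

Definition calS l F S := calI (l ++ [seq F i | i <- enum S]).

(** The difference between the two sides of the product formula: a factor
    [f] is adjoined to a symmetric product with no, one or two contractions,
    the latter either with the same factor or with two different ones. *)
Definition product_defect f F S (w : Omega) : R :=
  @I 2 f w * calS [::] F S w -
  (calS [:: f] F S w
   + 4 * \sum_(i in S) calS [:: Sym (star ip e f (F i))] F (S :\ i)%SET w
   + 2 * \sum_(i in S) tr2 ip e f (F i) * calS [::] F (S :\ i)%SET w
   + 4 * \sum_(i in S) \sum_(j in (S :\ i)%SET)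
       calS [:: Sym (star ip e (F i) (star ip e f (F j)))] F (S :\ i :\ j)%SET w).

Lemma symmetric_pp a b : sym2 (Sym (pp a b)).
Proof. by apply: symmetric_Sym; exact: (tensor_pure hip he). Qed.

(** On squares, and symmetrised products of two vectors, everything is a
    Wick monomial of Gaussian variables. *)
Lemma calS_squares (u : option V -> H) (qs : seq (lab V * lab V)) S :
  uniq (flat qs) -> (forall z, z \in flat qs -> z \notin twice S) ->
  calS [seq Sym (pp (u q.1.1) (u q.2.1)) | q <- qs] (fun i => sq (u (Some i))) S =a
  (fun w => gw (fun z : lab V => W (u z.1) w) (fun z t => ip (u z.1) (u t.1))
     ([set z in flat qs] :|: twice S)%SET).
Proof.
move=> uq disj; pose q2 : seq (lab V * lab V) := [seq ((Some i, true), (Some i, false)) | i <- enum S].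
have mem2 z : (z \in flat q2) = (z \in twice S).
  rewrite inE /flat /q2 -map_comp; apply/flattenP/idP => [[s /mapP[i iS ->]]|].
    by rewrite !inE mem_enum in iS * => /orP[] /eqP -> /=.
  case: z => -[i|] c //= iS; exists [:: (Some i, true); (Some i, false)].
    by apply/mapP; exists i; rewrite ?mem_enum.
  by rewrite !inE; case: c; rewrite eqxx ?orbT.
have u2 : uniq (flat q2).
  rewrite /q2; elim: (enum S) (enum_uniq S) => //= i s IH /andP[is_ us].
  rewrite IH // andbT !inE xpair_eqE andbF /= /flat -map_comp.
  suff N c : (Some i, c) \notin flatten [seq [:: q.1; q.2] | q <- [seq ((Some i, true), (Some i, false)) | i <- s]].
    by rewrite -map_comp in N; rewrite /= !N.
  apply/flattenP => -[t]; rewrite -map_comp => /mapP[j js ->]; rewrite !inE !xpair_eqE.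
  by case/orP => /andP[/eqP[ij] _]; rewrite ij js in is_.
have -> : calS [seq Sym (pp (u q.1.1) (u q.2.1)) | q <- qs] (fun i => sq (u (Some i))) S =
   calI [seq Sym (pp (u q.1.1) (u q.2.1)) | q <- qs ++ q2].
  by rewrite /calS map_cat /q2 -[in RHS]map_comp; congr (calI (_ ++ _)); apply: eq_map => i /=;
    rewrite sqE2.
have fl : flat (qs ++ q2) = flat qs ++ flat q2 by rewrite /flat map_cat flatten_cat.
have ufl : uniq (flat (qs ++ q2)).
  rewrite fl cat_uniq uq u2 andbT /=; apply/hasPn => z; rewrite mem2 => zS.
  by apply: contraL zS => /disj.
apply: aeq_trans; first exact: (calI_pairs (fun z : lab V => u z.1) (None, true) ufl).
apply: aeq_eq; apply/funext => w; congr gw; apply/finset.setP => z; rewrite !inE fl mem_cat mem2.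
by rewrite inE.
Qed.

(** On squares all terms are Wick monomials, and the identity is the
    pointwise [gw_square_mul]. *)
Lemma product_defect_squares a (u : V -> H) S :
  product_defect (sq a) (fun i => sq (u i)) S =a (fun=> 0).
Proof.
pose u' (o : option V) := oapp u a o.
have nt o c i S' : o = None \/ o = Some i -> ((o, c) : lab V) \notin twice (S' :\ i)%SET.
  by case=> ->; rewrite inE //= finset.setD11.
have nN c S' : ((None, c) : lab V) \notin twice S' by rewrite inE.
pose G w := @gw R (lab V) (fun z => W (u' z.1) w) (fun z t => ip (u' z.1) (u' t.1)).
have h0 := @calS_squares u' [::] S isT.
have h1 : calS [:: sq a] (fun i => sq (u i)) S =a
    (fun w => G w ((None, true) |: ((None, false) |: twice S)))%SET.
  have := @calS_squares u' [:: ((None, true), (None, false))] S isT.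
  rewrite /= -(sqE2 a) => h; apply: aeq_trans (h _) _ => [z|].
    by rewrite !inE => /orP[] /eqP ->.
  apply: aeq_eq; apply/funext => w; congr gw; apply/finset.setP => z; rewrite !inE.
  by rewrite orbA.
have h2 i : i \in S -> calS [:: Sym (star ip e (sq a) (sq (u i)))] (fun i => sq (u i)) (S :\ i)%SET =a
    (fun w => ip a (u i) * G w ((None, true) |: ((Some i, true) |: twice (S :\ i)))%SET).
  move=> iS; have := @calS_squares u' [:: ((None, true), (Some i, true))] (S :\ i)%SET isT.
  rewrite /= => h.
  have -> : Sym (star ip e (sq a) (sq (u i))) = fun h => ip a (u i) * Sym (pp a (u i)) h.
    by rewrite -Sym_scale; congr Sym; apply/funext => k; rewrite pp_star2.
  apply: aeq_trans (calI_scale _ _ (symmetric_pp _ _)) _.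
    by apply: sym_tensors_map => j; exact: (symmetric_power hip he).
  apply: aeq_scale; apply: aeq_trans (h _) _ => [z|].
    by rewrite !inE => /orP[] /eqP -> //=; rewrite !inE eqxx.
  apply: aeq_eq; apply/funext => w; congr gw; apply/finset.setP => z; rewrite !inE.
  by rewrite orbA.
have h3 i : i \in S -> calS [::] (fun i => sq (u i)) (S :\ i)%SET =a
    (fun w => G w (twice (S :\ i))%SET).
  move=> iS; have := @calS_squares u' [::] (S :\ i)%SET isT => h; apply: aeq_trans (h _) _ => //.
  by apply: aeq_eq; apply/funext => w; congr gw; apply/finset.setP => z; rewrite !inE.
have h4 i j : i \in S -> j \in (S :\ i)%SET ->
    calS [:: Sym (star ip e (sq (u i)) (star ip e (sq a) (sq (u j))))] (fun i => sq (u i)) (S :\ i :\ j)%SET =a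
    (fun w => ip a (u i) * ip a (u j) * G w ((Some i, true) |: ((Some j, true) |: twice (S :\ i :\ j)))%SET).
  move=> iS jS; have ij : j != i by move: jS; rewrite !inE => /andP[].
  have uq : uniq (flat [:: ((Some i, true), (Some j, true)) : lab V * lab V]).
    by rewrite /= inE xpair_eqE !andbT; apply/eqP => -[ii]; rewrite ii eqxx in ij.
  have := @calS_squares u' [:: ((Some i, true), (Some j, true))] (S :\ i :\ j)%SET uq.
  rewrite /= => h.
  have -> : Sym (star ip e (sq (u i)) (star ip e (sq a) (sq (u j)))) =
      fun h => ip a (u i) * ip a (u j) * Sym (pp (u i) (u j)) h.
    by rewrite -Sym_scale; congr Sym; apply/funext => k; rewrite pp_star3 (ipC ip (u i) a).
  apply: aeq_trans (calI_scale _ _ (symmetric_pp _ _)) _.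
    by apply: sym_tensors_map => k; exact: (symmetric_power hip he).
  apply: aeq_scale; apply: aeq_trans (h _) _ => [z|].
    by rewrite !inE => /orP[] /eqP -> //=; rewrite !inE eqxx ?andbF.
  apply: aeq_eq; apply/funext => w; congr gw; apply/finset.setP => z; rewrite !inE.
  by rewrite orbA.
have hI2 : @I 2 (sq a) =a (fun w => W a w ^+ 2 - ip a a).
  apply: aeq_trans (I_power hip he hW hI (n := 2) isT a) _; apply: aeq_eq; apply/funext => w.
  have -> : finset.setTfor 'I_2 = (ord0 |: [set ord_max])%SET.
    by apply/finset.setP => i; rewrite !inE; case: i => [[|[|//]] ?].
  rewrite gw_setU1 ?inE // -(finset.setU0 [set ord_max]%SET) gw_setU1 ?inE // big_set0 gw0.
  by rewrite finset.setU0 big_set1 finset.setDv gw0 hip; ring.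
have hS1 := aeq_sum (index_enum V) (Q := mem S) h2.
have hS3 := aeq_sum (index_enum V) (Q := mem S) (fun i iS => aeq_scale (tr2 ip e (sq a) (sq (u i))) (h3 i iS)).
have hS4 := aeq_sum (index_enum V) (Q := mem S) (fun i iS => aeq_sum (index_enum V) (Q := mem (S :\ i)%SET) (fun j jS => h4 i j iS jS)).
have h0' : calS [::] (fun i => sq (u i)) S =a (fun w => G w (twice S)).
  apply: aeq_trans (h0 _) _ => //.
  by apply: aeq_eq; apply/funext => w; congr gw; apply/finset.setP => z; rewrite !inE.
have hA := aeq_mul hI2 h0'.
have hB := aeq_add (aeq_add (aeq_add h1 (aeq_scale 4 hS1)) (aeq_scale 2 hS3)) (aeq_scale 4 hS4).
move: hA hB; apply: filterS2 => w hA hB; rewrite /product_defect hA hB /=.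
have := @gw_square_mul R V (fun o => W (u' o) w) (fun o o' => ip (u' o) (u' o')) _ S.
rewrite /= => ->; last by move=> *; exact: ipC.
apply/eqP; rewrite subr_eq0; apply/eqP; congr (_ + _ * _ + _ * _ + _ * _).
apply: eq_bigr => i _; rewrite (tr2_sq hip he); last exact: (symmetric_power hip he _ 2).1.
by rewrite (sqE ip) expr2.
Qed.

End ProductFormula.

Section ProductFormulaGeneral.
Context (R : realType) (H : completeNormedModType R) (ip : {dot H for idfun}).
Hypothesis hip : forall x, ip x x = `|x| ^+ 2.
Variable e : nat -> H.
Hypothesis he : orthonormal_basis ip e.
Context (d : measure_display) (Omega : measurableType d) (P : probability Omega R).
Variable W : H -> {RV P >-> R}.
Hypothesis hW : isonormal ip W.
Variable I : forall n, form H n -> {RV P >-> R}.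
Hypothesis hI : forall n, (0 < n)%N -> multiple_integral ip e W (@I n).
Variable V : finType.
Implicit Types (f g p : form H 2) (l : seq (form H 2)) (X : Omega -> R).
Implicit Types (F : V -> form H 2) (S : {set V}) (v : V).

Local Notation "X =a Y" := (aeq P X Y) (at level 70).
Local Notation sq u := (@tensor_power R H ip u 2).
Local Notation sym2 := (@symmetric_tensor R H e 2).
Local Notation syms := (sym_tensors e).
Local Notation calI := (calI I).
Local Notation calS := (calS I).
Local Notation L1g := (L1bounded e P).
Local Notation L2g := (L2bounded e P).

Definition upd F v p : V -> form H 2 := fun k => if k == v then p else F k.

Lemma upd_sym F v p : (forall i, sym2 (F i)) -> sym2 p -> forall i, sym2 (upd F v p i).
Proof. by move=> sF sp i; rewrite /upd; case: ifP. Qed.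

Lemma calS_notin l F v p S : v \notin S -> calS l (upd F v p) S = calS l F S.
Proof.
move=> vS; rewrite /calS; congr (calI (_ ++ _)); apply/eq_in_map => i.
by rewrite mem_enum /upd => iS; case: eqP => // iv; rewrite -iv iS in vS.
Qed.

Lemma L1bounded_ext (D D' : form H 2 -> Omega -> R) :
  (forall p w, D p w = D' p w) -> L1g D -> L1g D'.
Proof. by move=> E; rewrite (_ : D = D') //; apply/funext => p; apply/funext => w. Qed.

Section Slot.
Variables (F : V -> form H 2) (v : V).
Hypothesis sF : forall i, sym2 (F i).

Lemma L2bounded_slot l S : syms l -> v \in S -> L2g (fun p => calS l (upd F v p) S).
Proof.
move=> sl vS; have vE : v \in enum S by rewrite mem_enum.
have [r1 [r2 [E n1 n2]]] : exists r1 r2, [/\ enum S = r1 ++ v :: r2, v \notin r1 & v \notin r2].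
  have := enum_uniq (mem S); case/splitPr: vE => r1 r2; rewrite cat_uniq /=.
  by case/and3P => _ /norP[n1 _] /andP[n2 _]; exists r1, r2.
have fr r p : v \notin r -> [seq upd F v p i | i <- r] = [seq F i | i <- r].
  move=> vr; apply/eq_in_map => i ir; rewrite /upd; case: eqP => // iv.
  by rewrite -iv ir in vr.
have -> : (fun p => calS l (upd F v p) S) =
    (fun p => calI ((l ++ [seq F i | i <- r1]) ++ id p :: [seq F i | i <- r2])).
  apply/funext => p; rewrite /calS E map_cat /= !fr // /upd eqxx.
  by rewrite catA.
apply: (L2bounded_calI hI); [|exact: sym_tensors_map|exact: bounded_map_id].
by apply/sym_tensors_cat; split=> //; exact: sym_tensors_map.
Qed.

Lemma L2bounded_head phi S : bounded_map e phi -> v \notin S ->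
  L2g (fun p => calS [:: phi p] (upd F v p) S).
Proof.
move=> hphi vS; rewrite (_ : (fun p => _) = (fun p => calI ([::] ++ phi p :: [seq F i | i <- enum S]))).
  by apply: (L2bounded_calI hI) => //; exact: sym_tensors_map.
by apply/funext => p; rewrite calS_notin.
Qed.

End Slot.

Lemma symmetric_star3 f g p : sym2 f -> sym2 g -> sym2 p -> sym2 (Sym (star ip e f (star ip e g p))).
Proof.
move=> [tf _] [tg _] [tp _]; apply: symmetric_Sym; apply: (tensor_star hip he) => //.
exact: (tensor_star hip he).
Qed.

Lemma L2_calS l F S : syms l -> (forall i, sym2 (F i)) -> L2 P (calS l F S).
Proof.
move=> sl sF; apply: (calI_L2 hI _).1; apply/sym_tensors_cat; split=> //.
exact: sym_tensors_map.
Qed.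

Lemma L2_I2 f : sym2 f -> L2 P (@I 2 f).
Proof. by move=> sf; case: (I_L2 hI (n := 2) isT sf). Qed.

Lemma tr2_good_r f : sym2 f -> forall X, L2 P X -> L2g (fun p w => tr2 ip e f p * X w).
Proof.
move=> [tf _] X hX; apply: L2bounded_scalar => // [a g h [tg _] [th _]|].
  exact: (tr2_linr hip he).
by exists (hs e f) => [|g [tg _]]; [exact: hs_ge0|exact: (tr2_le hip he)].
Qed.

Lemma tr2_good_l f : sym2 f -> forall X, L2 P X -> L2g (fun p w => tr2 ip e p f * X w).
Proof.
move=> [tf _] X hX; apply: L2bounded_scalar => // [a g h [tg _] [th _]|].
  exact: (tr2_linl hip he).
by exists (hs e f) => [|g [tg _]]; [exact: hs_ge0|rewrite mulrC; exact: (tr2_le hip he)].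
Qed.

(** Every term is an integral with [p] in one slot, possibly after
    contraction with other tensors, or a trace against [p]. *)
Lemma product_defect_slot f F v S : sym2 f -> (forall i, sym2 (F i)) -> v \in S ->
  L1g (fun p => product_defect ip e I f (upd F v p) S).
Proof.
move=> sf sF vS.
have ss g h : sym2 g -> sym2 h -> sym2 (Sym (star ip e g h)) by exact: (symmetric_symstar hip he).
have updv p : upd F v p v = p by rewrite /upd eqxx.
have updn i p : i != v -> upd F v p i = F i by rewrite /upd => /negPf ->.
have inD i S' : i != v -> v \in S' -> v \in (S' :\ i)%SET.
  by move=> iv vS'; rewrite !inE vS' eq_sym iv.
have notD S' : v \notin (S' :\ v)%SET by rewrite !inE eqxx.
apply: (@L1bounded_ext (fun p w => (-1) * (calS [:: f] (upd F v p) S w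
   + 4 * (\sum_(i in S) calS [:: Sym (star ip e f (upd F v p i))] (upd F v p) (S :\ i)%SET w)
   + 2 * (\sum_(i in S) tr2 ip e f (upd F v p i) * calS [::] (upd F v p) (S :\ i)%SET w)
   + 4 * (\sum_(i in S) \sum_(j in (S :\ i)%SET)
       calS [:: Sym (star ip e (upd F v p i) (star ip e f (upd F v p j)))] (upd F v p) (S :\ i :\ j)%SET w))
   + @I 2 f w * calS [::] (upd F v p) S w)).
  by move=> p w; rewrite mulN1r addrC.
apply: L1bounded_lin; last by apply: L2bounded_mul; [exact: L2bounded_slot|exact: L2_I2].
apply: L1bounded_add; [apply: L1bounded_add; [apply: L1bounded_add|]|].
- by apply/L2bounded_L1bounded/L2bounded_slot.
- apply/L1bounded_scale/L1bounded_sum => i iS; apply: L2bounded_L1bounded.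
  have [->|iv] := eqVneq i v.
    under eq_fun do rewrite updv; apply: (@L2bounded_head F v sF (fun p => Sym (star ip e f p))) => //.
    by case: (bounded_map_star hip he sf sf).
  under eq_fun do rewrite updn //.
  by apply: L2bounded_slot => //; [split=> //; exact: ss|exact: inD].
- apply/L1bounded_scale/L1bounded_sum => i iS; apply: L2bounded_L1bounded.
  have [->|iv] := eqVneq i v.
    rewrite (_ : (fun p w => _) = (fun p w => tr2 ip e f p * calS [::] F (S :\ v)%SET w)).
      by apply: tr2_good_r => //; exact: L2_calS.
    by apply/funext => p; apply/funext => w; rewrite updv calS_notin.
  have hD : L2g (fun p => calS [::] (upd F v p) (S :\ i)%SET) by apply: L2bounded_slot => //; exact: inD.
  case: hD => D1 D2 [C C0 DC]; split=> [g sg|a g h sg sh|].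
  + by apply: L2_scale; exact: D1.
  + by apply: filterS (D2 a g h sg sh) => w ->; rewrite !updn //; ring.
  + exists (tr2 ip e f (F i) ^+ 2 * C); first by rewrite mulr_ge0 ?sqr_ge0.
    move=> g sg; rewrite (_ : (fun w => _) =
        (fun w => tr2 ip e f (F i) ^+ 2 * calS [::] (upd F v g) (S :\ i)%SET w ^+ 2)).
      rewrite E1_scale; last exact: (L2_L1sqr (D1 g sg)).
      by rewrite -[leRHS]mulrA ler_wpM2l ?sqr_ge0 ?DC.
    by apply/funext => w; rewrite updn // exprMn.
- apply/L1bounded_scale/L1bounded_sum => i iS; apply: L1bounded_sum => j jS; apply: L2bounded_L1bounded.
  have ji : j != i by move: jS; rewrite !inE => /andP[].
  have [iv|iv] := eqVneq i v.
    rewrite iv in ji *; under eq_fun do rewrite updv updn //.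
    apply: (@L2bounded_head F v sF (fun p => Sym (star ip e p (star ip e f (F j))))).
      by case: (bounded_map_star hip he sf (sF j)).
    by rewrite !inE eqxx andbF.
  have [jv|jv] := eqVneq j v.
    rewrite jv; under eq_fun do rewrite updv updn //.
    apply: (@L2bounded_head F v sF (fun p => Sym (star ip e (F i) (star ip e f p)))) => //.
    by case: (bounded_map_star hip he (sF i) sf).
  under eq_fun do rewrite !updn //.
  apply: L2bounded_slot => //; first by split=> //; exact: symmetric_star3.
  by apply: (inD _ _) => //; exact: inD.
Qed.

Lemma product_defect_head F S : (forall i, sym2 (F i)) ->
  L1g (fun f => product_defect ip e I f F S).
Proof.
move=> sF.
apply: (@L1bounded_ext (fun f w => (-1) * (calS [:: f] F S w
   + 4 * (\sum_(i in S) calS [:: Sym (star ip e f (F i))] F (S :\ i)%SET w)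
   + 2 * (\sum_(i in S) tr2 ip e f (F i) * calS [::] F (S :\ i)%SET w)
   + 4 * (\sum_(i in S) \sum_(j in (S :\ i)%SET)
       calS [:: Sym (star ip e (F i) (star ip e f (F j)))] F (S :\ i :\ j)%SET w))
   + calS [::] F S w * @I 2 f w)).
  by move=> p w; rewrite mulN1r addrC [X in X - _]mulrC.
have sm S' : syms [seq F i | i <- enum S'] by exact: sym_tensors_map.
have hd phi S' : bounded_map e phi -> L1g (fun f => calS [:: phi f] F S').
  by move=> hphi; apply: L2bounded_L1bounded; exact: (@L2bounded_calI _ _ _ _ _ _ _ _ _ hI phi [::]).
apply: L1bounded_lin; last first.
  have h : L2g (fun f => calI ([::] ++ id f :: [::])).
    by apply: (L2bounded_calI hI) => //; exact: bounded_map_id.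
  have := L2bounded_mul h (L2_calS S (l := [::]) Logic.I sF).
  case=> D1 D2 [C DC]; split=> [f sf|a f g sf sg|].
  - by have := D1 f sf; rewrite cat0s (calI1 (e := e)).
  - by have := D2 a f g sf sg; rewrite !cat0s !(calI1 (e := e)) //; exact: symmetric_lin.
  - by exists C => f sf; have := DC f sf; rewrite cat0s (calI1 (e := e)).
apply: L1bounded_add; [apply: L1bounded_add; [apply: L1bounded_add|]|].
- by apply: (hd id); exact: bounded_map_id.
- apply/L1bounded_scale/L1bounded_sum => i iS; apply: (hd (fun f => Sym (star ip e f (F i)))).
  by case: (bounded_map_star hip he (sF i) (sF i)).
- apply/L1bounded_scale/L1bounded_sum => i iS; apply: L2bounded_L1bounded.
  by apply: tr2_good_l => //; exact: L2_calS.
- apply/L1bounded_scale/L1bounded_sum => i iS; apply: L1bounded_sum => j jS.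
  apply: (hd (fun f => Sym (star ip e (F i) (star ip e f (F j))))).
  by case: (bounded_map_star hip he (sF i) (sF j)).
Qed.

Lemma upd_id F v : upd F v (F v) = F.
Proof. by apply/funext => k; rewrite /upd; case: eqP => [->|]. Qed.

(** Both sides are multilinear and continuous in every tensor, and agree when
    all tensors are squares; slots are freed one by one. *)
Lemma product_formula f F S : sym2 f -> (forall i, sym2 (F i)) ->
  product_defect ip e I f F S =a (fun=> 0).
Proof.
move=> sf sF.
(* [Q] is the set of slots that need not contain squares *)
suff key (Q : {set V}) : forall F, (forall i, sym2 (F i)) ->
    (forall i, i \notin Q -> exists u, F i = sq u) ->
    forall f, sym2 f -> product_defect ip e I f F S =a (fun=> 0).
  by apply: (key finset.setT) => // i; rewrite inE.
have [n] := ubnP #|Q|; elim: n => // n IH in Q * => Qn {}F {}sF FQ {}f {}sf.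
have [Q0|[v vQ]] := finset.set_0Vmem Q.
  have [u uE] : exists u : V -> H, F = fun i => sq (u i).
    have /choice[u uE] : forall i, exists u, F i = sq u by move=> i; apply: FQ; rewrite Q0 inE.
    by exists u; apply/funext.
  apply: (L1bounded_density hip he (product_defect_head S sF)) => // a.
  by rewrite uE; exact: (product_defect_squares hip he hW hI).
have lt : (#|(Q :\ v)%SET| < n)%N by move: Qn; rewrite (finset.cardsD1 v) vQ ltnS.
have sqv u i : i \notin (Q :\ v)%SET -> exists u', upd F v (sq u) i = sq u'.
  rewrite /upd; case: eqP => [->|/eqP iv]; first by exists u.
  by rewrite !inE iv /= => iQ; exact: FQ.
have spow u : sym2 (sq u) by exact: (symmetric_power hip he).
have [vS|vS] := boolP (v \in S).
  rewrite -(upd_id F v); apply: (L1bounded_density hip he (product_defect_slot sf sF vS)) => // u.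
  by apply: (IH (Q :\ v)%SET) => //; [exact: upd_sym|exact: sqv].
have := IH (Q :\ v)%SET lt (upd F v (sq 0)) (upd_sym v sF (spow 0)) (sqv 0) f sf.
rewrite (_ : product_defect _ _ _ _ _ _ = product_defect ip e I f F S) //.
have nD S' i : v \notin S' -> v \notin (S' :\ i)%SET by rewrite !inE negb_and => ->; rewrite orbT.
have nv i S' : v \notin S' -> i \in S' -> upd F v (sq 0) i = F i.
  by move=> vS' iS; rewrite /upd; case: eqP => // iv; rewrite -iv iS in vS'.
apply/funext => w; rewrite /product_defect !calS_notin //; congr (_ - (_ + _ * _ + _ * _ + _ * _)).
- by apply: eq_bigr => i iS; rewrite (nv _ S) // calS_notin // nD.
- by apply: eq_bigr => i iS; rewrite (nv _ S) // calS_notin // nD.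
- apply: eq_bigr => i iS; apply: eq_bigr => j jS.
  by rewrite (nv i S) // (nv j (S :\ i)%SET) ?nD // calS_notin // !nD.
Qed.

End ProductFormulaGeneral.

(** * Permuting the factors of a symmetric product *)

Section Symmetry.
Context (R : realType) (H : completeNormedModType R) (ip : {dot H for idfun}).
Hypothesis hip : forall x, ip x x = `|x| ^+ 2.
Variable e : nat -> H.
Hypothesis he : orthonormal_basis ip e.
Context (d : measure_display) (Omega : measurableType d) (P : probability Omega R).
Variable W : H -> {RV P >-> R}.
Hypothesis hW : isonormal ip W.
Variable I : forall n, form H n -> {RV P >-> R}.
Hypothesis hI : forall n, (0 < n)%N -> multiple_integral ip e W (@I n).
Implicit Types (f g p : form H 2) (l : seq (form H 2)) (X : Omega -> R).

Local Notation "X =a Y" := (aeq P X Y) (at level 70).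
Local Notation sq u := (@tensor_power R H ip u 2).
Local Notation sym2 := (@symmetric_tensor R H e 2).
Local Notation syms := (sym_tensors e).
Local Notation calI := (calI I).
Local Notation L1g := (L1bounded e P).
Local Notation L2g := (L2bounded e P).

(** For squares the integral is a Wick monomial indexed by a set of labels,
    so the order is immaterial. *)
Lemma calI_squares_perm (V : finType) (u : V -> H) (r1 r2 : seq V) :
  uniq r1 -> perm_eq r1 r2 ->
  calI [seq sq (u i) | i <- r1] =a calI [seq sq (u i) | i <- r2].
Proof.
move=> u1 p12; have u2 : uniq r2 by rewrite -(perm_uniq p12).
have [z0|r0] := boolP (nilp r1).
  move/nilP: z0 p12 => ->; rewrite perm_sym => /perm_nilP ->; exact: aeq_refl.
case: r1 r0 u1 p12 => // i0 r1 _ u1 p12.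
pose q (r : seq V) : seq ((V * bool) * (V * bool)) := [seq ((i, true), (i, false)) | i <- r].
have memq r z : (z \in flat (q r)) = (z.1 \in r).
  rewrite /flat /q -map_comp; apply/flattenP/idP => [[s /mapP[i iS ->]]|zr].
    by rewrite !inE => /orP[] /eqP ->.
  exists [:: (z.1, true); (z.1, false)]; first by apply/mapP; exists z.1.
  by case: z {zr} => i [] /=; rewrite !inE eqxx ?orbT.
have uq r : uniq r -> uniq (flat (q r)).
  elim: r => //= i r IH /andP[ir /IH ur].
  rewrite [uniq _]/= inE xpair_eqE andbF /= -[flatten _]/(flat (q r)) !memq /= ir /=.
  exact: ur.
have E r : [seq sq (u i) | i <- r] =
    [seq Sym (pure ip (pair2 (u z.1.1) (u z.2.1))) | z <- q r].
  by rewrite /q -map_comp; apply: eq_map => i /=; rewrite (sqE2 hip he).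
rewrite !E.
have h r : uniq r -> _ := fun ur => calI_pairs hip he hW hI (fun z : (V * bool)%type => u z.1) (i0, true) (uq r ur).
apply: aeq_trans (h _ u1) _; apply: aeq_trans _ (aeq_sym (h _ u2)).
apply: aeq_eq; apply/funext => w; congr gw; apply/finset.setP => z.
by rewrite [LHS]inE [RHS]inE !memq (perm_mem p12).
Qed.

(** Slots are freed one by one from the case of squares, by density. *)
Lemma calI_family_perm (V : finType) (F : V -> form H 2) (r1 r2 : seq V) :
  (forall i, sym2 (F i)) -> uniq r1 -> perm_eq r1 r2 ->
  calI [seq F i | i <- r1] =a calI [seq F i | i <- r2].
Proof.
move=> sF u1 p12; have u2 : uniq r2 by rewrite -(perm_uniq p12).
have slot (F' : V -> form H 2) v r : (forall i, sym2 (F' i)) -> uniq r -> v \in r ->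
    L2g (fun p => calI [seq upd F' v p i | i <- r]).
  move=> sF' ur vr; case/splitPr: vr ur => s1 s2; rewrite cat_uniq /=.
  case/and3P => _ /norP[n1 _] /andP[n2 _].
  have fr s p : v \notin s -> [seq upd F' v p i | i <- s] = [seq F' i | i <- s].
    move=> vs; apply/eq_in_map => i iS; rewrite /upd; case: eqP => // iv.
    by rewrite -iv iS in vs.
  have -> : (fun p => calI [seq upd F' v p i | i <- s1 ++ v :: s2]) =
      (fun p => calI ([seq F' i | i <- s1] ++ id p :: [seq F' i | i <- s2])).
    by apply/funext => p; rewrite map_cat /= !fr // /upd eqxx.
  by apply: (L2bounded_calI hI); [exact: sym_tensors_map|exact: sym_tensors_map|exact: bounded_map_id].
(* [Q] is the set of slots that need not contain squares *)
suff key (Q : {set V}) : forall F, (forall i, sym2 (F i)) ->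
    (forall i, i \notin Q -> exists u, F i = sq u) ->
    calI [seq F i | i <- r1] =a calI [seq F i | i <- r2].
  by apply: (key finset.setT) => // i; rewrite inE.
have [n] := ubnP #|Q|; elim: n => // n IH in Q * => Qn {}F {}sF FQ.
have [Q0|[v vQ]] := finset.set_0Vmem Q.
  have /choice[u uE] : forall i, exists u, F i = sq u by move=> i; apply: FQ; rewrite Q0 inE.
  by have -> : F = (fun i => sq (u i)) by [apply/funext]; exact: calI_squares_perm.
have lt : (#|(Q :\ v)%SET| < n)%N by move: Qn; rewrite (finset.cardsD1 v) vQ ltnS.
have IHv u : calI [seq upd F v (sq u) i | i <- r1] =a calI [seq upd F v (sq u) i | i <- r2].
  apply: (IH (Q :\ v)%SET) => //.
    by apply: upd_sym => //; exact: (symmetric_power hip he).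
  move=> i; rewrite /upd; case: eqP => [->|/eqP iv]; first by exists u.
  by rewrite !inE iv /= => iQ; exact: FQ.
have [vr|vr] := boolP (v \in r1); last first.
  have E r : v \notin r -> [seq F i | i <- r] = [seq upd F v (sq 0) i | i <- r].
    move=> vs; apply/eq_in_map => i iS; rewrite /upd; case: eqP => // iv.
    by rewrite -iv iS in vs.
  by rewrite !E // -(perm_mem p12).
have h1 := L2bounded_L1bounded (slot F v r1 sF u1 vr).
have h2 := L2bounded_L1bounded (slot F v r2 sF u2 (etrans (esym (perm_mem p12 v)) vr)).
have := L1bounded_density hip he (L1bounded_lin (-1) h2 h1) _ (sF v).
rewrite upd_id => h; apply: filterS (h _) => [w h0|u]; first by lra.
by apply: filterS (IHv u) => w ->; rewrite mulN1r addNr.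
Qed.

End Symmetry.

(** * Path tensors *)

Section Paths.
Context (R : realType) (H : completeNormedModType R) (ip : {dot H for idfun}).
Hypothesis hip : forall x, ip x x = `|x| ^+ 2.
Variable e : nat -> H.
Hypothesis he : orthonormal_basis ip e.
Variables (m : nat) (f : 'I_m -> form H 2).
Hypothesis hf : forall j, symmetric_tensor e (f j).
Implicit Types (s : seq 'I_m) (B : {set 'I_m}) (a : 'I_m).

Local Notation sym2 := (@symmetric_tensor R H e 2).
Local Notation A g := (HS_op ip e g).

Let hb j : bform (f j). Proof. exact: symmetric_bform (hf j). Qed.

Definition path_op s (y : H) : H := foldr (fun j x => A (f j) x) y s.

Definition path_star s : form H 2 :=
  if s is j :: s' then foldl (star ip e) (f j) [seq f i | i <- s'] else @zero_form R H.

Lemma path_tensorE s : path_tensor ip e f s = Sym (path_star s).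
Proof.
case: s => //=; apply/funext => h; rewrite Sym_id //.
Qed.

Lemma path_op_lin s b u v : path_op s (b *: u + v) = b *: path_op s u + path_op s v.
Proof. by elim: s => //= j s ->; rewrite (HS_op_lin hip he). Qed.

Lemma path_op_cat s t y : path_op (s ++ t) y = path_op s (path_op t y).
Proof. by rewrite /path_op foldr_cat. Qed.

Lemma HS_op_selfadjoint g x y : sym2 g -> ip x (A g y) = ip (A g x) y.
Proof.
move=> sg; have bg := symmetric_bform sg.
rewrite (ipC ip (A _ x)) !(ip_HS_op hip he) //; case: sg => _ gs.
exact: (sym_pair y x gs).
Qed.

(** The operators of symmetric tensors are self-adjoint, so that taking the
    adjoint reverses the path. *)
Lemma path_op_adjoint s x y : ip x (path_op s y) = ip (path_op (rev s) x) y.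
Proof.
elim: s x => //= j s IH x; rewrite HS_op_selfadjoint // IH rev_cons -cats1.
by rewrite path_op_cat.
Qed.

Lemma path_star_tensor s : tensor e (path_star s).
Proof.
case: s => [|j s] /=; first exact: (symmetric_zero hip he).1.
elim: s (f j) (hf j).1 => //= i s IH g tg; apply: IH.
by apply: (tensor_star hip he) => //; exact: (hf i).1.
Qed.

(** Star products of tensors are compositions of operators. *)
Lemma path_star_pair s x y : s <> [::] -> path_star s (pair2 x y) = ip x (path_op s y).
Proof.
case: s => // j s _ /=; rewrite (ip_HS_op hip he) //.
elim: s (f j) (hf j).1 => //= i s IH g tg.
have ti := (hf i).1; rewrite IH; last exact: (tensor_star hip he).
by rewrite (star_pair hip he x _ (tensor_bform tg) (tensor_bform ti)).
Qed.

Lemma symmetric_path s : sym2 (path_tensor ip e f s).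
Proof. by rewrite path_tensorE; apply: symmetric_Sym; exact: path_star_tensor. Qed.

(** Symmetrisation averages a path and its reversal. *)
Lemma path_tensor_pair s x y : s <> [::] ->
  path_tensor ip e f s (pair2 x y) = 2^-1 * (ip x (path_op s y) + ip x (path_op (rev s) y)).
Proof.
move=> s0; rewrite path_tensorE Sym2_pair !path_star_pair //.
by rewrite [in ip y _]path_op_adjoint (ipC ip _ x).
Qed.

Lemma path_tensor_rev s : path_tensor ip e f (rev s) = path_tensor ip e f s.
Proof.
have [->//|s0] : s = [::] \/ s <> [::] by case: s; [left|right].
apply: form2_ext => x y; rewrite !path_tensor_pair ?revK 1?addrC //.
by move/(congr1 size); rewrite size_rev => /size0nil.
Qed.

(** The weight is 2 to the number of non-isolated vertices of the path,
    halved because an ordering and its reversal describe the same path; a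
    one-vertex path has weight 1. *)
Definition block_tensor B : form H 2 :=
  fun h => \sum_(s <- ords B) 2 ^+ #|B|.-1 * path_tensor ip e f s h.

Lemma symmetric_block B : sym2 (block_tensor B).
Proof.
rewrite /block_tensor; elim: (ords B) => [|s r IH].
  under eq_fun do rewrite big_nil; exact: (symmetric_zero hip he).
under eq_fun do rewrite big_cons.
exact: (symmetric_lin (2 ^+ #|B|.-1) (symmetric_path s) IH).
Qed.

Lemma block_tensor0 : block_tensor finset.set0 = @zero_form R H.
Proof.
by apply/funext => h; rewrite /block_tensor ords0 big_seq1 /= mulr0.
Qed.

Let block_bform B : bform (block_tensor B).
Proof. exact: symmetric_bform (symmetric_block B). Qed.

(** Operators instead of forms: the empty ordering gives the identity
    operator, whereas no tensor of order two represents it; the term with [B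
    == set0] in the comparison below accounts for that. *)
Definition full_op B (y : H) : H := \sum_(s <- ords B) path_op s y.

Lemma ip_block B x y : 2 * ip x (A (block_tensor B) y) + (B == finset.set0)%:R * ip x y =
  2 ^+ #|B| * ip x (full_op B y).
Proof.
rewrite (ip_HS_op hip he) // /block_tensor /full_op (ip_sumr ip).
have [->|B0] := eqVneq B finset.set0.
  by rewrite ords0 !big_seq1 /= mulr0 finset.cards0 expr0 mulr0 add0r.
rewrite mul0r addr0 -mulr_sumr -[#|B|]prednK ?finset.card_gt0 // exprS -!mulrA.
congr (2 * (_ * _)).
transitivity (\sum_(s <- ords B) 2^-1 * (ip x (path_op s y) + ip x (path_op (rev s) y))).
  rewrite big_seq [RHS]big_seq; apply: eq_bigr => s sB.
  by rewrite path_tensor_pair //; exact: ords_neq0 sB.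
rewrite -mulr_sumr big_split /=.
rewrite (sum_ords_rev B (fun s => ip x (path_op s y))).
by field.
Qed.

Lemma block_op B y :
  2 ^+ #|B| *: full_op B y = 2 *: A (block_tensor B) y + (B == finset.set0)%:R *: y.
Proof. by apply: (ip_ext hip) => x; rewrite (ipDr ip) !(ipZr ip) ip_block. Qed.

Lemma full_op_lin B b u v : full_op B (b *: u + v) = b *: full_op B u + full_op B v.
Proof.
rewrite /full_op scaler_sumr -big_split /=; apply: eq_bigr => s _; exact: path_op_lin.
Qed.

(** An ordering of [a |: B] is an ordering of a subset [C], followed by [a],
    followed by an ordering of [B :\: C], and the operator of a path is the
    composition of those of its parts. *)
Lemma block_setU1_pair a B x y : a \notin B ->
  block_tensor (a |: B)%SET (pair2 x y) =
  \sum_(C : {set 'I_m} | C \subset B) ip x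
     (2 *: A (block_tensor C) (A (f a) (2 *: A (block_tensor (B :\: C)) y
        + ((B :\: C)%SET == finset.set0)%:R *: y))
      + (C == finset.set0)%:R *: (A (f a) (2 *: A (block_tensor (B :\: C)) y
        + ((B :\: C)%SET == finset.set0)%:R *: y))).
Proof.
move=> aB; have aB0 : (a |: B)%SET != finset.set0 by apply/finset.set0Pn; exists a; rewrite finset.setU11.
transitivity (2 ^+ #|B| * ip x (full_op (a |: B)%SET y)).
  have := ip_block (a |: B)%SET x y; rewrite (negPf aB0) mul0r addr0 (ip_HS_op hip he) //.
  rewrite finset.cardsU1 aB add1n exprS -mulrA => E.
  by apply: (mulfI (_ : (2 : R) != 0)); [rewrite pnatr_eq0|exact: E].
rewrite /full_op sum_ords_setU1 // (ip_sumr ip) mulr_sumr; apply: eq_bigr => C CB.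
rewrite -[in RHS]block_op -block_op (ipZr ip).
have -> : A (f a) (2 ^+ #|(B :\: C)%SET| *: full_op (B :\: C)%SET y) =
    2 ^+ #|(B :\: C)%SET| *: A (f a) (full_op (B :\: C)%SET y) + 0.
  have := HS_op_lin hip he (hb a) (2 ^+ #|(B :\: C)%SET|) (full_op (B :\: C)%SET y) 0.
  have A0 : A (f a) 0 = 0.
    by have := HS_op_lin hip he (hb a) (-1) 0 0; rewrite scaler0 addr0 scaleN1r addNr.
  by rewrite A0 !addr0.
have F0 : full_op C 0 = 0.
  by have := full_op_lin C (-1) 0 0; rewrite scaler0 addr0 scaleN1r addNr.
rewrite full_op_lin F0 addr0 (ipZr ip) mulrA -exprD.
have -> : (#|C| + #|(B :\: C)%SET|)%N = #|B|.
  by rewrite -(finset.cardsID C B) (finset.setIidPr CB).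
congr (_ * _); rewrite /full_op !(ip_sumr ip); apply: eq_bigr => s _.
rewrite (ip_sumr ip).
(* the operator of a path through [a] factors at [a] *)
have AS (r : seq (seq 'I_m)) : A (f a) (\sum_(t <- r) path_op t y) = \sum_(t <- r) A (f a) (path_op t y).
  elim: r => [|t r IH].
    by rewrite !big_nil; have := HS_op_lin hip he (hb a) (-1) 0 0; rewrite scaler0 addr0 scaleN1r addNr.
  by rewrite !big_cons -IH; have := HS_op_lin hip he (hb a) 1 (path_op t y) (\sum_(t <- r) path_op t y);
    rewrite !scale1r.
rewrite AS; elim: (ords _) => [|t r IH].
  rewrite !big_nil; have := path_op_lin s (-1) 0 0; rewrite scaler0 addr0 scaleN1r addNr => ->.
  by rewrite (ip0r ip).
rewrite !big_cons IH; have := path_op_lin s 1 (A (f a) (path_op t y)) (\sum_(t <- r) A (f a) (path_op t y)).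
by rewrite !scale1r => ->; rewrite (ipDr ip) path_op_cat.
Qed.

Lemma Sym_star_pair (g k : form H 2) x y : bform g -> bform k ->
  Sym (star ip e g k) (pair2 x y) = 2^-1 * (ip x (A g (A k y)) + ip y (A g (A k x))).
Proof.
move=> bg bk; apply: (etrans (Sym2_pair _ _ _)).
have E u v : star ip e g k (pair2 u v) = ip u (A g (A k v)).
  apply: (etrans (star_pair hip he u v bg bk)).
  exact: esym (ip_HS_op hip he u (A k v) bg).
by rewrite (E x y) (E y x).
Qed.

(** The place of [a] in a path through [a |: B]: alone, at an end, or
    between two paths. These are the contractions of [f a] with no block,
    with one block and with two different blocks in the product formula. *)
Lemma block_setU1 a B : a \notin B ->
  block_tensor (a |: B)%SET = fun h => (B == finset.set0)%:R * f a h
    + 4 * Sym (star ip e (f a) (block_tensor B)) h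
    + \sum_(C : {set 'I_m} | C \subset B)
        4 * Sym (star ip e (block_tensor C) (star ip e (f a) (block_tensor (B :\: C)))) h.
Proof.
move=> aB; apply: form2_ext => x y; rewrite block_setU1_pair //.
pose T C D := ip x (A (block_tensor C) (A (f a) (A (block_tensor D) y))).
have Alin g b u v : sym2 g -> A g (b *: u + v) = b *: A g u + A g v.
  by move=> sg; apply: (HS_op_lin hip he); exact: (symmetric_bform sg).
have A0 g : sym2 g -> A g 0 = 0.
  by move=> sg; have := Alin g (-1) 0 0 sg; rewrite scaler0 addr0 scaleN1r addNr.
have AZ g b u : sym2 g -> A g (b *: u) = b *: A g u.
  by move=> sg; have := Alin g b u 0 sg; rewrite A0 // !addr0.
have A2 g b c u v : sym2 g -> A g (b *: u + c *: v) = b *: A g u + c *: A g v.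
  by move=> sg; rewrite Alin // AZ.
have sb := symmetric_block.
transitivity (\sum_(C : {set 'I_m} | C \subset B) (4 * T C (B :\: C)%SET +
   (C == B)%:R * (2 * ip x (A (block_tensor C) (A (f a) y))) +
   (C == finset.set0)%:R * (2 * ip x (A (f a) (A (block_tensor (B :\: C)%SET) y))) +
   (C == finset.set0)%:R * ((C == B)%:R * ip x (A (f a) y)))).
  apply: eq_bigr => C CB; rewrite finset.setD_eq0.
  have -> : (B \subset C) = (C == B) by rewrite finset.eqEsubset CB.
  rewrite (A2 (f a)) // (A2 (block_tensor C)) // /T.
  move: (A (block_tensor C) (A (f a) (A _ y))) => p.
  move: (A (block_tensor C) (A (f a) y)) => q; move: (A (f a) (A _ y)) => r.
  move: (A (f a) y) => s.
  by rewrite (ipDr ip) !(ipZr ip) !(ipDr ip) !(ipZr ip); ring.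
have delta (D : {set 'I_m}) (g : {set 'I_m} -> R) : D \subset B ->
    \sum_(C : {set 'I_m} | C \subset B) (C == D)%:R * g C = g D.
  move=> DB; rewrite (bigD1 D) //= eqxx mul1r big1 ?addr0 // => C /andP[_ /negPf ->].
  by rewrite mul0r.
have s0B := finset.sub0set B.
have spl (t1 t2 t3 t4 : {set 'I_m} -> R) :
    \sum_(C : {set 'I_m} | C \subset B) (t1 C + t2 C + t3 C + t4 C) =
    \sum_(C : {set 'I_m} | C \subset B) t1 C + \sum_(C : {set 'I_m} | C \subset B) t2 C
    + \sum_(C : {set 'I_m} | C \subset B) t3 C + \sum_(C : {set 'I_m} | C \subset B) t4 C.
  by rewrite !big_split.
rewrite (spl (fun C => 4 * T C (B :\: C)%SET)
   (fun C => (C == B)%:R * (2 * ip x (A (block_tensor C) (A (f a) y))))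
   (fun C => (C == finset.set0)%:R * (2 * ip x (A (f a) (A (block_tensor (B :\: C)%SET) y))))
   (fun C => (C == finset.set0)%:R * ((C == B)%:R * ip x (A (f a) y)))).
transitivity (\sum_(C : {set 'I_m} | C \subset B) 4 * T C (B :\: C)%SET
   + 2 * ip x (A (block_tensor B) (A (f a) y))
   + 2 * ip x (A (f a) (A (block_tensor B) y))
   + (B == finset.set0)%:R * ip x (A (f a) y)).
  congr (_ + _ + _ + _).
  - exact: (delta B (fun C => 2 * ip x (A (block_tensor C) (A (f a) y))) (fintype.subxx B)).
  - have := delta _ (fun C => 2 * ip x (A (f a) (A (block_tensor (B :\: C)%SET) y))) s0B.
    by rewrite finset.setD0.
  - have := delta _ (fun C => (C == B)%:R * ip x (A (f a) y)) s0B.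
    by rewrite eq_sym.
have selfadj C u v : ip u (A (block_tensor C) v) = ip (A (block_tensor C) u) v.
  exact: HS_op_selfadjoint.
have sa u v : ip u (A (f a) v) = ip (A (f a) u) v by exact: HS_op_selfadjoint.
have half (z u v w : R) : z = 2^-1 * (u + w) -> w = v -> 4 * z = 2 * u + 2 * v.
  by move=> -> ->; field.
have Sb : 4 * Sym (star ip e (f a) (block_tensor B)) (pair2 x y) =
    2 * ip x (A (f a) (A (block_tensor B) y)) + 2 * ip x (A (block_tensor B) (A (f a) y)).
  apply: (half _ _ _ _ (Sym_star_pair x y (hb a) (block_bform B))).
  apply: (etrans (sa y (A (block_tensor B) x))).
  apply: (etrans (selfadj B (A (f a) y) x)); exact: ipC.
have Sc C : 4 * Sym (star ip e (block_tensor C) (star ip e (f a) (block_tensor (B :\: C)%SET))) (pair2 x y) =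
    2 * T C (B :\: C)%SET + 2 * T (B :\: C)%SET C.
  have bD := block_bform (B :\: C)%SET.
  have bs := bform_star hip he (hb a) bD.
  have Ex := HS_op_star hip he x (hb a) bD; have Ey := HS_op_star hip he y (hb a) bD.
  have E := Sym_star_pair x y (block_bform C) bs.
  apply: (half _ _ _ _ (etrans E _)); last reflexivity.
  apply: (congr1 (fun t => 2^-1 * t)); apply: f_equal2.
    exact: (congr1 (fun t => ip x (A (block_tensor C) t)) Ey).
  apply: (etrans (congr1 (fun t => ip y (A (block_tensor C) t)) Ex)).
  apply: (etrans (selfadj C y _)); apply: (etrans (sa (A (block_tensor C) y) _)).
  apply: (etrans (selfadj (B :\: C)%SET _ x)); exact: ipC.
have Tc : \sum_(C : {set 'I_m} | C \subset B) 2 * T (B :\: C)%SET C =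
    \sum_(C : {set 'I_m} | C \subset B) 2 * T C (B :\: C)%SET.
  exact: (sum_subset_compl B (fun C D => 2 * T C D)).
have T4 : \sum_(C : {set 'I_m} | C \subset B) 4 * T C (B :\: C)%SET =
    \sum_(C : {set 'I_m} | C \subset B) 2 * T C (B :\: C)%SET +
    \sum_(C : {set 'I_m} | C \subset B) 2 * T C (B :\: C)%SET.
  rewrite -big_split; apply: eq_bigr => C _ /=; move: (T _ _) => u; ring.
transitivity ((B == finset.set0)%:R * ip x (A (f a) y)
   + (2 * ip x (A (f a) (A (block_tensor B) y)) + 2 * ip x (A (block_tensor B) (A (f a) y)))
   + (\sum_(C : {set 'I_m} | C \subset B) 2 * T C (B :\: C)%SET
      + \sum_(C : {set 'I_m} | C \subset B) 2 * T (B :\: C)%SET C)).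
  have gen (S1 S2 S4 p q w : R) : S4 = S1 + S1 -> S2 = S1 ->
      S4 + p + q + w = w + (q + p) + (S1 + S2) by move=> -> ->; ring.
  exact: (gen _ _ _ _ _ _ T4 Tc).
apply: f_equal2; first (apply: f_equal2; last exact: esym Sb).
  exact: (congr1 (fun t => (B == finset.set0)%:R * t) (ip_HS_op hip he x y (hb a))).
rewrite -big_split; apply: eq_bigr => C _; exact: esym (Sc C).
Qed.

End Paths.

(** * Adjoining a variable to a sum over set partitions *)

Section BlockProduct.
Context (R : realType) (H : completeNormedModType R) (ip : {dot H for idfun}).
Hypothesis hip : forall x, ip x x = `|x| ^+ 2.
Variable e : nat -> H.
Hypothesis he : orthonormal_basis ip e.
Context (d : measure_display) (Omega : measurableType d) (P : probability Omega R).
Variable W : H -> {RV P >-> R}.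
Hypothesis hW : isonormal ip W.
Variable I : forall n, form H n -> {RV P >-> R}.
Hypothesis hI : forall n, (0 < n)%N -> multiple_integral ip e W (@I n).
Variables (m : nat) (f : 'I_m -> form H 2).
Hypothesis hf : forall j, symmetric_tensor e (f j).
Implicit Types (B C J : {set 'I_m}) (pi : {set {set 'I_m}}) (a : 'I_m).

Local Notation "X =a Y" := (aeq P X Y) (at level 70).
Local Notation sym2 := (@symmetric_tensor R H e 2).
Local Notation syms := (sym_tensors e).
Local Notation calI := (calI I).
Local Notation calS := (calS I).
Local Notation Bt := (block_tensor ip e f).
Local Notation part := finset.partition.

Let sB B : sym2 (Bt B). Proof. exact: symmetric_block. Qed.

Definition ae_linear (D : form H 2 -> Omega -> R) : Prop :=
  forall c g h, sym2 g -> sym2 h -> D (lin c g h) =a (fun w => c * D g w + D h w).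

Lemma ae_linear0 D : ae_linear D -> D (@zero_form R H) =a (fun=> 0).
Proof.
move=> Dl; have s0 := symmetric_zero hip he.
have := Dl (-1) _ _ s0 s0; have -> : lin (-1) (@zero_form R H) (@zero_form R H) = @zero_form R H.
  by apply/funext => h; rewrite /lin /zero_form mulr0 addr0.
by apply: filterS => w ->; rewrite mulN1r addNr.
Qed.

(** The tensor [h] carries the terms that come without a common coefficient. *)
Lemma ae_linear_sum D (K : Type) (r : seq K) (Q : pred K) (c : R) (g : K -> form H 2) h :
  ae_linear D -> (forall k, sym2 (g k)) -> sym2 h ->
  sym2 (fun x => h x + \sum_(k <- r | Q k) c * g k x) /\
  D (fun x => h x + \sum_(k <- r | Q k) c * g k x) =a
  (fun w => D h w + \sum_(k <- r | Q k) c * D (g k) w).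
Proof.
move=> Dl sg sh; elim: r => [|k r [s IH]].
  have -> : (fun x => h x + \sum_(k <- [::] | Q k) c * g k x) = h.
    by apply/funext => x; rewrite big_nil addr0.
  by split=> //; apply: aeq_eq; apply/funext => w; rewrite big_nil addr0.
have [Qk|Qk] := boolP (Q k); last first.
  under eq_fun do rewrite big_cons (negPf Qk); split=> //.
  by apply: aeq_trans IH _; apply: aeq_eq; apply/funext => w; rewrite big_cons (negPf Qk).
have -> : (fun x => h x + \sum_(k <- k :: r | Q k) c * g k x) =
    lin c (g k) (fun x => h x + \sum_(k <- r | Q k) c * g k x).
  by apply/funext => x; rewrite /lin big_cons Qk addrCA.
split; first exact: symmetric_lin.
apply: aeq_trans (Dl _ _ _ (sg k) s) _; apply: filterS IH => w ->.
by rewrite big_cons Qk addrCA.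
Qed.

(** The linear functional met whenever one tensor, a block containing [a] or
    a contraction, is singled out. *)
Definition headI J g (w : Omega) : R :=
  \sum_(pi : {set {set 'I_m}} | part pi J) calS [:: g] Bt pi w.

Definition blockI J (w : Omega) : R :=
  \sum_(pi : {set {set 'I_m}} | part pi J) calS [::] Bt pi w.

Lemma headI_linear J : ae_linear (headI J).
Proof.
move=> c g h sg sh; rewrite /headI.
apply: aeq_trans.
  apply: aeq_sum => pi _.
  have st := sym_tensors_map (enum pi) sB.
  exact: (calI_lin hI (l1 := [::]) c Logic.I st sg sh).
by apply: aeq_eq; apply/funext => w; rewrite big_split mulr_sumr.
Qed.

Lemma calS_block B pi : B \notin pi ->
  calS [::] Bt (B |: pi)%SET =a calS [:: Bt B] Bt pi.
Proof.
move=> Bpi; apply: (calI_family_perm hip he hW hI (r2 := B :: enum pi)) => //.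
  exact: enum_uniq.
apply: uniq_perm; rewrite /= ?enum_uniq ?mem_enum ?Bpi // => C.
by rewrite mem_enum !inE mem_enum.
Qed.

Lemma blockI_setU1 a J : a \notin J ->
  blockI (a |: J)%SET =a
  (fun w => \sum_(B : {set 'I_m} | B \subset J) headI (J :\: B)%SET (Bt (a |: B)%SET) w).
Proof.
move=> aJ; rewrite /blockI.
under eq_fun do rewrite (sum_partition_at (fun pi => calS [::] Bt pi _) aJ).
apply: aeq_sum => B BJ; apply: aeq_sum => pi piA; apply: calS_block.
apply/negP => /(finset.partitionS piA)/fintype.subsetP/(_ a).
by rewrite !inE eqxx /= (negPf aJ) andbF => /(_ isT).
Qed.

Section Step.
Variables (a : 'I_m) (J : {set 'I_m}).
Hypothesis aJ : a \notin J.

Let tail g : form H 2 := Sym (star ip e (f a) g).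
Let mid g h : form H 2 := Sym (star ip e g (star ip e (f a) h)).

Let s_tail g : sym2 g -> sym2 (tail g).
Proof. by move=> sg; apply: (symmetric_symstar hip he) => //; exact: (hf a). Qed.

Let s_mid g h : sym2 g -> sym2 h -> sym2 (mid g h).
Proof. by move=> sg sh; apply: (symmetric_star3 hip he) => //. Qed.

Let s_tail4 B : sym2 (lin 4 (tail (Bt B)) (@zero_form R H)).
Proof. by apply: symmetric_lin; [exact: s_tail|exact: symmetric_zero]. Qed.

(** The place of [a] in a path, read inside the integrals. *)
Lemma headI_block B : B \subset J ->
  headI (J :\: B)%SET (Bt (a |: B)%SET) =a
  (fun w => (B == finset.set0)%:R * headI (J :\: B)%SET (f a) w
    + (4 * headI (J :\: B)%SET (tail (Bt B)) w
    + \sum_(C : {set 'I_m} | C \subset B) 4 * headI (J :\: B)%SET (mid (Bt C) (Bt (B :\: C)%SET)) w)).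
Proof.
move=> BJ; have aB : a \notin B by apply: contra aJ; exact: (fintype.subsetP BJ).
have Dl := headI_linear (J :\: B)%SET.
have sm C : sym2 (mid (Bt C) (Bt (B :\: C)%SET)) by exact: s_mid.
have [s1 E1] := ae_linear_sum (index_enum {set 'I_m}) (fun C => C \subset B) 4 Dl sm (s_tail4 B).
rewrite (block_setU1 hip he hf aB).
rewrite (_ : (fun h => _) = lin (B == finset.set0)%:R (f a)
   (fun x => lin 4 (tail (Bt B)) (@zero_form R H) x + \sum_(C : {set 'I_m} | C \subset B)
        4 * mid (Bt C) (Bt (B :\: C)%SET) x)); last first.
  by apply/funext => x; rewrite /lin /zero_form addr0 addrA.
apply: aeq_trans (Dl _ _ _ (hf a) s1) _; apply: aeq_lin; first exact: aeq_refl.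
apply: aeq_trans E1 _; apply: aeq_add; last exact: aeq_refl.
apply: aeq_trans (Dl _ _ _ (s_tail (sB B)) (symmetric_zero hip he)) _.
by apply: filterS (ae_linear0 Dl) => w ->; rewrite addr0.
Qed.

Lemma bounded_map0 (phi : form H 2 -> form H 2) : bounded_map e phi ->
  phi (@zero_form R H) = @zero_form R H.
Proof.
have s0 := symmetric_zero hip he; move=> [_ pl _].
have z : lin (-1) (@zero_form R H) (@zero_form R H) = @zero_form R H.
  by apply/funext => h; rewrite /lin /zero_form mulr0 addr0.
by rewrite -[in LHS]z pl //; apply/funext => h; rewrite /lin mulN1r addNr.
Qed.

Let tail0 : tail (Bt finset.set0) = @zero_form R H.
Proof.
rewrite block_tensor0; have [g _ _ _ _] := bounded_map_star hip he (hf a) (hf a).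
exact: bounded_map0 g.
Qed.

Let midl0 B : mid (Bt finset.set0) (Bt B) = @zero_form R H.
Proof.
rewrite block_tensor0; have [_ _ _ _ g] := bounded_map_star hip he (hf a) (sB B).
exact: bounded_map0 g.
Qed.

Let midr0 B : mid (Bt B) (Bt finset.set0) = @zero_form R H.
Proof.
rewrite block_tensor0; have [_ _ g _ _] := bounded_map_star hip he (sB B) (hf a).
exact: bounded_map0 g.
Qed.

Let tr20 : tr2 ip e (f a) (Bt finset.set0) = 0.
Proof. by rewrite block_tensor0; exact: (tr2_zeror hip he (hf a).1). Qed.

Let headI0 J' : headI J' (@zero_form R H) =a (fun=> 0).
Proof. exact: ae_linear0 (headI_linear J'). Qed.

(** Empty blocks have zero tensors, and may be included in the sums over
    blocks. *)
Lemma nonempty_sum (K : {set 'I_m}) (h : {set 'I_m} -> Omega -> R) : h finset.set0 =a (fun=> 0) ->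
  (fun w => \sum_(B : {set 'I_m} | (B != finset.set0) && (B \subset K)) h B w) =a
  (fun w => \sum_(B : {set 'I_m} | B \subset K) h B w).
Proof.
apply: filterS => w h0; rewrite [RHS](bigD1 finset.set0) /= ?finset.sub0set //.
rewrite h0 add0r; apply: eq_bigl => B; exact: andbC.
Qed.

(** The contractions of [f a] with the blocks of a partition of [J] are what is
    needed to insert [a] at all places of all blocks. *)
Lemma I2_blockI : (fun w => @I 2 (f a) w * blockI J w) =a
  (fun w => blockI (a |: J)%SET w +
     \sum_(B : {set 'I_m} | B \subset J) 2 * tr2 ip e (f a) (Bt B) * blockI (J :\: B)%SET w).
Proof.
pose T1 w := headI J (f a) w.
pose h2 B w := headI (J :\: B)%SET (tail (Bt B)) w.
pose h3 B w := tr2 ip e (f a) (Bt B) * blockI (J :\: B)%SET w.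
pose h4 C D w := headI (J :\: C :\: D)%SET (mid (Bt C) (Bt D)) w.
pose sumne (K : {set 'I_m}) (h : {set 'I_m} -> Omega -> R) w :=
  \sum_(B : {set 'I_m} | (B != finset.set0) && (B \subset K)) h B w.
pose sumall (K : {set 'I_m}) (h : {set 'I_m} -> Omega -> R) w :=
  \sum_(B : {set 'I_m} | B \subset K) h B w.
have PF : (fun w => @I 2 (f a) w * blockI J w) =a (fun w => T1 w + 4 * sumne J h2 w +
    2 * sumne J h3 w + 4 * sumne J (fun C => sumne (J :\: C)%SET (h4 C)) w).
  have := @aeq_sum _ _ _ P _ (index_enum {set {set 'I_m}}) (fun pi => part pi J) _ _
     (fun pi _ => product_formula hip he hW hI pi (hf a) sB).
  apply: filterS => w; rewrite big1_eq => E.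
  have {E} : @I 2 (f a) w * blockI J w - (T1 w +
     4 * (\sum_(pi | part pi J) \sum_(B in pi) calS [:: tail (Bt B)] Bt (pi :\ B)%SET w) +
     2 * (\sum_(pi | part pi J) \sum_(B in pi) tr2 ip e (f a) (Bt B) * calS [::] Bt (pi :\ B)%SET w) +
     4 * (\sum_(pi | part pi J) \sum_(C in pi) \sum_(D in (pi :\ C)%SET)
         calS [:: mid (Bt C) (Bt D)] Bt (pi :\ C :\ D)%SET w)) = 0.
    apply: etrans E; rewrite /blockI /T1 /headI /product_defect sumrB !big_split -!mulr_sumr mulr_sumr; reflexivity.
  move/subr0_eq => ->; congr (_ + 4 * _ + 2 * _ + 4 * _).
  - exact: (sum_partition_block J (fun B pi => calS [:: tail (Bt B)] Bt pi w)).
  - rewrite (sum_partition_block J (fun B pi => tr2 ip e (f a) (Bt B) * calS [::] Bt pi w)).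
    by apply: eq_bigr => B _; rewrite /h3 /blockI mulr_sumr.
  - rewrite (sum_partition_block J (fun C pi => \sum_(D in pi) calS [:: mid (Bt C) (Bt D)] Bt (pi :\ D)%SET w)).
    apply: eq_bigr => C _.
    exact: (sum_partition_block (J :\: C)%SET (fun D pi => calS [:: mid (Bt C) (Bt D)] Bt pi w)).
have N2 : sumne J h2 =a sumall J h2 by apply: nonempty_sum; rewrite /h2 tail0.
have N3 : sumne J h3 =a sumall J h3.
  by apply: nonempty_sum; apply: aeq_eq; apply/funext => w; rewrite /h3 tr20 mul0r.
have N4 : sumne J (fun C => sumne (J :\: C)%SET (h4 C)) =a sumall J (fun C => sumall (J :\: C)%SET (h4 C)).
  apply: (aeq_trans (Y := sumne J (fun C => sumall (J :\: C)%SET (h4 C)))).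
    by apply: aeq_sum => C _; apply: nonempty_sum; rewrite /h4 midr0.
  apply: nonempty_sum.
  apply: (aeq_trans (Y := fun w => \sum_(D : {set 'I_m} | D \subset (J :\: finset.set0)%SET) 0)).
    by apply: aeq_sum => D _; rewrite /h4 midl0.
  by apply: aeq_eq; apply/funext => w; rewrite big1.
have BE : blockI (a |: J)%SET =a
   (fun w => T1 w + (4 * sumall J h2 w + 4 * sumall J (fun C => sumall (J :\: C)%SET (h4 C)) w)).
  apply: aeq_trans (blockI_setU1 aJ) _.
  apply: aeq_trans; first by apply: aeq_sum => B BJ; exact: headI_block BJ.
  apply: aeq_eq; apply/funext => w; rewrite 2!big_split /=; congr (_ + (_ + _)).
  - rewrite (bigD1 finset.set0) ?finset.sub0set //= eqxx mul1r finset.setD0 big1 ?addr0 //.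
    by move=> B /andP[_ /negPf ->]; rewrite mul0r.
  - by rewrite -mulr_sumr.
  - rewrite /sumall -(sum_subset_subset J (fun C D => h4 C D w)) mulr_sumr.
    apply: eq_bigr => B BJ; rewrite -mulr_sumr; congr (_ * _); apply: eq_bigr => C CB.
    rewrite /h4 finset.setDDl; congr (headI (_ :\: _)%SET _ w).
    by rewrite finset.setDE finset.setUIr finset.setUCr finset.setIT (finset.setUidPr CB).
apply: aeq_trans PF _.
apply: (aeq_trans (Y := fun w => T1 w + 4 * sumall J h2 w + 2 * sumall J h3 w
   + 4 * sumall J (fun C => sumall (J :\: C)%SET (h4 C)) w)).
  apply: aeq_add; last exact: aeq_scale N4.
  apply: aeq_add; last exact: aeq_scale N3.
  apply: aeq_add; [exact: aeq_refl|exact: aeq_scale N2].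
apply: filterS BE => w ->.
have -> : \sum_(B : {set 'I_m} | B \subset J) 2 * tr2 ip e (f a) (Bt B) * blockI (J :\: B)%SET w =
    2 * sumall J h3 w by rewrite mulr_sumr; apply: eq_bigr => B _; rewrite mulrA.
by move: (T1 w) (sumall J h2 w) (sumall _ _ w) (sumall _ _ w) => u v x y; ring.
Qed.

End Step.
End BlockProduct.

(** * Joint cumulants and Wick products *)

Section Combinations.
Context (R : realType) (d : measure_display) (Omega : measurableType d) (P : probability Omega R).
Variables (K : Type) (r : seq K) (Q : pred K) (c : K -> R) (X : K -> Omega -> R).

Lemma E1_comb : (forall k, Q k -> L1 P (X k)) ->
  L1 P (fun w => \sum_(k <- r | Q k) c k * X k w) /\
  E1 P (fun w => \sum_(k <- r | Q k) c k * X k w) = \sum_(k <- r | Q k) c k * E1 P (X k).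
Proof.
move=> hX; elim: r => [|k s [IH1 IH2]].
  under eq_fun do rewrite big_nil; rewrite big_nil; split; [exact: L1_cst|exact: E1_cst].
case Qk: (Q k); rewrite big_cons Qk; under eq_fun do rewrite big_cons Qk; last by [].
by split; [apply: L1_lin => //; exact: hX|rewrite E1_lin ?IH2 //; exact: hX].
Qed.

Lemma L2_comb : (forall k, Q k -> L2 P (X k)) -> L2 P (fun w => \sum_(k <- r | Q k) c k * X k w).
Proof.
move=> hX; elim: r => [|k s IH]; first by under eq_fun do rewrite big_nil; exact: L2_cst.
case Qk: (Q k); under eq_fun do rewrite big_cons Qk; last by [].
by apply: L2_lin => //; exact: hX.
Qed.

End Combinations.

(** The top term is isolated with coefficient [M set0]. *)
Lemma conv_cancel (R : comPzRingType) (V : finType) (M F G : {set V} -> R) (A : {set V}) :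
  M finset.set0 = 1 ->
  (forall B : {set V}, B \subset A -> B != A -> F B = G B) -> conv F M A = conv G M A -> F A = G A.
Proof.
move=> M0 FG; rewrite /conv (bigD1 A) //= [RHS](bigD1 A) //= finset.setDv M0 !mulr1.
rewrite (eq_bigr (fun B => G B * M (A :\: B)%SET)) => [/addIr //|B /andP[BA nBA]].
by rewrite FG.
Qed.

Section Moments.
Context (R : realType) (H : completeNormedModType R) (ip : {dot H for idfun}).
Hypothesis hip : forall x, ip x x = `|x| ^+ 2.
Variable e : nat -> H.
Hypothesis he : orthonormal_basis ip e.
Context (d : measure_display) (Omega : measurableType d) (P : probability Omega R).
Variable W : H -> {RV P >-> R}.
Hypothesis hW : isonormal ip W.
Variable I : forall n, form H n -> {RV P >-> R}.
Hypothesis hI : forall n, (0 < n)%N -> multiple_integral ip e W (@I n).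
Variables (m : nat) (f : 'I_m -> form H 2).
Hypothesis hf : forall j, symmetric_tensor e (f j).
Implicit Types (A B C J : {set 'I_m}) (pi : {set {set 'I_m}}) (a : 'I_m).

Local Notation "X =a Y" := (aeq P X Y) (at level 70).
Local Notation Bt := (block_tensor ip e f).
Local Notation blockI := (blockI ip e I f).
Local Notation part := finset.partition.

Let sB B : symmetric_tensor e (Bt B). Proof. exact: symmetric_block. Qed.
Let Y j : Omega -> R := @I 2 (f j).
Let k a B : R := 2 * tr2 ip e (f a) (Bt B).
Let kappa : {set 'I_m} -> R := cumulant P Y.
Let M A : R := E1 P (fun w => \prod_(j in A) Y j w).

(** A partition of a non-empty set has at least one block, and its integral
    is then centred. *)
Lemma E_blockI J : L2 P (blockI J) /\ E1 P (blockI J) = (J == finset.set0)%:R.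
Proof.
have cal pi : L2 P (calS I [::] Bt pi) by exact: (@L2_calS _ _ _ _ _ _ _ _ _ hI _ [::] _ pi Logic.I sB).
have E : blockI J = fun w => \sum_(pi | part pi J) 1 * calS I [::] Bt pi w.
  by apply/funext => w; apply: eq_bigr => pi _; rewrite mul1r.
split; first by rewrite E; apply: L2_comb.
rewrite E (E1_comb _ _ _).2; last by move=> pi _; apply: L2_L1.
have [->|J0] := eqVneq J finset.set0.
  rewrite (big_pred1 finset.set0) => [|pi]; last by rewrite finset.partition_set0.
  by rewrite /calS finset.enum_set0 mul1r E1_cst.
rewrite big1 // => pi piJ; rewrite mul1r; apply: (E_calI hip he hI).
  exact: sym_tensors_map.
move=> pi0; have {}pi0 : pi = finset.set0.
  by apply/eqP; rewrite -finset.cards_eq0 cardE -(size_map Bt) (pi0 : map Bt (enum pi) = [::]).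
by move: piJ J0; rewrite pi0 => /finset.cover_partition <-; rewrite /finset.cover finset.big_set0 eqxx.
Qed.

(** Among the terms of the product only the one where [f a] is contracted
    completely with a single block through [J] has non-zero mean. *)
Lemma E_I2_blockI a J : a \notin J ->
  L1 P (fun w => Y a w * blockI J w) /\ E1 P (fun w => Y a w * blockI J w) = k a J.
Proof.
move=> aJ; have LB B := (E_blockI B).1; have EB B := (E_blockI B).2.
have L : L1 P (fun w => Y a w * blockI J w) by apply: L2_mul => //; exact: (L2_I2 hI (hf a)).
split=> //.
have [L' E'] := @E1_comb _ _ _ P _ (index_enum {set 'I_m}) (fun B => B \subset J) (k a)
   (fun B => blockI (J :\: B)%SET) (fun B _ => L2_L1 (LB _)).
have L0 := L2_L1 (LB (a |: J)%SET).
transitivity (E1 P (fun w => 1 * blockI (a |: J)%SET w +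
     \sum_(B : {set 'I_m} | B \subset J) k a B * blockI (J :\: B)%SET w)).
  apply: E1_aeq; [exact: (L1_measurable L)|exact: (L1_measurable (L1_lin 1 L0 L'))|].
  by apply: filterS (I2_blockI hip he hW hI hf aJ) => w ->; rewrite mul1r.
rewrite E1_lin // EB E'.
have -> : (a |: J == finset.set0)%SET = false.
  by apply/negbTE/finset.set0Pn; exists a; rewrite finset.setU11.
transitivity (0 + \sum_(B : {set 'I_m} | B \subset J) (B == J)%:R * k a B).
  congr (_ + _); first exact: mulr0.
  apply: eq_bigr => B BJ; rewrite EB finset.setD_eq0 mulrC.
  by congr (_%:R * _); rewrite finset.eqEsubset BJ.
rewrite add0r (bigD1 J) //= eqxx mul1r big1 ?addr0 // => B /andP[_ /negPf ->].
exact: mul0r.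
Qed.

Let M0 : M finset.set0 = 1.
Proof. by rewrite /M; under eq_fun do rewrite finset.big_set0; rewrite E1_cst. Qed.

Let Ym j : measurable_fun setT (Y j). Proof. exact: mRV. Qed.

Let prodm A : measurable_fun setT (fun w => \prod_(j in A) Y j w).
Proof.
rewrite (_ : (fun w => _) = (fun w => \prod_(j in A) Y j w)) //.
elim: (index_enum _) => [|j s IH]; first by under eq_fun do rewrite big_nil; exact: measurable_cst.
case jA: (j \in A); under eq_fun do rewrite big_cons jA; last by [].
by apply: measurable_funM.
Qed.

(** Joint induction. The Wick product and the sum over partitions satisfy
    the same recursion in [a], because contracting [f a] with a whole block
    produces the cumulants of [a |: B]. Taking expectations in the resulting
    expansion of the product of all variables then identifies the next
    cumulants, the other terms being centred. *)
Lemma wick_blockI A :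
  (fun w => wickf (fun j => Y j w) kappa A) =a blockI A /\
  (forall a, a \notin A -> kappa (a |: A)%SET = k a A).
Proof.
have [n] := ubnP #|A|; elim: n => // n IH in A *; rewrite ltnS => An.
have IHs B : B \subset A -> B != A ->
    (fun w => wickf (fun j => Y j w) kappa B) =a blockI B /\
    (forall a, a \notin B -> kappa (a |: B)%SET = k a B).
  move=> BA nBA; apply: IH; apply: leq_trans An; apply: fintype.proper_card.
  by rewrite finset.properEneq nBA.
have wA : (fun w => wickf (fun j => Y j w) kappa A) =a blockI A.
  have [A0|[a aA]] := finset.set_0Vmem A.
    apply: aeq_eq; apply/funext => w; rewrite A0 wickf0 /blockI.
    rewrite (big_pred1 finset.set0) => [|pi]; last by rewrite finset.partition_set0.
    by rewrite /calS finset.enum_set0.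
  have aD : a \notin (A :\ a)%SET by rewrite finset.setD11.
  have sub B : B \subset (A :\ a)%SET -> B \subset A /\ B != A.
    move=> BA; split; first exact: fintype.subset_trans BA (finset.subD1set _ _).
    by apply: contraL aA => /eqP <-; apply: contra aD; exact: (fintype.subsetP BA).
  rewrite -(finset.setD1K aA).
  have H1 : (fun w => wickf (fun j => Y j w) kappa (A :\ a)%SET) =a blockI (A :\ a)%SET.
    by have [s1 s2] := sub _ (fintype.subxx _); have [] := IHs _ s1 s2.
  have H2 : (fun w => conv (fun B => kappa (a |: B)%SET) (wickf (fun j => Y j w) kappa) (A :\ a)%SET) =a
      (fun w => \sum_(B : {set 'I_m} | B \subset (A :\ a)%SET) k a B * blockI (A :\ a :\: B)%SET w).
    apply: aeq_sum => B BA; have [s1 s2] := sub _ BA.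
    have aB : a \notin B by apply: contra aD; exact: (fintype.subsetP BA).
    rewrite (IHs _ s1 s2).2 //; apply: aeq_scale.
    have [t1 t2] := sub _ (finset.subsetDl (A :\ a)%SET B); exact: (IHs _ t1 t2).1.
  have H3 := I2_blockI hip he hW hI hf aD.
  apply: (aeq_trans (Y := fun w => Y a w * blockI (A :\ a)%SET w -
     \sum_(B : {set 'I_m} | B \subset (A :\ a)%SET) k a B * blockI (A :\ a :\: B)%SET w)).
    by apply: filterS2 H1 H2 => w h1 h2; rewrite wickf_setU1 // h1 h2.
  by apply: filterS H3 => w ->; rewrite /k addrK.
split=> // a aA.
have wS B : B \subset A -> (fun w => wickf (fun j => Y j w) kappa B) =a blockI B.
  by move=> BA; have [->//|nBA] := eqVneq B A; exact: (IHs B BA nBA).1.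
have LE B (BA : B \subset A) : a \notin (A :\: B)%SET by rewrite finset.in_setD negb_and aA orbT.
have [L' E'] := @E1_comb _ _ _ P _ (index_enum {set 'I_m}) (fun B => B \subset A) (expp kappa)
   (fun B w => Y a w * blockI (A :\: B)%SET w) (fun B BA => (E_I2_blockI (LE B BA)).1).
(* the product over [A] is expanded into Wick products, which are known to be
   sums over partitions, and only contractions with [f a] have non-zero mean *)
have Mk : M (a |: A)%SET = conv (k a) M A.
  rewrite convC; transitivity (E1 P (fun w => \sum_(B : {set 'I_m} | B \subset A)
      expp kappa B * (Y a w * blockI (A :\: B)%SET w))).
    apply: E1_aeq; [exact: prodm|exact: (L1_measurable L')|].
    apply: (aeq_trans (Y := fun w => Y a w * conv (expp kappa) (wickf (fun j => Y j w) kappa) A)).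
      by apply: aeq_eq; apply/funext => w; rewrite finset.big_setU1 //= (prod_wickf _ kappa).
    apply: (aeq_trans (Y := fun w => \sum_(B : {set 'I_m} | B \subset A)
        expp kappa B * (Y a w * wickf (fun j => Y j w) kappa (A :\: B)%SET))).
      by apply: aeq_eq; apply/funext => w; rewrite mulr_sumr; apply: eq_bigr => B _; rewrite mulrCA.
    apply: aeq_sum => B BA; apply: aeq_scale; apply: aeq_mul; first exact: aeq_refl.
    exact: wS (finset.subsetDl _ _).
  rewrite E'; apply: eq_bigr => B BA; rewrite (E_I2_blockI (LE B BA)).2.
  by rewrite -(expp_logp M0).
have Lk : conv (fun B => kappa (a |: B)%SET) M A = conv (k a) M A.
  by rewrite -Mk; exact: (conv_logp M0 aA).
apply: (conv_cancel M0 _ Lk) => B BA nBA; apply: (IHs B BA nBA).2.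
by apply: contra aA; exact: (fintype.subsetP BA).
Qed.

Lemma cumulant_trace a A : a \notin A -> cumulant P Y (a |: A)%SET = k a A.
Proof. exact: (wick_blockI A).2. Qed.

Lemma wick_productE : wick_product P Y =a blockI [set: 'I_m]%SET.
Proof.
apply: aeq_trans (wick_blockI _).1; apply: aeq_eq; apply/funext => w.
apply: eq_big => [J|J _]; first by rewrite finset.subsetT.
by congr (_ * _); rewrite /expp finset.setTD; apply: eq_bigr => pi _; rewrite prodrN.
Qed.

End Moments.

(** * Cycles and their traces *)

Section CycleGraphs.
Import boot.fintype boot.finset.
Variable m : nat.
Implicit Types (s t : seq 'I_m) (a : 'I_m) (E : {set 'I_m}).

Lemma cycle_edgesE a s : cycle_edges (a :: s) = path_edges (a :: rcons s a).
Proof.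
rewrite /cycle_edges /path_edges rot1_cons [behead _]/=; congr map.
rewrite -(rcons_cons a s a).
have h (u v : seq 'I_m) : size u = size v -> zip (rcons u a) v = zip u v.
  by elim: u v => [|x u IH] [|y v] //= [] /IH ->.
by rewrite h // size_rcons.
Qed.

(** The edges of the cycle at [a] are those joining it to the ends of the
    remaining path. *)
Lemma path_edges_mid a s E : a \notin s ->
  (E \in path_edges s) = (E \in cycle_edges (a :: s)) && (a \notin E).
Proof.
rewrite cycle_edgesE; case: s => [|b s] aN.
  apply/esym/negbTE/negP => /andP[]; rewrite mem_seq1 => /eqP ->.
  by rewrite !inE eqxx.
rewrite -[path_edges (a :: _)]/([set a; b] :: path_edges (rcons (b :: s) a)).
have [p [c E1]] : exists p c, b :: s = rcons p c.
  by case/lastP: (b :: s) (isT : b :: s != [::]) => [|p c] //; exists p, c.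
rewrite E1 path_edges_rcons -E1 inE mem_rcons inE.
have [Es|Es] /= := boolP (E \in path_edges (b :: s)).
  by rewrite !orbT /=; apply/esym; apply: contra aN; exact: mem_path_edges Es.
rewrite orbF; apply/esym/negbTE/negP => /andP[/orP[]/eqP ->]; by rewrite !inE eqxx ?orbT.
Qed.

Lemma count_cycle_graph s E : (size s <= m)%N ->
  (cycle_graph s E : nat) = count_mem E (cycle_edges s).
Proof.
move=> sm; rewrite ffunE inordK // ltnS (leq_trans (count_size _ _)) //.
by rewrite size_map size_zip size_rot minnn.
Qed.

Lemma cycle_graph_rev a s : cycle_graph (a :: rev s) = cycle_graph (a :: s).
Proof.
apply/ffunP => E; rewrite !ffunE; congr inord.
have -> : cycle_edges (a :: rev s) = rev (cycle_edges (a :: s)).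
  by rewrite !cycle_edgesE -path_edges_rev rev_cons rev_rcons.
by rewrite count_rev.
Qed.

(** Cycles through the same vertices coincide only if the paths left by
    deleting [a] have the same edges. *)
Lemma cycle_graph_inj a (B : {set 'I_m}) s t : a \notin B -> (#|B| < m)%N -> s \in ords B -> t \in ords B ->
  (cycle_graph (a :: s) == cycle_graph (a :: t)) = (s == t) || (s == rev t).
Proof.
move=> aB Bm sB tB.
have aN r : r \in ords B -> a \notin r.
  by rewrite mem_ords => /andP[_ /eqP rE]; move: aB; rewrite -rE inE.
have sz r : r \in ords B -> (size (a :: r) <= m)%N by move=> /size_ords /= ->.
apply/eqP/idP => [E|/orP[]/eqP ->//]; last exact: cycle_graph_rev.
have /andP[us /eqP sE] : uniq s && ([set x in s] == B) by rewrite -mem_ords.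
have /andP[ut /eqP tE] : uniq t && ([set x in t] == B) by rewrite -mem_ords.
have [] : s = t \/ s = rev t; [|by move=> ->; rewrite eqxx|by move=> ->; rewrite eqxx orbT].
apply: path_unique => //; first by apply: uniq_perm => // x; have /setP/(_ x) := etrans sE (esym tE); rewrite !inE.
move=> F; rewrite !(path_edges_mid _ (aN _ _)) //; congr (_ && _).
have in_cnt r : r \in ords B -> (F \in cycle_edges (a :: r)) = (0 < cycle_graph (a :: r) F)%N.
  by move=> rB; rewrite count_cycle_graph ?sz // -has_count has_pred1.
by rewrite !in_cnt // E.
Qed.

Lemma ords_setC1 a t : uniq (a :: t) -> size (a :: t) = m ->
  t \in ords (~: [set a]).
Proof.
rewrite cons_uniq => /andP[aN ut] sm; rewrite mem_ords ut /= eqEcard.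
have -> : #|[set x in t]| = size t by rewrite cardsE; exact/card_uniqP.
have sz : #|~: [set a]| = size t.
  by rewrite cardsC1 card_ord; exact: (congr1 predn (esym sm)).
rewrite sz leqnn andbT; apply/subsetP => x; rewrite !inE => xt.
by apply: contraNneq aN => <-.
Qed.

Lemma cycle_orientation_ords (a : 'I_m) G s : (a : nat) = m.-1 -> cycle_orientation G s ->
  [/\ s = a :: behead s, behead s \in ords (~: [set a]) & cycle_graph (a :: behead s) = G].
Proof.
move=> am /and4P[us /eqP sm hs /eqP sG]; case: s us sm hs sG => [|b t] // us sm /eqP[ba] sG.
have -> : a = b by apply: val_inj; rewrite /= am ba.
by split=> //; exact: ords_setC1.
Qed.

(** Every cycle is met twice when the orderings of the other vertices are
    listed, except for the double edge, which is its own reversal. *)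
Lemma sum_cycles (M : nmodType) (a : 'I_m) (g : seq 'I_m -> M) (ori : multigraph m -> seq 'I_m) :
  (a : nat) = m.-1 -> (forall G, G \in cycles m -> cycle_orientation G (ori G)) ->
  (forall s, g (rev s) = g s) ->
  \sum_(s <- ords (~: [set a])) g s =
  \sum_(G in cycles m) g (behead (ori G)) *+ (if (m <= 2)%N then 1 else 2)%N.
Proof.
move=> am hori gr; set B := ~: [set a].
have mp : (0 < m)%N by apply: leq_ltn_trans (ltn_ord a).
have cB : #|B| = m.-1 by rewrite cardsC1 card_ord.
have aB : a \notin B by rewrite !inE eqxx.
rewrite big_seq (partition_big (fun s => cycle_graph (a :: s)) (mem (cycles m))) /=; last first.
  move=> s sB; have us : uniq (a :: s).
    move: (sB); rewrite mem_ords => /andP[us /eqP sE]; rewrite cons_uniq us andbT.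
    by move: aB; rewrite -sE inE.
  have ss : size (a :: s) == m by rewrite /= (size_ords sB) cB prednK.
  by apply/imsetP; exists (Tuple ss) => //; rewrite inE.
apply: eq_bigr => G Gc; have [_ tB tG] := cycle_orientation_ords am (hori G Gc).
have -> : (if (m <= 2)%N then 1 else 2)%N = (if (#|B| <= 1)%N then 1 else 2)%N.
  by rewrite cB -[in LHS](prednK mp) ltnS.
rewrite -(sum_orientations tB (gr _)) [RHS]big_seq_cond.
apply: eq_bigl => s; case: (boolP (s \in ords B)) => //= sB.
have Bm : (#|B| < m)%N by rewrite cB prednK.
by have := cycle_graph_inj aB Bm sB tB; rewrite tG.
Qed.

End CycleGraphs.

Section Traces.
Context (R : realType) (H : completeNormedModType R) (ip : {dot H for idfun}).
Hypothesis hip : forall x, ip x x = `|x| ^+ 2.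
Variable e : nat -> H.
Hypothesis he : orthonormal_basis ip e.
Variables (m : nat) (f : 'I_m -> form H 2).
Hypothesis hf : forall j, symmetric_tensor e (f j).
Implicit Types (s t : seq 'I_m) (a : 'I_m).

Local Notation path_op := (path_op ip e f).
Local Notation tr := (trace ip e).

(** The diagonal matrix entries of an operator and of its adjoint coincide. *)
Lemma trace_path_rev s : tr (path_op (rev s)) = tr (path_op s).
Proof.
rewrite /trace; congr (limn (series _)); apply/funext => k.
rewrite (path_op_adjoint hip he hf s) ; exact: ipC.
Qed.

Lemma cycle_op_path s : cycle_op ip e f s = path_op (rev s).
Proof.
apply/funext => y; rewrite /cycle_op /path_op -[in LHS](revK s) foldl_rev.
by [].
Qed.

Lemma HS_op_path_star s x : s <> [::] -> HS_op ip e (path_star ip e f s) x = path_op s x.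
Proof.
move=> s0; apply: (ip_ext hip) => z.
apply: (etrans (ip_HS_op hip he z x (tensor_bform (path_star_tensor hip he hf s)))).
exact: (path_star_pair hip he hf z x s0).
Qed.

(** The operator of the reversed path is that of the transposed form, and a
    trace against the symmetric [f a] does not see the transposition. *)
Lemma trace_path_rot a s : s <> [::] -> tr (path_op (rcons s a)) = tr (path_op (rcons (rev s) a)).
Proof.
move=> s0; have r0 : rev s <> [::] by move/(congr1 size); rewrite size_rev => /size0nil.
have E r : r <> [::] -> tr (path_op (rcons r a)) = tr2 ip e (path_star ip e f r) (f a).
  move=> rn; rewrite /tr2; congr trace; apply/funext => x.
  by rewrite (HS_op_path_star _ rn) -cats1 path_op_cat.
have T r := path_star_tensor hip he hf r.
have Er : transp (path_star ip e f s) = path_star ip e f (rev s).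
  apply: form2_ext => x y; apply: (etrans (path_star_pair hip he hf y x s0)).
  apply: (etrans (path_op_adjoint hip he hf s y x)); apply: (etrans (ipC _ _ _)).
  exact: esym (path_star_pair hip he hf x y r0).
rewrite !E // -Er; apply: (tr2_transp hip he (T s) _ (hf a)); rewrite Er; exact: T.
Qed.

Lemma trace_cycle_rev a s : tr (path_op (a :: rev s)) = tr (path_op (a :: s)).
Proof.
case: (s =P [::]) => [->//|s0].
rewrite -trace_path_rev -[in RHS]trace_path_rev !rev_cons revK; exact: trace_path_rot.
Qed.

(** Both orientations in the symmetrised path tensor contribute the same
    trace. *)
Lemma tr2_path_tensor a s : s <> [::] ->
  tr2 ip e (f a) (path_tensor ip e f s) = tr (path_op (a :: s)).
Proof.
move=> s0; have r0 : rev s <> [::] by move/(congr1 size); rewrite size_rev => /size0nil.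
have T r := path_star_tensor hip he hf r.
have E r : r <> [::] -> tr2 ip e (f a) (path_star ip e f r) = tr (path_op (a :: r)).
  move=> rn; rewrite /tr2; congr trace; apply/funext => x.
  by rewrite (HS_op_path_star _ rn).
have z := (symmetric_zero hip he).1.
have -> : path_tensor ip e f s =
    lin 2^-1 (path_star ip e f s) (lin 2^-1 (path_star ip e f (rev s)) (@zero_form R H)).
  apply: form2_ext => x y; apply: (etrans (path_tensor_pair hip he hf x y s0)).
  rewrite /lin /zero_form (path_star_pair hip he hf x y s0) (path_star_pair hip he hf x y r0).
  by rewrite addr0 mulrDr.
have tz := tr2_zeror hip he (hf a).1.
rewrite (tr2_linr hip he _ (T s) (tensor_lin _ (T _) z) (hf a).1).
rewrite (tr2_linr hip he _ (T _) z (hf a).1) tz !E // trace_cycle_rev.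
by move: (tr _) => u; field.
Qed.

Lemma tr2_block a (B : {set 'I_m}) : B != finset.set0 ->
  2 * tr2 ip e (f a) (block_tensor ip e f B) =
  2 ^+ #|B| * \sum_(s <- ords B) tr (path_op (a :: s)).
Proof.
move=> B0; have z := (symmetric_zero hip he).1.
have tz := tr2_zeror hip he (hf a).1.
suff L (c : R) r : tensor e (fun h => \sum_(s <- r) c * path_tensor ip e f s h) /\
    tr2 ip e (f a) (fun h => \sum_(s <- r) c * path_tensor ip e f s h) =
    \sum_(s <- r) c * tr2 ip e (f a) (path_tensor ip e f s).
  rewrite /block_tensor (L _ _).2 -mulr_sumr mulrA -exprS prednK ?finset.card_gt0 //.
  congr (_ * _); rewrite big_seq [RHS]big_seq; apply: eq_bigr => s sB.
  exact: tr2_path_tensor (ords_neq0 B0 sB).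
elim: r => [|s r [IH1 IH2]].
  rewrite big_nil (_ : (fun h => _) = @zero_form R H) //.
  by apply/funext => h; rewrite big_nil.
rewrite big_cons -IH2 (_ : (fun h => _) =
    lin c (path_tensor ip e f s) (fun h => \sum_(s <- r) c * path_tensor ip e f s h)); last first.
  by apply/funext => h; rewrite big_cons.
have Ts := (symmetric_path hip he hf s).1.
by split; [exact: tensor_lin|exact: (tr2_linr hip he c Ts IH1 (hf a).1)].
Qed.

End Traces.

(** * Linear forests *)

Section LinearForests.
Import boot.fintype boot.finset.
Variable m : nat.
Implicit Types (s t : seq 'I_m) (a x y : 'I_m) (E A B : {set 'I_m}).
Implicit Types (G : {set {set 'I_m}}) (c : seq (seq 'I_m)).

Definition edge_set s : {set {set 'I_m}} := [set E in path_edges s].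

Definition edges_of c : {set {set 'I_m}} := [set E in flatten (map (@path_edges m) c)].

(** Decompositions into paths of a graph on the vertex set [A], needed for
    the subsets [A] that remain when a component is deleted. *)
Definition path_partition A G c : bool :=
  [&& [::] \notin c, perm_eq (flatten c) (enum A) & G == edges_of c].

Definition forests A : {set {set {set 'I_m}}} := [set G | `[< exists c, path_partition A G c >]].

Lemma forestsP A G : reflect (exists c, path_partition A G c) (G \in forests A).
Proof. by rewrite inE; exact: asboolP. Qed.

Lemma edges_of_cons s c : edges_of (s :: c) = edge_set s :|: edges_of c.
Proof. by apply/setP => E; rewrite !inE mem_cat. Qed.

(** A path is connected: membership propagates along its edges in both
    directions. *)
Lemma connected_path (Q : pred 'I_m) s x y :
  (forall u v, [set u; v] \in path_edges s -> Q u -> Q v) ->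
  x \in s -> y \in s -> Q x -> Q y.
Proof.
move=> cl; suff h z r : (forall u v, [set u; v] \in path_edges (z :: r) -> Q u -> Q v) ->
    forall x, x \in z :: r -> Q x = Q z.
  by case: s cl => [|z s] // cl xs ys; rewrite (h z s cl x xs) (h z s cl y ys).
elim: r z => [|z' r IH] z {cl} cl u; first by rewrite mem_seq1 => /eqP ->.
rewrite inE => /orP[/eqP -> //|ur]; rewrite (IH z') // => [|u' v' e].
  have e : [set z; z'] \in path_edges [:: z, z' & r] by rewrite inE eqxx.
  by apply/idP/idP; apply: cl; rewrite // setUC.
by apply: cl; rewrite inE e orbT.
Qed.

Section Decomposition.
Variables (A : {set 'I_m}) (G : {set {set 'I_m}}) (c : seq (seq 'I_m)).
Hypothesis cG : path_partition A G c.

Let uf : uniq (flatten c).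
Proof. by case/and3P: cG => _ p _; rewrite (perm_uniq p) enum_uniq. Qed.

Lemma component_uniq s : s \in c -> uniq s.
Proof.
move=> sc; have := uf; rewrite (perm_uniq (perm_flatten (perm_to_rem sc))) /= cat_uniq.
by case/andP.
Qed.

Lemma component_sub s x : s \in c -> x \in s -> x \in A.
Proof.
case/and3P: cG => _ p _ sc xs; rewrite -mem_enum -(perm_mem p).
by apply/flattenP; exists s.
Qed.

Lemma component_eq s t x : s \in c -> t \in c -> x \in s -> x \in t -> s = t.
Proof.
move=> sc tc xs xt; have := uf.
rewrite (perm_uniq (perm_flatten (perm_to_rem sc))) /= cat_uniq => /and3P[_ /hasPn h _].
apply/eqP/negPn/negP => nst; have /h : x \in flatten (rem s c); last by rewrite /= xs.
apply/flattenP; exists t => //; move: tc; rewrite (perm_mem (perm_to_rem sc)) inE.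
by rewrite eq_sym (negPf nst).
Qed.

(** An edge lies in a single component. *)
Lemma component_closed s E x : s \in c -> E \in G -> x \in E -> x \in s -> E \in path_edges s.
Proof.
case/and3P: cG => _ _ /eqP ->; rewrite inE => sc /flatten_mapP[t tc Et] xE xs.
by rewrite (component_eq sc tc xs (mem_path_edges Et xE)).
Qed.

Lemma component_edges s E : s \in c -> E \in path_edges s -> E \in G.
Proof.
case/and3P: cG => _ _ /eqP -> sc Es; rewrite inE.
by apply/flatten_mapP; exists s.
Qed.

End Decomposition.

(** A component is connected and the other one is closed under edges. *)
Lemma component_subset A G c c' s t x y : path_partition A G c -> path_partition A G c' ->
  s \in c -> t \in c' -> x \in s -> x \in t -> y \in s -> y \in t.
Proof.
move=> cG cG' sc tc xs xt ys; apply: (@connected_path (mem t) s x) => // u v e ut.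
have eG := component_edges cG sc e.
have := component_closed cG' tc eG (_ : u \in _) ut; rewrite !inE eqxx => /(_ isT).
by move/mem_path_edges; apply; rewrite !inE eqxx orbT.
Qed.

(** A linear forest determines the vertices of each of its components, hence
    their edges, hence their two orientations. *)
Lemma component_unique A G c c' s t x : path_partition A G c -> path_partition A G c' ->
  s \in c -> t \in c' -> x \in s -> x \in t -> s = t \/ s = rev t.
Proof.
move=> cG cG' sc tc xs xt.
have us := component_uniq cG sc; have ut := component_uniq cG' tc.
have st y : (y \in s) = (y \in t).
  by apply/idP/idP; [exact: (component_subset cG cG' sc tc xs xt)|exact: (component_subset cG' cG tc sc xt xs)].
apply: path_unique => //; first exact: uniq_perm.
move=> F; have /orP[] := orbN ((F \in path_edges s) || (F \in path_edges t)); last first.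
  by rewrite negb_or => /andP[/negPf -> /negPf ->].
move=> Fst; have /set0Pn[y yF] : F != set0 by case/orP: Fst; exact: path_edges_neq0.
apply/idP/idP => h; have yh := mem_path_edges h yF.
  by apply: (component_closed cG' tc (component_edges cG sc h) yF); rewrite -st.
by apply: (component_closed cG sc (component_edges cG' tc h) yF); rewrite st.
Qed.

Lemma forest_edge_sub A G E : G \in forests A -> E \in G -> E != set0 /\ E \subset A.
Proof.
case/forestsP => c cG EG; have := cG; case/and3P => _ _ /eqP GE.
move: EG; rewrite GE inE => /flatten_mapP[s sc Es]; split; first exact: path_edges_neq0 Es.
by apply/subsetP => x /(mem_path_edges Es); exact: component_sub cG _ _ sc.
Qed.

Section Component.
Variables (a : 'I_m) (A : {set 'I_m}).
Hypothesis aA : a \notin A.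

Lemma ords_mem B s x : s \in ords (a |: B) -> (x \in s) = (x \in a |: B).
Proof. by rewrite mem_ords => /andP[_ /eqP <-]; rewrite inE. Qed.

Lemma path_partition_cons B s G c : B \subset A -> s \in ords (a |: B) ->
  path_partition (A :\: B) G c -> path_partition (a |: A) (edge_set s :|: G) (s :: c).
Proof.
move=> BA sB /and3P[cN pc /eqP GE]; apply/and3P; split.
- rewrite inE negb_or cN andbT; apply: contraTneq (setU11 a B) => s0.
  by rewrite -(ords_mem a sB) -s0.
- have us : uniq s by move: sB; rewrite mem_ords => /andP[].
  have uc : uniq (flatten c) by rewrite (perm_uniq pc) enum_uniq.
  have mc x : (x \in flatten c) = (x \in A :\: B) by rewrite (perm_mem pc) mem_enum.
  apply: uniq_perm; rewrite ?enum_uniq //= ?cat_uniq ?us ?uc ?andbT.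
    apply/hasPn => x; rewrite mc inE => /andP[xB xA] /=; rewrite (ords_mem x sB) !inE negb_or xB andbT.
    by apply: contraNneq aA => <-.
  move=> x; rewrite mem_cat mc (ords_mem x sB) mem_enum !inE.
  by have := subsetP BA x; case: (x == a) => //=; case: (x \in B) => //= ->.
- by rewrite edges_of_cons GE.
Qed.

Lemma path_partition_split G c : path_partition (a |: A) G c ->
  exists s B G' c', [/\ s \in c, B \subset A, s \in ords (a |: B),
     path_partition (A :\: B) G' c' & G = edge_set s :|: G'].
Proof.
move=> cG; have := cG; case/and3P => cN pc /eqP GE.
have /flattenP[s sc as_] : a \in flatten c by rewrite (perm_mem pc) mem_enum setU11.
have us := component_uniq cG sc; have pr := perm_to_rem sc.
pose B := [set x in s] :\ a.
have aB : a |: B = [set x in s] by rewrite setD1K // inE.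
exists s, B, (edges_of (rem s c)), (rem s c).
have sB : s \in ords (a |: B) by rewrite mem_ords us aB eqxx.
have uf : uniq (flatten c) by rewrite (perm_uniq pc) enum_uniq.
have := uf; rewrite (perm_uniq (perm_flatten pr)) /= cat_uniq => /and3P[_ /hasPn dis ur].
split=> //.
- apply/subsetP => x; rewrite !inE => /andP[xa xs].
  by have := component_sub cG sc xs; rewrite !inE (negPf xa).
- apply/and3P; split=> //; first by apply: contra cN; exact: mem_rem.
  apply: uniq_perm; rewrite ?enum_uniq // => x; rewrite mem_enum !inE.
  have : (x \in flatten c) = (x \in a |: A) by rewrite (perm_mem pc) mem_enum.
  rewrite (perm_mem (perm_flatten pr)) /= mem_cat !inE.
  have [xr|xr] := boolP (x \in flatten (rem s c)).
    have /negPf := dis x xr; rewrite /= => xs; rewrite xs /= andbF /=.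
    by case: eqP => // xa; rewrite xa as_ in xs.
  rewrite orbF; case: eqP => [->|_] /= E; first by rewrite (negPf aA).
  by rewrite -E; case: (x \in s).
- by rewrite GE -edges_of_cons; apply/setP => E; rewrite !inE;
    apply: perm_mem; apply: perm_flatten; exact: perm_map.
Qed.

Lemma forest_edge_notin B s G E : B \subset A -> s \in ords (a |: B) -> G \in forests (A :\: B) ->
  E \in G -> E \notin edge_set s.
Proof.
move=> BA sB GF EG; have [/set0Pn[x xE] /subsetP/(_ x xE)] := forest_edge_sub GF EG.
rewrite !inE => /andP[xB xA]; apply/negP => /mem_path_edges/(_ xE).
rewrite (ords_mem x sB) !inE (negPf xB) orbF => /eqP xa.
by rewrite xa (negPf aA) in xA.
Qed.

(** The edges of the component of [a] and of the remaining forest are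
    disjoint, so the latter is recovered by difference. *)
Lemma forest_setU_inj B s G1 G2 : B \subset A -> s \in ords (a |: B) ->
  G1 \in forests (A :\: B) -> G2 \in forests (A :\: B) ->
  edge_set s :|: G1 = edge_set s :|: G2 -> G1 = G2.
Proof.
move=> BA sB f1 f2 E; have n1 := forest_edge_notin BA sB f1; have n2 := forest_edge_notin BA sB f2.
apply/setP => F; have /setP/(_ F) := E; rewrite !in_setU.
have [F1|F1] := boolP (F \in G1); first by rewrite (negPf (n1 F F1)).
have [F2|F2] := boolP (F \in G2); first by rewrite (negPf (n2 F F2)).
by [].
Qed.

Lemma edge_set_rev s : edge_set (rev s) = edge_set s.
Proof. by apply/setP => E; rewrite !inE path_edges_rev mem_rev. Qed.

(** The two orientations of a non-trivial path share its weight. *)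
Definition orientation_weight (R : fieldType) s : R := if (size s <= 1)%N then 1 else 2^-1.

(** Deleting the component of [a] from a linear forest leaves a linear
    forest, and the component is counted with the weights of its
    orientations. *)
Lemma sum_forests (R : numFieldType) (g : {set {set 'I_m}} -> R) :
  \sum_(G in forests (a |: A)) g G =
  \sum_(B : {set 'I_m} | B \subset A) \sum_(s <- ords (a |: B))
    \sum_(G in forests (A :\: B)) orientation_weight R s * g (edge_set s :|: G).
Proof.
(* the number of forests that complete the path [s] to [G] *)
pose hit B s G : R := \sum_(G' in forests (A :\: B)) (edge_set s :|: G' == G)%:R.
transitivity (\sum_(B : {set 'I_m} | B \subset A) \sum_(s <- ords (a |: B))
    \sum_(G in forests (a |: A)) orientation_weight R s * hit B s G * g G); last first.
  apply: eq_bigr => B BA; rewrite big_seq [RHS]big_seq; apply: eq_bigr => s sB.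
  under eq_bigr do rewrite mulrAC /hit mulr_sumr.
  rewrite exchange_big /=; apply: eq_bigr => G' /forestsP[c cG'].
  have GF : edge_set s :|: G' \in forests (a |: A).
    by apply/forestsP; exists (s :: c); exact: (path_partition_cons BA sB cG').
  rewrite (bigD1 (edge_set s :|: G')) //= eqxx mulr1 big1 ?addr0 // => G /andP[_ /negPf nG].
  by rewrite eq_sym nG mulr0.
under [RHS]eq_bigr do rewrite exchange_big /=.
rewrite [RHS]exchange_big /=; apply: eq_bigr => G /forestsP[c cG].
under [RHS]eq_bigr do rewrite -mulr_suml.
rewrite -[LHS]mul1r -[RHS]mulr_suml; congr (_ * _).
have [s0 [B0 [G0 [c0 [s0c B0A s0B c0G GE]]]]] := path_partition_split cG.
have as0 : a \in s0 by rewrite (ords_mem a s0B) setU11.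
have hitE B s : B \subset A -> s \in ords (a |: B) -> hit B s G = ((s == s0) || (s == rev s0))%:R.
  move=> BA sB; have [/orP ss0|nss0] := boolP ((s == s0) || (s == rev s0)).
    have BE : B = B0.
      have : a |: B = a |: B0.
        apply/setP => x; rewrite -(ords_mem x sB) -(ords_mem x s0B).
        by case: ss0 => /eqP ->; rewrite ?mem_rev.
      move/setP => E; apply/setP => x; have := E x; rewrite !inE; case: eqP => // -> _.
      by rewrite (negPf (contra (subsetP BA a) aA)) (negPf (contra (subsetP B0A a) aA)).
    rewrite BE in BA sB *; have G0F : G0 \in forests (A :\: B0) by apply/forestsP; exists c0.
    have GE' : edge_set s :|: G0 = G by case: ss0 => /eqP ->; rewrite ?edge_set_rev.
    rewrite /hit (bigD1 G0) //= GE' eqxx big1 ?addr0 // => G' /andP[GF' /negPf nG'].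
    case: eqP => // E'; move: nG'.
    by rewrite (forest_setU_inj BA sB GF' G0F (etrans E' (esym GE'))) eqxx.
  rewrite /hit big1 // => G' /forestsP[c' cG']; case: eqP => // E'.
  have cG2 := path_partition_cons BA sB cG'; rewrite E' in cG2.
  have as_ : a \in s by rewrite (ords_mem a sB) setU11.
  case: (component_unique cG2 cG (mem_head _ _) s0c as_ as0) nss0 => ->; rewrite eqxx ?orbT //.
rewrite (bigD1 B0) //= [X in _ + X]big1 ?addr0; last first.
  move=> B /andP[BA /eqP nB]; rewrite big_seq big1 // => s sB; rewrite hitE //.
  case: (boolP (_ || _)) => [/orP ss0|_]; last by rewrite mulr0.
  case: nB; have : a |: B = a |: B0.
    apply/setP => x; rewrite -(ords_mem x sB) -(ords_mem x s0B).
    by case: ss0 => /eqP ->; rewrite ?mem_rev.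
  move/setP => E; apply/setP => x; have := E x; rewrite !inE; case: eqP => // -> _.
  by rewrite (negPf (contra (subsetP BA a) aA)) (negPf (contra (subsetP B0A a) aA)).
apply: esym; transitivity (\sum_(s <- ords (a |: B0) | (s == s0) || (s == rev s0)) orientation_weight R s).
  rewrite [RHS]big_mkcond /= big_seq [RHS]big_seq; apply: eq_bigr => s sB; rewrite hitE //.
  by case: ifP; rewrite ?mulr1 ?mulr0.
rewrite (sum_orientations s0B); last by rewrite /orientation_weight size_rev.
rewrite /orientation_weight (size_ords s0B); case: ifP => // _.
by rewrite mulr2n; field.
Qed.

Lemma cover_edge_set s x : (1 < size s)%N -> (x \in cover (edge_set s)) = (x \in s).
Proof.
move=> s1; apply/bigcupP/idP => [[E]|]; first by rewrite inE; exact: mem_path_edges.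
suff h : forall z z' r, x \in [:: z, z' & r] ->
    exists2 E, E \in path_edges [:: z, z' & r] & x \in E.
  by case: s s1 => [|z [|z' r]] // _ /h[E Es xE]; exists E => //; rewrite inE.
move=> z z' r; elim: r z z' => [|w r IH] z z' xs.
  by exists [set z; z']; [rewrite inE eqxx|move: xs; rewrite !inE].
move: xs; rewrite inE => /orP[/eqP ->|/IH[E Es xE]].
  by exists [set z; z']; rewrite !inE eqxx.
by exists E => //; rewrite inE Es orbT.
Qed.

(** A component with at least two vertices adds all of them to the
    non-isolated ones, and an isolated vertex none. *)
Lemma card_non_isolated (R : numFieldType) B s G : B \subset A -> s \in ords (a |: B) ->
  G \in forests (A :\: B) ->
  orientation_weight R s * 2 ^+ #|cover (edge_set s :|: G)| = 2 ^+ #|B| * 2 ^+ #|cover G|.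
Proof.
move=> BA sB GF; have aB : a \notin B by apply: contra aA; exact: (subsetP BA).
have sz : size s = #|B|.+1 by rewrite (size_ords sB) cardsU1 aB.
have -> : cover (edge_set s :|: G) = cover (edge_set s) :|: cover G by exact: boot.finset.bigcup_setU.
have dis : cover (edge_set s) :&: cover G = set0.
  apply/setP => x; rewrite inE [RHS]inE; apply/negbTE/negP => /andP[/bigcupP[E]]; rewrite inE => Es xE.
  case/bigcupP => F FG xF; have [_ /subsetP/(_ x xF)] := forest_edge_sub GF FG.
  have := mem_path_edges Es xE; rewrite (ords_mem x sB) !inE => /orP[/eqP ->|->//].
  by rewrite (negPf aA) andbF.
rewrite cardsU dis cards0 subn0 exprD mulrA; congr (_ * _); rewrite /orientation_weight sz ltnS leqn0.
have [B0|B0] := eqVneq #|B| 0%N.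
  rewrite B0 expr0 mul1r (_ : cover _ = set0) ?cards0 //.
  apply/setP => x; rewrite inE; apply/negbTE/negP => /bigcupP[E]; rewrite inE.
  by case: s {sB dis} sz => [|z [|z' r]] //; rewrite B0.
have -> : #|cover (edge_set s)| = #|B|.+1.
  rewrite -sz (size_ords sB).
  by apply: eq_card => x; rewrite cover_edge_set ?(ords_mem x sB) // sz ltnS lt0n.
by rewrite exprS; field.
Qed.

End Component.

End LinearForests.

(** * Integrals over linear forests *)

Section ForestSums.
Context (R : realType) (H : completeNormedModType R) (ip : {dot H for idfun}).
Hypothesis hip : forall x, ip x x = `|x| ^+ 2.
Variable e : nat -> H.
Hypothesis he : orthonormal_basis ip e.
Context (d : measure_display) (Omega : measurableType d) (P : probability Omega R).
Variable W : H -> {RV P >-> R}.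
Hypothesis hW : isonormal ip W.
Variable I : forall n, form H n -> {RV P >-> R}.
Hypothesis hI : forall n, (0 < n)%N -> multiple_integral ip e W (@I n).
Variables (m : nat) (f : 'I_m -> form H 2).
Hypothesis hf : forall j, symmetric_tensor e (f j).
Implicit Types (A B C J : {set 'I_m}) (pi G : {set {set 'I_m}}) (a : 'I_m).
Implicit Types (s t : seq 'I_m) (c : seq (seq 'I_m)) (l : seq (form H 2)).

Local Notation "X =a Y" := (aeq P X Y) (at level 70).
Local Notation sym2 := (@symmetric_tensor R H e 2).
Local Notation syms := (sym_tensors e).
Local Notation calI := (calI I).
Local Notation calS := (calS I).
Local Notation Bt := (block_tensor ip e f).
Local Notation pt := (path_tensor ip e f).
Local Notation part := finset.partition.

Let sB B : sym2 (Bt B). Proof. exact: symmetric_block. Qed.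
Let spt s : sym2 (pt s). Proof. exact: symmetric_path. Qed.

(** The fixed factors [l] are given labels of their own. *)
Lemma calI_perm_tail (V : finType) (F : V -> form H 2) l (r1 r2 : seq V) : syms l ->
  (forall i, sym2 (F i)) -> uniq r1 -> perm_eq r1 r2 ->
  calI (l ++ [seq F i | i <- r1]) =a calI (l ++ [seq F i | i <- r2]).
Proof.
move=> sl sF ur p; pose z := @zero_form R H.
pose F' (v : 'I_(size l) + V) := match v with inl i => nth z l i | inr v => F v end.
have sF' v : sym2 (F' v).
  have sn k i : syms k -> (i < size k)%N -> sym2 (nth z k i).
    by elim: k i => [|g k IH] [|i] //= [sg sk] ltik //; exact: IH.
  by case: v => [i|v] //=; exact: sn.
have E r : l ++ [seq F i | i <- r] =
    [seq F' v | v <- map inl (enum 'I_(size l)) ++ map inr r].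
  rewrite map_cat -(map_comp F' inl) -(map_comp F' inr); congr (_ ++ _).
  apply: (etrans (esym (mkseq_nth z l))); rewrite /mkseq -val_enum_ord -(map_comp (nth z l) val).
  reflexivity.
rewrite !E; apply: (calI_family_perm hip he hW hI sF'); last by rewrite perm_cat2l perm_map.
have il : injective (@inl 'I_(size l) V) by move=> ? ? [].
have ir : injective (@inr 'I_(size l) V) by move=> ? ? [].
rewrite cat_uniq (map_inj_uniq il) (map_inj_uniq ir) enum_uniq ur andbT /=.
by apply/hasPn => _ /mapP[v _ ->]; apply/negP => /mapP[].
Qed.

Lemma flatten_uniq (T : eqType) (c : seq (seq T)) : [::] \notin c -> uniq (flatten c) -> uniq c.
Proof.
elim: c => //= s c IH; rewrite inE negb_or cat_uniq => /andP[s0 cN] /and3P[_ /hasPn dis uc].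
rewrite IH // andbT; apply/negP => sc; case: s s0 dis sc => // x s _ dis sc.
have /dis : x \in flatten c by apply/flattenP; exists (x :: s); rewrite ?mem_head.
by rewrite /= mem_head.
Qed.

Let vset s : {set 'I_m} := finset (fun x => x \in s).

Lemma path_partition_match A G c c' s : path_partition A G c -> path_partition A G c' ->
  s \in c -> exists2 t, t \in c' & t = s \/ t = rev s.
Proof.
move=> cG cG' sc; have := cG; case/and3P => cN _ _.
case: s sc => [|x s] sc; first by rewrite sc in cN.
have xA := component_sub cG sc (mem_head x s).
have /flattenP[t tc xt] : x \in flatten c'.
  by case/and3P: cG' => _ p _; rewrite (perm_mem p) mem_enum.
by exists t => //; exact: (component_unique cG' cG tc sc xt (mem_head x s)).
Qed.

(** Two decompositions of the same forest have the same components up to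
    orientation, which path tensors do not see, and up to order, which
    integrals do not see. *)
Lemma calI_forest A G c c' l : syms l -> path_partition A G c -> path_partition A G c' ->
  calI (l ++ map pt c) =a calI (l ++ map pt c').
Proof.
move=> sl cG cG'.
have vr s : vset (rev s) = vset s by apply/finset.setP => x; rewrite !inE mem_rev.
(* both lists of components are read through their vertex sets *)
pose F B : form H 2 := pt (nth [::] c (find (fun s => vset s == B) c)).
have sF B : sym2 (F B) by exact: spt.
have vinj c0 (cG0 : path_partition A G c0) : {in c0 &, injective vset}.
  move=> s t sc tc E; have := cG0; case/and3P => cN _ _.
  case: s sc E => [|x s] sc E; first by rewrite sc in cN.
  apply: (component_eq cG0 sc tc (mem_head x s)).
  by have /finset.setP/(_ x) := E; rewrite !inE eqxx => <-.
have Fc s : s \in c -> F (vset s) = pt s.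
  move=> sc; congr pt; have hs : has (fun t => vset t == vset s) c by apply/hasP; exists s.
  by apply: (vinj c cG) => //; [rewrite mem_nth -?has_find|exact/eqP/(nth_find [::] hs)].
have Fc' t : t \in c' -> F (vset t) = pt t.
  move=> tc; have [s sc [sE|sE]] := path_partition_match cG' cG tc.
    by rewrite -sE; exact: Fc.
  by rewrite -[vset t]vr -(path_tensor_rev hip he hf t) -sE; exact: Fc.
have E1 : map pt c = map F (map vset c) by rewrite -map_comp; apply/eq_in_map => s /= /Fc.
have E2 : map pt c' = map F (map vset c') by rewrite -map_comp; apply/eq_in_map => s /= /Fc'.
have uv c0 (cG0 : path_partition A G c0) : uniq (map vset c0).
  rewrite map_inj_in_uniq; last exact: vinj.
  case/and3P: cG0 => cN p _; apply: flatten_uniq => //.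
  by rewrite (perm_uniq p) enum_uniq.
have sub c1 c2 (c1G : path_partition A G c1) (c2G : path_partition A G c2) B :
    B \in map vset c1 -> B \in map vset c2.
  case/mapP => s sc ->; have [t tc ts] := path_partition_match c1G c2G sc.
  by apply/mapP; exists t => //; case: ts => ->; rewrite ?vr.
rewrite E1 E2; apply: calI_perm_tail => //; first exact: uv.
apply: uniq_perm; [exact: uv|exact: uv|].
by move=> B; apply/idP/idP; [exact: (sub c c')|exact: (sub c' c)].
Qed.

Lemma syms_rcons l g : syms l -> sym2 g -> syms (rcons l g).
Proof. by move=> sl sg; rewrite -cats1; apply/sym_tensors_cat. Qed.

Lemma exists_components : exists cdec : {set 'I_m} -> {set {set 'I_m}} -> seq (seq 'I_m),
  forall A G, G \in forests A -> path_partition A G (cdec A G).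
Proof.
have /choice[h hh] : forall p : {set 'I_m} * {set {set 'I_m}}, exists c,
    p.2 \in forests p.1 -> path_partition p.1 p.2 c.
  move=> [A G]; have [/forestsP[c cG]|GN] := boolP (G \in forests A); first by exists c.
  by exists [::] => /= GF; case/negP: GN.
by exists (fun A G => h (A, G)) => A G; exact: (hh (A, G)).
Qed.

(** Linearity of the integral in the slot of the block. *)
Lemma calI_block l A (q : seq {set 'I_m}) : syms l -> A != finset.set0 ->
  calI (l ++ Bt A :: map Bt q) =a
  (fun w => \sum_(s <- ords A) 2 ^+ #|A|.-1 * calI (l ++ pt s :: map Bt q) w).
Proof.
move=> sl A0; have sq := sym_tensors_map q sB.
have Dl : @ae_linear R H e d Omega P (fun g => calI (l ++ g :: map Bt q)).
  by move=> c g h sg sh; exact: (calI_lin hI c sl sq sg sh).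
have z := symmetric_zero hip he.
have [_ E] := ae_linear_sum (ords A) predT (2 ^+ #|A|.-1) Dl spt z.
rewrite (_ : Bt A = (fun x => @zero_form R H x + \sum_(s <- ords A) 2 ^+ #|A|.-1 * pt s x)); last first.
  by apply/funext => x; rewrite /zero_form add0r.
apply: aeq_trans E _.
by apply: filterS (ae_linear0 hip he Dl) => w ->; rewrite add0r.
Qed.

(** Induction on the vertex set: the component of [a] is split off on one
    side, the block of [a] on the other, and the orderings of the block list
    the possible components with both orientations. The prefix [l] collects
    the components already split off. *)
Lemma forest_sum A l (cA : {set {set 'I_m}} -> seq (seq 'I_m)) : syms l ->
  (forall G, G \in forests A -> path_partition A G (cA G)) ->
  (fun w => \sum_(G in forests A) 2 ^+ #|finset.cover G| * calI (l ++ map pt (cA G)) w) =a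
  (fun w => \sum_(pi : {set {set 'I_m}} | part pi A) calS l Bt pi w).
Proof.
have [cdec hcdec] := exists_components.
have [n] := ubnP #|A|; elim: n => // n IH in A l cA *; rewrite ltnS => An sl hcA.
have [A0|[a aA]] := finset.set_0Vmem A.
  have c0 : path_partition A finset.set0 [::].
    rewrite /path_partition A0 finset.enum_set0 /=; apply/eqP/finset.setP => E.
    by rewrite !inE.
  have F0 : forests A = [set finset.set0]%SET.
    apply/finset.setP => G; rewrite finset.in_set1; apply/idP/eqP => [|->]; last first.
      by apply/forestsP; exists [::].
    case/forestsP => c cG; apply/finset.setP => E; rewrite [RHS]inE; apply/negbTE/negP => EG.
    have GF : G \in forests A by apply/forestsP; exists c.
    have [/finset.set0Pn[x xE] /fintype.subsetP/(_ x xE)] := forest_edge_sub GF EG.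
    by rewrite A0 inE.
  have cA0 : path_partition A finset.set0 (cA finset.set0) by apply: hcA; rewrite F0 inE.
  apply: (aeq_trans (Y := calI (l ++ map pt [::]))).
    apply: filterS (calI_forest sl cA0 c0) => w <-.
    by rewrite F0 finset.big_set1 /finset.cover finset.big_set0 finset.cards0 expr0 mul1r.
  apply: aeq_eq; apply/funext => w; rewrite (big_pred1 finset.set0) => [|pi]; last first.
    by rewrite A0 finset.partition_set0.
  by rewrite /calS finset.enum_set0.
pose A' := (A :\ a)%SET; have aA' : a \notin A' by rewrite finset.setD11.
have AE : A = (a |: A')%SET by rewrite finset.setD1K.
rewrite AE in hcA *.
have key B : B \subset A' -> (fun w => \sum_(s <- ords (a |: B)%SET)
    \sum_(G in forests (A' :\: B)%SET) orientation_weight R s *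
      (2 ^+ #|finset.cover (edge_set s :|: G)%SET| * calI (l ++ map pt (cA (edge_set s :|: G)%SET)) w)) =a
    (fun w => \sum_(pi : {set {set 'I_m}} | part pi (A' :\: B)%SET) calS l Bt ((a |: B) |: pi)%SET w).
  move=> BA.
  have aB : a \notin B by apply: contra aA'; exact: (fintype.subsetP BA).
  have aB0 : (a |: B)%SET != finset.set0 by apply/finset.set0Pn; exists a; rewrite finset.setU11.
  have cB : #|(a |: B)%SET|.-1 = #|B| by rewrite finset.cardsU1 aB.
  apply: (aeq_trans (Y := fun w => \sum_(s <- ords (a |: B)%SET) 2 ^+ #|B| *
     \sum_(G in forests (A' :\: B)%SET) 2 ^+ #|finset.cover G| *
        calI (rcons l (pt s) ++ map pt (cdec (A' :\: B)%SET G)) w)).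
    apply: aeq_sum_seq => s sB'.
    apply: (aeq_trans (Y := fun w => \sum_(G in forests (A' :\: B)%SET) 2 ^+ #|B| *
      (2 ^+ #|finset.cover G| * calI (rcons l (pt s) ++ map pt (cdec (A' :\: B)%SET G)) w))).
      apply: aeq_sum => G GF; have cG := path_partition_cons aA' BA sB' (hcdec _ _ GF).
      have cG' : path_partition (a |: A')%SET (edge_set s :|: G)%SET (cA (edge_set s :|: G)%SET).
        by apply: hcA; apply/forestsP; eexists; exact: cG.
      apply: filterS (calI_forest sl cG' cG) => w ->.
      by rewrite (mulrA (orientation_weight R s)) (card_non_isolated aA' R BA sB' GF) -mulrA cat_rcons.
    by apply: aeq_eq; apply/funext => w; rewrite mulr_sumr.
  apply: (aeq_trans (Y := fun w => \sum_(s <- ords (a |: B)%SET) 2 ^+ #|B| *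
     \sum_(pi : {set {set 'I_m}} | part pi (A' :\: B)%SET) calS (rcons l (pt s)) Bt pi w)).
    apply: aeq_sum_seq => s _; apply: aeq_scale; apply: IH; [|exact: syms_rcons|exact: hcdec].
    apply: leq_trans An; rewrite AE finset.cardsU1 aA' add1n ltnS.
    exact: fintype.subset_leq_card (finset.subsetDl _ _).
  apply: aeq_sym; apply: (aeq_trans (Y := fun w =>
     \sum_(pi : {set {set 'I_m}} | part pi (A' :\: B)%SET) \sum_(s <- ords (a |: B)%SET)
       2 ^+ #|B| * calS (rcons l (pt s)) Bt pi w)).
    apply: aeq_sum => pi piA; have Bpi : (a |: B)%SET \notin pi.
      apply/negP => /(finset.partitionS piA)/fintype.subsetP/(_ a).
      by rewrite !inE eqxx /= andbF => /(_ isT).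
    apply: (aeq_trans (Y := calI (l ++ Bt (a |: B)%SET :: map Bt (enum pi)))).
      apply: (calI_perm_tail (r2 := (a |: B)%SET :: enum pi)) => //; first exact: enum_uniq.
      apply: uniq_perm; rewrite /= ?enum_uniq ?mem_enum ?Bpi // => C.
      by rewrite mem_enum !inE mem_enum.
    apply: aeq_trans (calI_block _ sl aB0) _; apply: aeq_eq; apply/funext => w.
    by apply: eq_bigr => s _; rewrite cB /calS cat_rcons.
  by apply: aeq_eq; apply/funext => w; rewrite exchange_big /=; apply: eq_bigr => s _; rewrite mulr_sumr.
apply: (aeq_trans (Y := fun w => \sum_(B : {set 'I_m} | B \subset A')
   \sum_(pi : {set {set 'I_m}} | part pi (A' :\: B)%SET) calS l Bt ((a |: B) |: pi)%SET w)).
  apply: (aeq_trans (Y := fun w => \sum_(B : {set 'I_m} | B \subset A') \sum_(s <- ords (a |: B)%SET)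
    \sum_(G in forests (A' :\: B)%SET) orientation_weight R s *
      (2 ^+ #|finset.cover (edge_set s :|: G)%SET| * calI (l ++ map pt (cA (edge_set s :|: G)%SET)) w))).
    by apply: aeq_eq; apply/funext => w; rewrite (sum_forests aA').
  by apply: aeq_sum => B BA; exact: key.
by apply: aeq_eq; apply/funext => w; rewrite (sum_partition_at (fun pi => calS l Bt pi w) aA').
Qed.

End ForestSums.

(** * Cumulants and change of chaos *)

Section Closing.
Context (R : realType) (H : completeNormedModType R) (ip : {dot H for idfun}).
Hypothesis hip : forall x, ip x x = `|x| ^+ 2.
Variable e : nat -> H.
Hypothesis he : orthonormal_basis ip e.
Context (d : measure_display) (Omega : measurableType d) (P : probability Omega R).
Variable W : H -> {RV P >-> R}.
Hypothesis hW : isonormal ip W.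
Variable I : forall n, form H n -> {RV P >-> R}.
Hypothesis hI : forall n, (0 < n)%N -> multiple_integral ip e W (@I n).
Variable m : nat.
Hypothesis hm : (2 <= m)%N.

Let last_lt : (m.-1 < m)%N. Proof. by rewrite prednK // (leq_trans _ hm). Qed.
Let a : 'I_m := Ordinal last_lt.

(** Paths through the vertices other than the last one, closed up at the
    last one, as cycles are listed. *)
Lemma cumulant_orderings (f : 'I_m -> form H 2) : (forall j, symmetric_tensor e (f j)) ->
  cumulant P (fun j => @I 2 (f j)) [set: 'I_m]%SET =
  2 ^+ m.-1 * \sum_(s <- ords (finset.setC [set a]%SET)) trace ip e (path_op ip e f (a :: s)).
Proof.
move=> hf; set B := finset.setC _.
have cB : #|B| = m.-1 by rewrite finset.cardsC1 card_ord.
have aB : a \notin B by rewrite !inE eqxx.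
have TE : [set: 'I_m]%SET = (a |: B)%SET by rewrite finset.setUCr.
have B0 : B != finset.set0 by rewrite -finset.card_gt0 cB -ltnS prednK // (leq_trans _ hm).
rewrite TE (cumulant_trace hip he hW hI hf aB) (tr2_block hip he hf a B0).
by rewrite cB.
Qed.

Lemma conform_formE n n' (F : form H n) : n = n' -> @I n' (conform_form n' F) = @I n F.
Proof.
move=> nn; case: n' / nn; congr (I _); rewrite /conform_form; case: eqP => // E.
by apply/funext => h; congr F; apply/funext => i /=; congr h; exact: val_inj.
Qed.

Lemma path_decompositionE G c : @path_decomposition m G c = path_partition [set: 'I_m]%SET G c.
Proof.
rewrite /path_decomposition /path_partition; congr [&& _, _ & _].
have p : perm_eq (enum 'I_m) (enum [set: 'I_m]%SET).
  by apply: uniq_perm; rewrite ?enum_uniq // => x; rewrite !mem_enum !inE.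
by rewrite -(permPr p).
Qed.

Lemma linear_forestsE : linear_forests m = forests [set: 'I_m]%SET.
Proof.
apply/finset.setP => G; rewrite !inE; congr (`[< _ >]); apply/propext.
by split=> -[c]; rewrite ?path_decompositionE => h; exists c; rewrite ?path_decompositionE.
Qed.

End Closing.

Theorem proposition4p6 (R : realType) (H : completeNormedModType R)
  (ip : {dot H for idfun}) (hip : forall x, ip x x = `|x| ^+ 2)
  (hsep : separable H) (e : nat -> H) (he : orthonormal_basis ip e)
  (d : measure_display) (Omega : measurableType d) (P : probability Omega R)
  (W : H -> {RV P >-> R}) (hW : isonormal ip W)
  (I : forall n, form H n -> {RV P >-> R})
  (hI : forall n, (0 < n)%N -> multiple_integral ip e W (@I n))
  (m : nat) (hm : (2 <= m)%N)
  (f : 'I_m -> form H 2) (hf : forall j, symmetric_tensor e (f j))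
  (* an orientation of every cycle, and of the components of every forest *)
  (ori : multigraph m -> seq 'I_m)
  (hori : forall G, G \in cycles m -> cycle_orientation G (ori G))
  (cmp : {set {set 'I_m}} -> seq (seq 'I_m))
  (hcmp : forall G, G \in linear_forests m -> path_decomposition G (cmp G)) :
  [/\ cumulant P (fun j => I 2%N (f j)) [set: 'I_m]%SET
        = 2 ^+ m.-1 * (if m == 2%N then 1 else 2) *
          \sum_(G in cycles m) trace ip e (cycle_op ip e f (ori G)),
      forall g : form H 2, symmetric_tensor e g ->
        cumulant P (fun _ : 'I_m => I 2%N g) [set: 'I_m]%SET
          = 2 ^+ m.-1 * (m.-1)`!%:R * trace ip e (iter m (HS_op ip e g))
    & {ae P, forall w,
        wick_product P (fun j => I 2%N (f j)) w
          = \sum_(G in linear_forests m) 2 ^+ #|non_isolated G| *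
              I (2 * m - 2 * #|G|)%N
                (conform_form (2 * m - 2 * #|G|)%N (forest_tensor ip e f (cmp G))) w}].
Proof.
have m0 : (0 < m)%N by exact: leq_trans hm.
split.
- rewrite (cumulant_orderings hip he hW hI hm hf) -mulrA; congr (_ * _).
  set a := Ordinal _.
  rewrite (@sum_cycles _ _ a (fun s => trace ip e (path_op ip e f (a :: s))) ori erefl hori); last first.
    by move=> s; exact: (trace_cycle_rev hip he hf).
  rewrite mulr_sumr; apply: eq_bigr => G Gc.
  have [oE _ _] := cycle_orientation_ords (a := a) erefl (hori G Gc).
  rewrite cycle_op_path (trace_path_rev hip he hf) [in RHS]oE.
  have -> : (m <= 2)%N = (m == 2)%N by rewrite eqn_leq hm andbT.
  by case: (m == 2)%N; rewrite ?mul1r // mulr_natl.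
- move=> g sg; rewrite (cumulant_orderings hip he hW hI hm (fun=> sg)) -mulrA; congr (_ * _).
  set a := Ordinal _; set B := finset.setC _.
  have cB : #|B| = m.-1 by rewrite finset.cardsC1 card_ord.
  have pE (s : seq 'I_m) y : path_op ip e (fun=> g) s y = iter (size s) (HS_op ip e g) y.
    by elim: s => //= j s ->.
  rewrite big_seq (eq_bigr (fun=> trace ip e (iter m (HS_op ip e g)))) => [|s sB].
    rewrite -big_seq big_const_seq count_predT iter_addr_0 mulr_natl; congr (_ *+ _).
    by rewrite size_permutations ?enum_uniq // -cardE cB.
  congr trace; apply/funext => y; rewrite pE /= (size_ords sB) cB.
  by rewrite -iterS prednK.
- apply: filterS2 (wick_productE hip he hW hI hf)
    (forest_sum hip he hW hI hf (l := [::]) (A := [set: 'I_m]%SET) (cA := cmp) Logic.I _) => [w -> E|G].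
    rewrite /blockI -E linear_forestsE; apply: eq_bigr => G GF; congr (_ * _).
    have cG : path_decomposition G (cmp G) by apply: hcmp; rewrite linear_forestsE.
    rewrite conform_formE; last by rewrite size_map; exact: (path_decomposition_size cG).
    rewrite /forest_tensor sym_bigprodE /= /calI.
    case E': (map _ _) => [|p l] //; case/and3P: cG => _ pc _.
    have c0 : cmp G = [::] by apply: size0nil; rewrite -(size_map (path_tensor ip e f)) E'.
    by move: hm; rewrite -[m]size_enum_ord -(perm_size pc) c0.
  by rewrite -linear_forestsE -path_decompositionE; exact: hcmp.
Qed.
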